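(* Assume Continuity, Strong convexity, Stochastic noise, Unbiased compression and Point-wise bounded heterogeneity (all stated in the context). Let the iterates be generated by CM-SOBA with $\beta<\min\{\frac2{\mu_g+L_g},\frac{\mu_gn}{8\omega_\ell L_g^2}\}$, $\gamma\le\min\{\frac1{L_g},\frac{\mu_gn}{36\omega_\ell L_g^2}\}$, $\theta\le\min\{1,\frac n{12\omega_u}\}$, $\rho\ge C_f/\mu_g$ and $\alpha\le\min\{\frac1{2L_{\nabla\Phi}},C_2\}$, where $$C_2^{-2}=2\Big(\frac{2L_{\nabla\Phi}^2}{\theta^2}+\frac{26(L_2^2+25\kappa_g^2L_1^2)L_{y^\star}^2}{\beta^2\mu_g^2}+\frac{78L_g^2L_{z^\star}^2}{\gamma^2\mu_g^2}\Big).$$ Then \begin{align*} &\frac1K\sum_{k=0}^{K-1}\mathbb E\|\nabla\Phi(x^k)\|_2^2\le\frac{4\Delta_\Phi^0}{K\alpha}+\frac{2\Delta_x^0}{K\theta}+\frac{26(L_2^2+25\kappa_g^2L_1^2)\Delta_y^0}{\mu_gK\beta}+\frac{52L_g^2\Delta_z^0}{\mu_gK\gamma}+\frac{52(1+\omega_\ell)(L_2^2+25\kappa_g^2L_1^2)\beta}{\mu_gn}\sigma^2\\ &+\Big(\frac{2(1+\omega_u)\theta}{n}+\frac{78L_g^2(1+\omega_\ell)\gamma}{\mu_gn}\Big)\sigma_1^2+\Big(\frac{12\rho^2\omega_u\theta}{n}+\frac{104(L_2^2+25\kappa_g^2L_1^2)\omega_\ell\beta}{n\mu_g}+\frac{312L_g^2\rho^2\omega_\ell\gamma}{n\mu_g}\Big)b_g^2+\Big(\frac{12\omega_u\theta}{n}+\frac{312L_g^2\omega_\ell\gamma}{n\mu_g}\Big)b_f^2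 . \end{align*} If one further chooses $\rho=C_f/\mu_g$, $\alpha=(2L_{\nabla\Phi}+C_2^{-1})^{-1}$, $$\beta=\Big(\tfrac{\mu_g+L_g}2+\tfrac{8\omega_\ell L_g^2}{\mu_gn}+\sqrt{\tfrac{2K((1+\omega_\ell)\sigma^2+2\omega_\ell b_g^2)}{n\Delta_y^0}}\Big)^{-1},$$ $$\gamma=\Big(L_g+\tfrac{36\omega_\ell L_g^2}{\mu_gn}+\sqrt{\tfrac{3K((1+\omega_\ell)\sigma_1^2+4\omega_\ell b_f^2+4\omega_\ell(C_f^2/\mu_g^2)b_g^2)}{2n\Delta_z^0}}\Big)^{-1},$$ $$\theta=\Big(1+\tfrac{12\omega_u}n+\sqrt{\tfrac{K((1+\omega_u)\sigma_1^2+6\omega_ub_f^2+6\omega_u(C_f^2/\mu_g^2)b_g^2)}{n\Delta_x^0}}\Big)^{-1},$$ then CM-SOBA converges as order $$\frac1K\sum_{k=0}^{K-1}\mathbb E\|\nabla\Phi(x^k)\|_2^2=\mathcal O\Big(\frac{\sqrt{(1+\omega_u+\omega_\ell)\Delta}\,\sigma+\sqrt{(\omega_u+\omega_\ell)\Delta}\,(b_f+b_g)}{\sqrt{nK}}+\frac{(1+\omega_u/n+\omega_\ell/n)\Delta}{K}\Big).$$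
   Context: Setting. $n\ge1$ workers; $f_i,g_i:\mathbb R^{d_x}\times\mathbb R^{d_y}\to\mathbb R$ with $f_i(x,y)=\mathbb E_{\phi\sim\mathcal D_{f_i}}[F(x,y;\phi)]$, $g_i(x,y)=\mathbb E_{\xi\sim\mathcal D_{g_i}}[G(x,y;\xi)]$; $f=\frac1n\sum_if_i$, $g=\frac1n\sum_ig_i$; $y^\star(x)=\arg\min_yg(x,y)$; $\Phi(x)=f(x,y^\star(x))$; $z^\star(x)=-[\nabla^2_{yy}g(x,y^\star(x))]^{-1}\nabla_yf(x,y^\star(x))$. $\nabla^2_{xy}g\in\mathbb R^{d_x\times d_y}$; $\|\cdot\|_2$ is the Euclidean norm of vectors and the spectral norm of matrices. $K\ge1$ is the number of iterations. Continuity: for all $i$, $f_i$ is $C_f$-Lipschitz in $y$, and $\nabla f_i,\nabla g_i,\nabla^2_{xy}g_i,\nabla^2_{yy}g_i$ are Lipschitz in $(x,y)$ with constants $L_f,L_g,L_{g_{xy}},L_{g_{yy}}$. Strong convexity: every $g_i$ is $\mu_g$-strongly convex in $y$. Stochastic noise: at every $(x,y)$, for every $i$, $\nabla F(x,y;\phi)$, $\nabla_yG(x,y;\xi)$, $\nabla^2_{xy}G(x,y;\xi)$, $\nabla^2_{yy}G(x,y;\xi)$ are unbiased estimates of $\nabla f_i,\nabla_yg_i,\nabla^2_{xy}g_i,\nabla^2_{yy}g_i$, each with mean squared error (in $\|\cdot\|_2$) at most $\sigma^2$. Unbiased compression: a random map $\mathcal C$ is $\omega$-unbiased ($\omega\ge0$)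 if $\mathbb E[\mathcal C(v)]=v$ and $\mathbb E\|\mathcal C(v)-v\|_2^2\le\omega\|v\|_2^2$ for all $v$. The upper-level compressors $\mathcal C_i^u$ are $\omega_u$-unbiased, the lower-level compressors $\mathcal C_i^\ell$ are $\omega_\ell$-unbiased; fresh randomness is used at each call, and outputs of different workers are mutually independent conditioned on the inputs. Point-wise bounded heterogeneity: for all $x$, at the point $(x,y^\star(x))$, for all $i$, $\|\nabla f_i-\nabla f\|_2^2\le b_f^2$, and $\|\nabla_yg_i-\nabla_yg\|_2^2$, $\|\nabla^2_{xy}g_i-\nabla^2_{xy}g\|_2^2$, $\|\nabla^2_{yy}g_i-\nabla^2_{yy}g\|_2^2\le b_g^2$. CM-SOBA. Positive parameters $\alpha,\beta,\gamma,\theta,\rho$; initial $x^0,y^0,z^0,h_x^0$ with $\|z^0\|_2\le\rho$. At iteration $k$, each worker $i$ draws fresh independent samples $\phi_i^k\sim\mathcal D_{f_i}$, $\xi_i^k\sim\mathcal D_{g_i}$ and forms $D_{x,i}^k=\nabla_{xy}^2G(x^k,y^k;\xi_i^k)z^k+\nabla_xF(x^k,y^k;\phi_i^k)$, $D_{y,i}^k=\nabla_yG(x^k,y^k;\xi_i^k)$, $D_{z,i}^k=\nabla_{yy}^2G(x^k,y^k;\xi_i^k)z^k+\nabla_yF(x^k,y^k;\phi_i^k)$. Then $h_x^{k+1}=(1-\theta)h_x^k+\frac\theta n\sum_i\mathcal C_i^u(D_{x,i}^k)$, $x^{k+1}=x^k-\alpha h_x^k$, $y^{k+1}=y^k-\frac\beta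 n\sum_i\mathcal C_i^\ell(D_{y,i}^k)$, $\tilde z^{k+1}=z^k-\frac\gamma n\sum_i\mathcal C_i^\ell(D_{z,i}^k)$, $z^{k+1}=\min\{1,\rho/\|\tilde z^{k+1}\|_2\}\tilde z^{k+1}$. Constants. $\kappa_g=L_g/\mu_g$, $L_1^2=L_f^2+L_{g_{yy}}^2\rho^2$, $L_2^2=L_f^2+L_{g_{xy}}^2\rho^2$, $\sigma_1^2=\sigma^2(1+\rho^2)$. $L_{\nabla\Phi},L_{y^\star},L_{z^\star}>0$ are Lipschitz constants of $\nabla\Phi,y^\star,z^\star$ (they exist under Continuity and Strong convexity). $\Delta_\Phi^0=\Phi(x^0)$, $\Delta_x^0=\|h_x^0-\nabla\Phi(x^0)\|_2^2$, $\Delta_y^0=\|y^0-y^\star(x^0)\|_2^2$, $\Delta_z^0=\|z^0-z^\star(x^0)\|_2^2$, $\Delta=\max\{\Delta_\Phi^0,\Delta_x^0,\Delta_y^0,\Delta_z^0\}$. Parameter upper bounds with a zero denominator are read as $+\infty$.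
   Formalization: Φ ≥ 0 is assumed (otherwise shifting f by a constant makes the bound false); in the rate, the hidden constant may depend on a bound for Δ/Δ_x^0, Δ/Δ_y^0, Δ/Δ_z^0, each of these errors being positive unless the matching noise term is zero. *)

(* Defs.v *)
From HB Require Import structures.
From mathcomp Require Import all_boot all_order all_algebra.
From mathcomp Require Import all_classical all_reals all_analysis.

Set Implicit Arguments.
Unset Strict Implicit.
Unset Printing Implicit Defensive.

Import Order.TTheory GRing.Theory Num.Theory.
Import numFieldNormedType.Exports.

Local Open Scope classical_set_scope.
Local Open Scope ring_scope.

(* The library norm on matrices is the entrywise maximum. It serves only for
   the topology and differentiability; all quantitative statements use the
   two norms below. *)
Definition l2norm (R : realType) (m : nat) (v : 'cV[R]_m) : R :=
  Num.sqrt (\sum_i v i 0 ^+ 2).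

Definition specnorm (R : realType) (m n : nat) (A : 'M[R]_(m, n)) : R :=
  sup [set l2norm (A *m v) | v in [set v : 'cV[R]_n | l2norm v <= 1]].

Definition borel (T : ptopologicalType) := g_sigma_algebraType (@open T).

Section Derivatives.
Context {R : realType} {dx dy : nat}.

Definition grad (m : nat) (f : 'cV[R]_m -> R) (x : 'cV[R]_m) : 'cV[R]_m :=
  \col_i 'D_(delta_mx i 0) f x.

Implicit Types f : 'cV[R]_dx -> 'cV[R]_dy -> R.

Definition grad_x f x y : 'cV[R]_dx := grad (fun x' => f x' y) x.
Definition grad_y f x y : 'cV[R]_dy := grad (f x) y.
Definition grad_full f x y : 'cV[R]_(dx + dy) :=
  col_mx (grad_x f x y) (grad_y f x y).

(* Entry (i, j) is the derivative in x_i, resp. y_i, of the j-th entry of the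
   y-gradient. *)
Definition hess_xy f x y : 'M[R]_(dx, dy) :=
  \matrix_(i, j) grad_x (fun x' y' => grad_y f x' y' j 0) x y i 0.
Definition hess_yy f x y : 'M[R]_dy :=
  \matrix_(i, j) grad_y (fun x' y' => grad_y f x' y' j 0) x y i 0.

Definition joint_differentiable (W : normedModType R)
    (f : 'cV[R]_dx -> 'cV[R]_dy -> W) : Prop :=
  forall p : 'cV[R]_dx * 'cV[R]_dy,
    differentiable (fun q : 'cV[R]_dx * 'cV[R]_dy => f q.1 q.2) p.

Definition joint_lipschitz (W : zmodType) (nrm : W -> R) (L : R)
    (f : 'cV[R]_dx -> 'cV[R]_dy -> W) : Prop :=
  forall x y x' y',
    nrm (f x y - f x' y') <= L * l2norm (col_mx (x - x') (y - y')).

End Derivatives.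

Section Randomness.
Context {R : realType}.

Definition unbiased d (S : measurableType d) (D : probability S R) (m n : nat)
    (X : S -> 'M[R]_(m, n)) (A : 'M[R]_(m, n)) : Prop :=
  forall i j, ('E_D[fun s => X s i j] = (A i j)%:E)%E.

Definition mse_le d (S : measurableType d) (D : probability S R) (m n : nat)
    (nrm : 'M[R]_(m, n) -> R) (X : S -> 'M[R]_(m, n)) (A : 'M[R]_(m, n))
    (e : R) : Prop :=
  ('E_D[fun s => (nrm (X s - A) ^+ 2)%R] <= e%:E)%E.

(* A random map is a measurable function of its input and of a random seed. *)
Definition unbiased_compressor d (S : measurableType d) (Q : probability S R)
    (m : nat) (omega : R) (C : 'cV[R]_m -> S -> 'cV[R]_m) : Prop :=
  measurable_fun setT
    (fun p : borel 'cV[R]_m * S => C p.1 p.2 : borel 'cV[R]_m)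
  /\ forall v : 'cV[R]_m,
      unbiased Q (C v) v
      /\ mse_le Q (@l2norm R m) (C v) v (omega * l2norm v ^+ 2).

Definition mutually_independent d (W : measurableType d) (P : probability W R)
    (I : eqType) (E : I -> set (set W)) : Prop :=
  forall (J : seq I) (A : I -> set W), uniq J ->
    (forall i, i \in J -> E i (A i)) ->
    (P (\big[setI/setT]_(i <- J) A i) = \prod_(i <- J) P (A i))%E.

Definition has_law d (W : measurableType d) (P : probability W R)
    d' (S : measurableType d') (X : W -> S) (D : probability S R) : Prop :=
  measurable_fun setT X
  /\ forall A, measurable A -> P (X @^-1` A) = D A.

End Randomness.

Record regularity (R : realType) := Regularity {
  C_f : R; L_f : R; L_g : R; L_gxy : R; L_gyy : R; mu_g : R;
  L_Phi : R; L_ystar : R; L_zstar : R }.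

Record noise (R : realType) := Noise {
  sigma : R; b_f : R; b_g : R; omega_u : R; omega_l : R }.

Record parameters (R : realType) := MkParameters {
  alpha : R; beta : R; gamma : R; theta : R; rho : R }.

Record iterate (R : realType) (dx dy : nat) := Iterate {
  it_x : 'cV[R]_dx; it_y : 'cV[R]_dy; it_z : 'cV[R]_dy; it_h : 'cV[R]_dx }.

(* The five sources of randomness of a worker in one iteration: the two data
   samples and the seeds of the compressions of D_x, D_y and D_z. *)
Inductive source := SrcF | SrcG | SrcX | SrcY | SrcZ.
HB.instance Definition _ := gen_eqMixin source.

Section CMSOBA.
Context {R : realType} {n dx dy : nat}.
Context {d_f d_g d_u d_l : measure_display}.
Context {Sf : measurableType d_f} {Sg : measurableType d_g}.
Context {Su : measurableType d_u} {Sl : measurableType d_l}.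

Record problem := Problem {
  F_ : 'cV[R]_dx -> 'cV[R]_dy -> Sf -> R;
  G_ : 'cV[R]_dx -> 'cV[R]_dy -> Sg -> R;
  D_f : 'I_n -> probability Sf R;
  D_g : 'I_n -> probability Sg R }.

Record compressors := Compressors {
  C_u : 'I_n -> 'cV[R]_dx -> Su -> 'cV[R]_dx;
  Q_u : 'I_n -> probability Su R;
  C_l : 'I_n -> 'cV[R]_dy -> Sl -> 'cV[R]_dy;
  Q_l : 'I_n -> probability Sl R }.

Section Objective.
Variable p : problem.

Definition f_ (i : 'I_n) x y : R := \int[D_f p i]_s F_ p x y s.
Definition g_ (i : 'I_n) x y : R := \int[D_g p i]_s G_ p x y s.
Definition f_avg x y : R := n%:R^-1 * \sum_i f_ i x y.
Definition g_avg x y : R := n%:R^-1 * \sum_i g_ i x y.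

(* Strong convexity makes the minimizer exist and be unique. *)
Definition ystar (x : 'cV[R]_dx) : 'cV[R]_dy :=
  xget 0 [set y | forall y', g_avg x y <= g_avg x y'].
Definition Phi x : R := f_avg x (ystar x).
Definition zstar x : 'cV[R]_dy :=
  - (invmx (hess_yy g_avg x (ystar x)) *m grad_y f_avg x (ystar x)).

Definition F_at s x y : R := F_ p x y s.
Definition G_at s x y : R := G_ p x y s.

(* What the notation of the problem presupposes: the expectations defining f_i
   and g_i exist, the derivatives in use exist, and the stochastic oracles are
   measurable. *)
Definition well_posed : Prop :=
  (forall i x y,
     (D_f p i).-integrable setT (EFin \o F_ p x y)
     /\ (D_g p i).-integrable setT (EFin \o G_ p x y))
  /\ (forall i, joint_differentiable (f_ i) /\ joint_differentiable (g_ i)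
      /\ joint_differentiable (grad_y (g_ i)))
  /\ (forall s, joint_differentiable (F_at s))
  /\ (forall s, joint_differentiable (G_at s)
      /\ joint_differentiable (grad_y (G_at s)))
  /\ measurable_fun setT
       (fun q : borel 'cV[R]_dx * borel 'cV[R]_dy * Sf =>
          grad_full (F_at q.2) q.1.1 q.1.2 : borel 'cV[R]_(dx + dy))
  /\ measurable_fun setT
       (fun q : borel 'cV[R]_dx * borel 'cV[R]_dy * Sg =>
          grad_y (G_at q.2) q.1.1 q.1.2 : borel 'cV[R]_dy)
  /\ measurable_fun setT
       (fun q : borel 'cV[R]_dx * borel 'cV[R]_dy * Sg =>
          hess_xy (G_at q.2) q.1.1 q.1.2 : borel 'M[R]_(dx, dy))
  /\ measurable_fun setT
       (fun q : borel 'cV[R]_dx * borel 'cV[R]_dy * Sg =>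
          hess_yy (G_at q.2) q.1.1 q.1.2 : borel 'M[R]_dy).

Definition continuity (c : regularity R) : Prop :=
  forall i,
    (forall x y y', `|f_ i x y - f_ i x y'| <= C_f c * l2norm (y - y'))
    /\ joint_lipschitz (@l2norm R _) (L_f c) (grad_full (f_ i))
    /\ joint_lipschitz (@l2norm R _) (L_g c) (grad_full (g_ i))
    /\ joint_lipschitz (@specnorm R _ _) (L_gxy c) (hess_xy (g_ i))
    /\ joint_lipschitz (@specnorm R _ _) (L_gyy c) (hess_yy (g_ i)).

Definition strong_convexity (mu : R) : Prop :=
  0 < mu /\
  forall i x y y' (t : R), 0 <= t <= 1 ->
    g_ i x (t *: y + (1 - t) *: y')
    <= t * g_ i x y + (1 - t) * g_ i x y'
       - mu / 2 * t * (1 - t) * l2norm (y - y') ^+ 2.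

Definition stochastic_noise (sg : R) : Prop :=
  forall i x y,
    (unbiased (D_f p i) (fun s => grad_full (F_at s) x y)
       (grad_full (f_ i) x y)
     /\ mse_le (D_f p i) (@l2norm R _) (fun s => grad_full (F_at s) x y)
       (grad_full (f_ i) x y) (sg ^+ 2))
    /\ (unbiased (D_g p i) (fun s => grad_y (G_at s) x y) (grad_y (g_ i) x y)
     /\ mse_le (D_g p i) (@l2norm R _) (fun s => grad_y (G_at s) x y)
       (grad_y (g_ i) x y) (sg ^+ 2))
    /\ (unbiased (D_g p i) (fun s => hess_xy (G_at s) x y) (hess_xy (g_ i) x y)
     /\ mse_le (D_g p i) (@specnorm R _ _) (fun s => hess_xy (G_at s) x y)
       (hess_xy (g_ i) x y) (sg ^+ 2))
    /\ (unbiased (D_g p i) (fun s => hess_yy (G_at s) x y) (hess_yy (g_ i) x y)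
     /\ mse_le (D_g p i) (@specnorm R _ _) (fun s => hess_yy (G_at s) x y)
       (hess_yy (g_ i) x y) (sg ^+ 2)).

Definition bounded_heterogeneity (bf bg : R) : Prop :=
  forall x i, let y := ystar x in
    l2norm (grad_full (f_ i) x y - grad_full f_avg x y) ^+ 2 <= bf ^+ 2
    /\ l2norm (grad_y (g_ i) x y - grad_y g_avg x y) ^+ 2 <= bg ^+ 2
    /\ specnorm (hess_xy (g_ i) x y - hess_xy g_avg x y) ^+ 2 <= bg ^+ 2
    /\ specnorm (hess_yy (g_ i) x y - hess_yy g_avg x y) ^+ 2 <= bg ^+ 2.

Definition lipschitz_constants (c : regularity R) : Prop :=
  [/\ 0 < L_Phi c, 0 < L_ystar c & 0 < L_zstar c]
  /\ forall x x',
    [/\ l2norm (grad Phi x - grad Phi x') <= L_Phi c * l2norm (x - x'),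
        l2norm (ystar x - ystar x') <= L_ystar c * l2norm (x - x')
      & l2norm (zstar x - zstar x') <= L_zstar c * l2norm (x - x')].

End Objective.

Definition unbiased_compression (C : compressors) (ou ol : R) : Prop :=
  [/\ 0 <= ou, 0 <= ol &
   forall i, unbiased_compressor (Q_u C i) ou (C_u C i)
             /\ unbiased_compressor (Q_l C i) ol (C_l C i)].

Section Algorithm.
Context {d : measure_display} {W : measurableType d}.

Record randomness := Randomness {
  phi : nat -> 'I_n -> W -> Sf;
  xi : nat -> 'I_n -> W -> Sg;
  seed_x : nat -> 'I_n -> W -> Su;
  seed_y : nat -> 'I_n -> W -> Sl;
  seed_z : nat -> 'I_n -> W -> Sl }.

Definition source_events (r : randomness) (j : nat * 'I_n * source) :
    set (set W) :=
  let: (k, i, c) := j in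
  match c with
  | SrcF => preimage_set_system setT (phi r k i) measurable
  | SrcG => preimage_set_system setT (xi r k i) measurable
  | SrcX => preimage_set_system setT (seed_x r k i) measurable
  | SrcY => preimage_set_system setT (seed_y r k i) measurable
  | SrcZ => preimage_set_system setT (seed_z r k i) measurable
  end.

Definition fresh_randomness (P : probability W R) (p : problem)
    (C : compressors) (r : randomness) : Prop :=
  (forall k i,
     [/\ has_law P (phi r k i) (D_f p i),
         has_law P (xi r k i) (D_g p i),
         has_law P (seed_x r k i) (Q_u C i),
         has_law P (seed_y r k i) (Q_l C i)
       & has_law P (seed_z r k i) (Q_l C i)])
  /\ mutually_independent P (source_events r).

(* For v = 0 the quotient is 0 by convention, and the result is 0 whatever the
   scaling factor. *)
Definition clip (rad : R) (v : 'cV[R]_dy) : 'cV[R]_dy :=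
  Num.min 1 (rad / l2norm v) *: v.

Definition cm_soba_step (p : problem) (C : compressors) (a : parameters R)
    (r : randomness) (w : W) (k : nat) (s : iterate R dx dy) :
    iterate R dx dy :=
  let: Iterate x y z h := s in
  let Fi i := F_at p (phi r k i w) in
  let Gi i := G_at p (xi r k i w) in
  let D_x i := hess_xy (Gi i) x y *m z + grad_x (Fi i) x y in
  let D_y i := grad_y (Gi i) x y in
  let D_z i := hess_yy (Gi i) x y *m z + grad_y (Fi i) x y in
  Iterate
    (x - alpha a *: h)
    (y - (beta a / n%:R) *: \sum_i C_l C i (D_y i) (seed_y r k i w))
    (clip (rho a)
       (z - (gamma a / n%:R) *: \sum_i C_l C i (D_z i) (seed_z r k i w)))
    ((1 - theta a) *: h
       + (theta a / n%:R) *: \sum_i C_u C i (D_x i) (seed_x r k i w)).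

Fixpoint cm_soba (p : problem) (C : compressors) (a : parameters R)
    (r : randomness) (s0 : iterate R dx dy) (k : nat) (w : W) :
    iterate R dx dy :=
  if k is k'.+1
  then cm_soba_step p C a r w k' (cm_soba p C a r s0 k' w)
  else s0.

Definition avg_grad (P : probability W R) (p : problem) (C : compressors)
    (a : parameters R) (r : randomness) (s0 : iterate R dx dy) (K : nat) :
    \bar R :=
  ((K%:R^-1)%:E *
   \sum_(k < K)
     'E_P[fun w =>
             (l2norm (grad (Phi p) (it_x (cm_soba p C a r s0 k w))) ^+ 2)%R])%E.

(* [forall x, 0 <= Phi p x] is the normalization behind taking the initial
   optimality gap to be [Phi p x0]. *)
Definition cm_soba_setting (c : regularity R) (e : noise R) (a : parameters R)
    (P : probability W R) (p : problem) (C : compressors) (r : randomness)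
    (s0 : iterate R dx dy) (K : nat) : Prop :=
  [/\ (0 < n)%N, (0 < dx)%N, (0 < dy)%N & (0 < K)%N]
  /\ well_posed p
  /\ continuity p c
  /\ strong_convexity p (mu_g c)
  /\ (0 <= sigma e /\ stochastic_noise p (sigma e))
  /\ unbiased_compression C (omega_u e) (omega_l e)
  /\ ([/\ 0 <= b_f e & 0 <= b_g e] /\ bounded_heterogeneity p (b_f e) (b_g e))
  /\ lipschitz_constants p c
  /\ (forall x, 0 <= Phi p x)
  /\ fresh_randomness P p C r
  /\ [/\ 0 < alpha a, 0 < beta a, 0 < gamma a, 0 < theta a & 0 < rho a]
  /\ l2norm (it_z s0) <= rho a.

End Algorithm.

Section InitialErrors.
Variables (p : problem) (s0 : iterate R dx dy).

Definition Delta_Phi : R := Phi p (it_x s0).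
Definition Delta_x : R := l2norm (it_h s0 - grad (Phi p) (it_x s0)) ^+ 2.
Definition Delta_y : R := l2norm (it_y s0 - ystar p (it_x s0)) ^+ 2.
Definition Delta_z : R := l2norm (it_z s0 - zstar p (it_x s0)) ^+ 2.
Definition Delta : R :=
  Num.max Delta_Phi (Num.max Delta_x (Num.max Delta_y Delta_z)).

End InitialErrors.

End CMSOBA.

Arguments problem R n dx dy {d_f d_g} Sf Sg.
Arguments compressors R n dx dy {d_u d_l} Su Sl.
Arguments randomness n {d_f d_g d_u d_l} Sf Sg Su Sl {d} W.

Section Constants.
Context {R : realType}.
Variables (c : regularity R) (e : noise R) (a : parameters R) (n : nat).

Definition kappa_g : R := L_g c / mu_g c.
Definition L1sq : R := L_f c ^+ 2 + L_gyy c ^+ 2 * rho a ^+ 2.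
Definition L2sq : R := L_f c ^+ 2 + L_gxy c ^+ 2 * rho a ^+ 2.
Definition sigma1sq : R := sigma e ^+ 2 * (1 + rho a ^+ 2).

Definition Lmix : R := L2sq + 25 * kappa_g ^+ 2 * L1sq.

(* C_2^{-1} *)
Definition C2inv : R :=
  Num.sqrt (2 * (2 * L_Phi c ^+ 2 / theta a ^+ 2
                 + 26 * Lmix * L_ystar c ^+ 2 / (beta a ^+ 2 * mu_g c ^+ 2)
                 + 78 * L_g c ^+ 2 * L_zstar c ^+ 2
                     / (gamma a ^+ 2 * mu_g c ^+ 2))).

(* Bounds of the form n / 0 are +oo, hence the guards on omega. *)
Definition parameter_bounds : Prop :=
  [/\ beta a < 2 / (mu_g c + L_g c)
        /\ (omega_l e != 0 ->
            beta a < mu_g c * n%:R / (8 * omega_l e * L_g c ^+ 2)),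
      gamma a <= (L_g c)^-1
        /\ (omega_l e != 0 ->
            gamma a <= mu_g c * n%:R / (36 * omega_l e * L_g c ^+ 2)),
      theta a <= 1
        /\ (omega_u e != 0 -> theta a <= n%:R / (12 * omega_u e)),
      C_f c / mu_g c <= rho a
    & alpha a <= Num.min (2 * L_Phi c)^-1 C2inv^-1].

Definition bound_rhs (K : nat) (DPhi Dx Dy Dz : R) : R :=
  4 * DPhi / (K%:R * alpha a)
  + 2 * Dx / (K%:R * theta a)
  + 26 * Lmix * Dy / (mu_g c * K%:R * beta a)
  + 52 * L_g c ^+ 2 * Dz / (mu_g c * K%:R * gamma a)
  + 52 * (1 + omega_l e) * Lmix * beta a / (mu_g c * n%:R) * sigma e ^+ 2
  + (2 * (1 + omega_u e) * theta a / n%:R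
     + 78 * L_g c ^+ 2 * (1 + omega_l e) * gamma a / (mu_g c * n%:R))
    * sigma1sq
  + (12 * rho a ^+ 2 * omega_u e * theta a / n%:R
     + 104 * Lmix * omega_l e * beta a / (n%:R * mu_g c)
     + 312 * L_g c ^+ 2 * rho a ^+ 2 * omega_l e * gamma a / (n%:R * mu_g c))
    * b_g e ^+ 2
  + (12 * omega_u e * theta a / n%:R
     + 312 * L_g c ^+ 2 * omega_l e * gamma a / (n%:R * mu_g c))
    * b_f e ^+ 2.

Definition noise_y : R :=
  (1 + omega_l e) * sigma e ^+ 2 + 2 * omega_l e * b_g e ^+ 2.
Definition noise_z : R :=
  (1 + omega_l e) * sigma1sq + 4 * omega_l e * b_f e ^+ 2
  + 4 * omega_l e * (C_f c ^+ 2 / mu_g c ^+ 2) * b_g e ^+ 2.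
Definition noise_x : R :=
  (1 + omega_u e) * sigma1sq + 6 * omega_u e * b_f e ^+ 2
  + 6 * omega_u e * (C_f c ^+ 2 / mu_g c ^+ 2) * b_g e ^+ 2.

Definition parameter_choice (K : nat) (Dx Dy Dz : R) : Prop :=
  [/\ rho a = C_f c / mu_g c,
      alpha a = (2 * L_Phi c + C2inv)^-1,
      beta a = ((mu_g c + L_g c) / 2
                + 8 * omega_l e * L_g c ^+ 2 / (mu_g c * n%:R)
                + Num.sqrt (2 * K%:R * noise_y / (n%:R * Dy)))^-1,
      gamma a = (L_g c + 36 * omega_l e * L_g c ^+ 2 / (mu_g c * n%:R)
                 + Num.sqrt (3 * K%:R * noise_z / (2 * n%:R * Dz)))^-1
    & theta a = (1 + 12 * omega_u e / n%:R
                 + Num.sqrt (K%:R * noise_x / (n%:R * Dx)))^-1].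

(* In [parameter_choice] the quotient noise / D0 under a square root must make
   sense: D0 > 0, or else the noise vanishes and the term is 0. The hidden
   constant of the rate is allowed to depend on a bound [t] on the ratio of the
   largest initial error D to those appearing as such denominators: e.g. when
   D0 = Delta_x tends to 0 with everything else fixed, theta and alpha tend to 0
   and the iterates stay at x^0, so that no constant independent of the ratio
   exists. *)
Definition balanced (t noise D0 D : R) : Prop :=
  noise = 0 \/ (0 < D0 /\ D <= t * D0).

Definition balanced_errors (t Dx Dy Dz D : R) : Prop :=
  [/\ balanced t noise_x Dx D, balanced t noise_y Dy D
    & balanced t noise_z Dz D].

Definition rate (K : nat) (D : R) : R :=
  (Num.sqrt ((1 + omega_u e + omega_l e) * D) * sigma e
   + Num.sqrt ((omega_u e + omega_l e) * D) * (b_f e + b_g e))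
    / Num.sqrt (n%:R * K%:R)
  + (1 + omega_u e / n%:R + omega_l e / n%:R) * D / K%:R.

End Constants.

(* Main.v *)
(* Write X = |h - grad Phi(x)|^2, Y = |y - ystar(x)|^2 and Z = |z - zstar(x)|^2.
   From a fixed state with |z| <= rho, one step decreases the expectation of
     2 Phi / alpha + X / theta + 9 Lmix Y / (beta mu) + 8 L_g^2 Z / (gamma mu)
   by 3/4 |grad Phi(x)|^2, up to an additive constant due to the noise: the y- and
   z-steps are contractions by strong cocoercivity, clipping is nonexpansive
   because |zstar| <= rho, and compression inflates the variance by omega times a
   second moment, which bounded heterogeneity controls at (x, ystar(x)).
   The state of iteration k is a function of the earlier sources of randomness,
   so it can be integrated separately from those of iteration k. All terms are
   nonnegative, hence no integrability of the iterates is needed, and summing over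
   k gives the first bound. For the rate, the inverse of each tuned parameter is
   a sum in which the square root balances an initial error against a noise term. *)

(* The weights of the potential close a chain of payments. The descent inequality for Phi,
   multiplied by 2/alpha, yields -|grad Phi|^2 - |h|^2/2 + X, and the momentum contraction of
   X/theta gives back exactly X. The term -|h|^2/2 pays for the motion of the three targets grad
   Phi, ystar and zstar when x moves by alpha h; this is the role of C_2. What remains is
   triangular: the h-step is charged a multiple of L^2 Z + L2sq Y, the z-step a multiple of kappa^2
   L1sq Y, the y-step only its own error, so the weight of Z and then that of Y can be fixed in
   turn. The bounds on beta, gamma and theta that involve omega make each compression variance a
   fixed fraction of the decrease that it spoils; its part proportional to |grad Phi|^2 costs the
   missing quarter. In place of conditional expectations, independence is used as the product form
   of a joint law: estimates for a frozen state are integrated over the law of the state. *)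
Require Import Defs.
From HB Require Import structures.
From mathcomp Require Import all_boot all_order all_algebra.
From mathcomp Require Import all_classical all_reals all_analysis.
From mathcomp Require Import measurable_realfun ring lra.

Set Implicit Arguments.
Unset Strict Implicit.
Unset Printing Implicit Defensive.

Import Order.TTheory GRing.Theory Num.Theory.
Import numFieldNormedType.Exports.
Local Open Scope classical_set_scope.
Local Open Scope ring_scope.

(** * Independence and square integrability *)

Section Independence.
Context {R : realType} {d : measure_display} {W : measurableType d}.
Variable P : probability W R.
Local Open Scope ereal_scope.

Definition independent_systems (E1 E2 : set (set W)) : Prop :=
  forall A B, E1 A -> E2 B -> P (A `&` B) = P A * P B.

Lemma independent_systemsC E1 E2 :
  independent_systems E1 E2 -> independent_systems E2 E1.
Proof. by move=> ind A B EA EB; rewrite setIC muleC ind. Qed.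

(** Pi-lambda argument: for a fixed B, the measurable sets A that satisfy the product formula with B
    form a Dynkin system, which therefore contains the sigma-algebra generated by the
    intersection-stable [E1]. *)
Lemma independent_systems_sigma_left E1 E2 :
  E1 `<=` measurable -> setI_closed E1 -> E2 `<=` measurable ->
  independent_systems E1 E2 -> independent_systems <<s E1 >> E2.
Proof.
move=> mE1 IE1 mE2 ind A B EA EB.
have mB := mE2 _ EB.
suff : <<s E1 >> `<=` [set A | measurable A /\ P (A `&` B) = P A * P B].
  by move=> /(_ _ EA) [].
apply: lambda_system_subset; [by []| | |by []].
- apply/dynkin_lambda_system; split.
  + by split=> //; rewrite setTI probability_setT mul1e.
  + move=> C [mC PC]; split; first exact: measurableC.
    have -> : ~` C `&` B = B `\` (B `&` C) by rewrite setDIr setDv set0U setDE setIC.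
    rewrite measureD//; [|exact: measurableI|by rewrite ltey_eq fin_num_measure].
    rewrite (_ : B `&` (B `&` C) = C `&` B) ?PC; last by rewrite setIA setIid setIC.
    rewrite probability_setC// muleBl ?mul1e//.
      by congr (_ - _).
    by rewrite fin_num_measure.
  + move=> F tF mF.
    have mF' i : measurable (F i) by case: (mF i).
    split; first exact: bigcupT_measurable.
    rewrite setI_bigcupl measure_bigcup//=; last 2 first.
    * by move=> n _; exact: measurableI.
    * apply/trivIsetP => i j _ _ ij; move/trivIsetP : tF => /(_ i j I I ij) FF.
      by rewrite setIACA FF set0I.
    rewrite measure_bigcup// muleC -[X in _ = X * _](@fineK _ (P B)) ?fin_num_measure//.
    rewrite -nneseriesZl// fineK ?fin_num_measure//.
    by apply: eq_eseriesr => n _; rewrite muleC; exact: (mF n).2.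
- by move=> C EC; split; [exact: mE1|exact: ind].
Qed.

Lemma independent_systems_sigma E1 E2 :
  E1 `<=` measurable -> setI_closed E1 ->
  E2 `<=` measurable -> setI_closed E2 ->
  independent_systems E1 E2 -> independent_systems <<s E1 >> <<s E2 >>.
Proof.
move=> mE1 IE1 mE2 IE2 ind.
apply: independent_systems_sigma_left => //.
  by apply: smallest_sub => //; exact: sigma_algebra_measurable.
apply: independent_systemsC; apply: independent_systems_sigma_left => //.
exact: independent_systemsC.
Qed.

Definition independent_elements d1 d2 (T1 : measurableType d1)
    (T2 : measurableType d2) (X : W -> T1) (Y : W -> T2) : Prop :=
  forall A B, measurable A -> measurable B ->
    P (X @^-1` A `&` Y @^-1` B) = P (X @^-1` A) * P (Y @^-1` B).

(** The joint law of (X, Y) agrees with the product of the two laws on rectangles, hence everywhere,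
    and Tonelli applies. Measurability of the inner integral is recorded because that integral is
    itself integrated later. *)
Lemma ge0_integral_independent d1 d2 (T1 : measurableType d1)
    (T2 : measurableType d2) (X : W -> T1) (Y : W -> T2) (f : T1 * T2 -> \bar R) :
  measurable_fun setT X -> measurable_fun setT Y -> independent_elements X Y ->
  measurable_fun setT f -> (forall p, 0 <= f p) ->
  \int[P]_w f (X w, Y w) = \int[P]_w \int[P]_w' f (X w, Y w')
  /\ measurable_fun setT (fun w => \int[P]_w' f (X w, Y w')).
Proof.
move=> mX mY ind mf f0.
pose X' : {mfun W >-> T1} := HB.pack X (isMeasurableFun.Build _ _ _ _ X mX).
pose Y' : {mfun W >-> T2} := HB.pack Y (isMeasurableFun.Build _ _ _ _ Y mY).
have mXY : measurable_fun setT (fun w => (X w, Y w)) by exact: measurable_fun_pair.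
pose Z : {mfun W >-> (T1 * T2)%type} := HB.pack (fun w => (X w, Y w)) (isMeasurableFun.Build _ _ _ _ _ mXY).
have inner x : \int[distribution P Y']_y f (x, y) = \int[P]_w' f (x, Y w').
  rewrite ge0_integral_distribution//.
  by apply: measurableT_comp => //; exact: measurable_fun_pair.
have mF := measurable_fun_fubini_tonelli_F (m2 := distribution P Y') _ mf f0.
split; last first.
  under eq_fun do rewrite -inner.
  exact: (measurableT_comp mF).
transitivity (\int[distribution P Z]_p f p).
  by rewrite ge0_integral_distribution.
transitivity (\int[distribution P X' \x distribution P Y']_p f p).
  apply/esym/eq_measure_integral => A mA _.
  apply: product_measure_unique => // B C mB mC.
rewrite fubini_tonelli1//.
rewrite ge0_integral_distribution//.
  by apply: eq_integral => w _; rewrite /= /fubini_F inner.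
by move=> x; apply: integral_ge0 => y _.
Qed.

(** Fubini counterpart: the nonnegative version applied to |f| turns the finiteness of the iterated
    integral into integrability for the joint law. *)
Lemma integral_independent d1 d2 (T1 : measurableType d1)
    (T2 : measurableType d2) (X : W -> T1) (Y : W -> T2) (f : T1 * T2 -> \bar R) :
  measurable_fun setT X -> measurable_fun setT Y -> independent_elements X Y ->
  measurable_fun setT f ->
  (forall x, P.-integrable setT (fun w => f (x, Y w))) ->
  \int[P]_w \int[P]_w' `|f (X w, Y w')| < +oo ->
  P.-integrable setT (fun w => f (X w, Y w))
  /\ \int[P]_w f (X w, Y w) = \int[P]_w \int[P]_w' f (X w, Y w').
Proof.
move=> mX mY ind mf fx fint.
pose X' : {mfun W >-> T1} := HB.pack X (isMeasurableFun.Build _ _ _ _ X mX).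
pose Y' : {mfun W >-> T2} := HB.pack Y (isMeasurableFun.Build _ _ _ _ Y mY).
have mXY : measurable_fun setT (fun w => (X w, Y w)) by exact: measurable_fun_pair.
pose Z : {mfun W >-> (T1 * T2)%type} := HB.pack (fun w => (X w, Y w)) (isMeasurableFun.Build _ _ _ _ _ mXY).
have mfa : measurable_fun setT (fun p => `|f p|) by exact: measurableT_comp.
have iZ : P.-integrable setT (fun w => f (X w, Y w)).
  apply/integrableP; split; first exact: measurableT_comp mf mXY.
  by rewrite (ge0_integral_independent mX mY ind mfa _).1.
split=> //.
have law g : \int[distribution P Z]_p g p
    = \int[distribution P X' \x distribution P Y']_p g p.
  by apply/esym/eq_measure_integral => A mA _; apply: product_measure_unique.
have aint : (distribution P X' \x distribution P Y').-integrable setT f.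
  apply/integrableP; split=> //; rewrite -law ge0_integral_distribution//.
  by move/integrableP : iZ => [].
transitivity (\int[distribution P Z]_p f p).
  by rewrite integral_distribution.
rewrite law -integral12_prod_meas1//.
have FE : fubini_F (distribution P Y') f \o X' = fun w => \int[P]_w' f (X w, Y w').
  apply/funext => w; rewrite /= /fubini_F integral_distribution//; last first.
    exact: fx.
  by apply: measurableT_comp mf _; exact: pair1_measurable.
have mF : measurable_fun setT (fubini_F (distribution P Y') f).
  exact: measurable_fubini_F aint.
rewrite (integral_distribution (X := X') mF) ?FE//.
have mFX : measurable_fun setT (fun w => \int[P]_w' f (X w, Y w')).
  by rewrite -FE; exact: measurableT_comp mF mX.
apply/integrableP; split=> //.
apply: le_lt_trans fint.
have [_ mG] := ge0_integral_independent mX mY ind mfa (fun=> abse_ge0 _).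
apply: ge0_le_integral => //.
  exact: measurableT_comp.
move=> w _; apply: le_abse_integral => //.
by have /measurable_int := fx (X w).
Qed.

End Independence.

Section SquareIntegrable.
Context {R : realType} {d : measure_display} {W : measurableType d}.
Variable P : probability W R.

(** Measurability of X is demanded separately, since that of X^2 does not imply it. *)
Definition sq_integrable (X : W -> R) : Prop :=
  measurable_fun setT X /\ P.-integrable setT (EFin \o (fun w => X w ^+ 2)).

Lemma sq_integrable_lty (X : W -> R) : measurable_fun setT X ->
  (\int[P]_w (X w ^+ 2)%:E < +oo)%E -> sq_integrable X.
Proof.
move=> mX Xoo; split=> //; apply/integrableP; split.
  by apply/measurable_EFinP; exact: measurable_funX.
by under eq_integral => w _ do rewrite gee0_abs ?lee_fin ?sqr_ge0//.
Qed.

(** Domination by X^2 + Y^2. *)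
Lemma integrable_mul_sq (X Y : W -> R) : sq_integrable X -> sq_integrable Y ->
  P.-integrable setT (EFin \o (fun w => X w * Y w)).
Proof.
move=> [mX iX] [mY iY]; apply: (le_integrable _ _ _ (integrableD _ iX iY)) => //.
  by apply/measurable_EFinP; exact: measurable_funM.
move=> w _ /=; rewrite lee_fin [leRHS]ger0_norm ?addr_ge0 ?sqr_ge0//.
by rewrite ler_norml; have := sqr_ge0 (X w + Y w); have := sqr_ge0 (X w - Y w);
  have := sqr_ge0 (X w); have := sqr_ge0 (Y w); rewrite !expr2 => *; apply/andP; split; nra.
Qed.

Lemma sq_integrable_cst (c : R) : sq_integrable (fun=> c).
Proof.
by split; [exact: measurable_cst | exact: finite_measure_integrable_cst].
Qed.

Lemma sq_integrable_integrable (X : W -> R) : sq_integrable X ->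
  P.-integrable setT (EFin \o X).
Proof.
move=> iX; have := integrable_mul_sq iX (sq_integrable_cst 1).
by under eq_fun do rewrite mulr1.
Qed.

Lemma sq_integrableD (X Y : W -> R) : sq_integrable X -> sq_integrable Y ->
  sq_integrable (fun w => X w + Y w).
Proof.
move=> iX iY; split; first by apply: measurable_funD; [case: iX | case: iY].
have iXY := integrable_mul_sq iX iY.
have -> : EFin \o (fun w => (X w + Y w) ^+ 2)
  = ((EFin \o (fun w => (X w ^+ 2)%R)) \+ ((fun w => 2%:E * (X w * Y w)%:E) \+ (EFin \o (fun w => (Y w ^+ 2)%R))))%E.
  by apply/funext => w /=; rewrite -EFinM -!EFinD; congr EFin; ring.
apply: integrableD => //; first by case: iX.
by apply: integrableD => //; [exact: integrableZl|case: iY].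
Qed.

Lemma sq_integrableZ (c : R) (X : W -> R) : sq_integrable X ->
  sq_integrable (fun w => c * X w).
Proof.
move=> [mX iX]; split; first exact: measurable_funM.
have -> : EFin \o (fun w => (c * X w) ^+ 2)
  = (fun w => (c ^+ 2)%:E * (X w ^+ 2)%:E)%E.
  by apply/funext => w /=; rewrite -EFinM exprMn.
exact: integrableZl.
Qed.

Lemma sq_integrableB (X Y : W -> R) : sq_integrable X -> sq_integrable Y ->
  sq_integrable (fun w => X w - Y w).
Proof.
move=> iX /(sq_integrableZ (-1)) iY; have := sq_integrableD iX iY.
by under eq_fun do rewrite mulN1r.
Qed.

Lemma sq_integrable_sum (I : Type) (r : seq I) (p : pred I) (X : I -> W -> R) :
  (forall i, p i -> sq_integrable (X i)) ->
  sq_integrable (fun w => \sum_(i <- r | p i) X i w).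
Proof.
move=> iX; elim: r => [|i r IH].
  have -> : (fun w : W => \sum_(i <- [::] | p i) X i w) = cst 0.
    by apply/funext => w; rewrite big_nil.
  exact: sq_integrable_cst.
have -> : (fun w => \sum_(j <- i :: r | p j) X j w)
    = if p i then fun w => X i w + \sum_(j <- r | p j) X j w
      else fun w => \sum_(j <- r | p j) X j w.
  by apply/funext => w; rewrite big_cons; case: ifP.
case: ifPn => // pi.
by apply: sq_integrableD => //; exact: iX.
Qed.

Lemma Rintegral_sum (I : Type) (r : seq I) (X : I -> W -> R) :
  (forall i, P.-integrable setT (EFin \o X i)) ->
  \int[P]_w (\sum_(i <- r) X i w) = \sum_(i <- r) \int[P]_w X i w
  /\ P.-integrable setT (EFin \o (fun w => \sum_(i <- r) X i w)).
Proof.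
move=> iX; elim: r => [|i r [IH1 IH2]].
  have E0 : (fun w : W => \sum_(i <- [::]) X i w) = cst 0.
    by apply/funext => w; rewrite big_nil.
  by rewrite E0 big_nil Rintegral_cst// mul0r; split=> //; exact: integrable0.
have E0 : (fun w : W => \sum_(i <- i :: r) X i w) = (fun w => X i w + \sum_(i <- r) X i w).
  by apply/funext => w; rewrite big_cons.
rewrite E0 big_cons RintegralD// IH1; split=> //.
exact: integrableD (iX i) IH2.
Qed.

Lemma Rintegral_cstT (c : R) : \int[P]_w c = c.
Proof. by rewrite (Rintegral_cst P)//= probability_setT mulr1. Qed.

Lemma Rintegral_mul_independent (X Y : W -> R) :
  sq_integrable X -> sq_integrable Y -> independent_elements P X Y ->
  \int[P]_w (X w * Y w) = (\int[P]_w X w) * (\int[P]_w Y w).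
Proof.
move=> iX iY ind.
have [jX jY] := (sq_integrable_integrable iX, sq_integrable_integrable iY).
have [mX mY] := (iX.1, iY.1).
have fE (x : R) : (\int[P]_w' (x * Y w')%:E = (x * \int[P]_w Y w)%:E)%E.
  rewrite -RintegralZl// fineK// integrable_fin_num//.
  exact: (integrableZl measurableT x jY).
rewrite [LHS]/Rintegral (@integral_independent _ _ _ P _ _ _ _ X Y (fun p => (p.1 * p.2)%:E) mX mY ind _ _ _).2.
- under eq_integral do rewrite fE.
  by rewrite -/(Rintegral _ _ _) RintegralZr.
- by apply/measurable_EFinP; apply: measurable_funM; [exact: measurable_fst|exact: measurable_snd].
- by move=> x /=; exact: (integrableZl measurableT x jY).
(* The iterated integral of |x Y| factors into the product of the first absolute moments, hence is
   finite. *)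
- have jX' := integrable_norm jX; have jY' := integrable_norm jY.
  rewrite /=; under eq_integral => w _.
    under eq_integral do rewrite normrM EFinM.
    rewrite (integralZl measurableT jY').
    over.
  rewrite /= -(fineK (integrable_fin_num _ jY'))// integralZr//.
  by rewrite -(fineK (integrable_fin_num _ jX'))// -EFinM ltry.
Qed.

End SquareIntegrable.

(** * Euclidean and spectral norms *)

Section EuclideanNorm.
Context {R : realType}.

Definition dot m (u v : 'cV[R]_m) : R := \sum_i u i 0 * v i 0.

Lemma dotC m (u v : 'cV[R]_m) : dot u v = dot v u.
Proof. by apply: eq_bigr => i _; rewrite mulrC. Qed.

Lemma dotDl m (u v w : 'cV[R]_m) : dot (u + v) w = dot u w + dot v w.
Proof. by rewrite -big_split/=; apply: eq_bigr => i _; rewrite mxE mulrDl. Qed.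

Lemma dotZl m a (u w : 'cV[R]_m) : dot (a *: u) w = a * dot u w.
Proof. by rewrite mulr_sumr; apply: eq_bigr => i _; rewrite mxE mulrA. Qed.

Lemma dotDr m (u v w : 'cV[R]_m) : dot w (u + v) = dot w u + dot w v.
Proof. by rewrite dotC dotDl !(dotC w). Qed.

Lemma dotZr m a (u w : 'cV[R]_m) : dot w (a *: u) = a * dot w u.
Proof. by rewrite dotC dotZl (dotC w). Qed.

Lemma dotNl m (u w : 'cV[R]_m) : dot (- u) w = - dot u w.
Proof. by rewrite -scaleN1r dotZl mulN1r. Qed.

Lemma dotNr m (u w : 'cV[R]_m) : dot w (- u) = - dot w u.
Proof. by rewrite dotC dotNl (dotC w). Qed.

Lemma dotBl m (u v w : 'cV[R]_m) : dot (u - v) w = dot u w - dot v w.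
Proof. by rewrite dotDl dotNl. Qed.

Lemma dotBr m (u v w : 'cV[R]_m) : dot w (u - v) = dot w u - dot w v.
Proof. by rewrite dotDr dotNr. Qed.

Lemma dot0l m (w : 'cV[R]_m) : dot 0 w = 0.
Proof. by rewrite -(scale0r 0) dotZl mul0r. Qed.

Lemma dot0r m (w : 'cV[R]_m) : dot w 0 = 0.
Proof. by rewrite dotC dot0l. Qed.

Lemma dot_delta m (u : 'cV[R]_m) i : dot u (delta_mx i 0) = u i 0.
Proof.
rewrite /dot (bigD1 i)//= !mxE !eqxx mulr1 big1 ?addr0// => j ji.
by rewrite !mxE (negbTE ji) mulr0.
Qed.

Lemma dot_mulmx m n (A : 'M[R]_(m, n)) u v : dot (A *m u) v = dot u (A^T *m v).
Proof.
rewrite /dot.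
under eq_bigr do rewrite !mxE mulr_suml.
rewrite exchange_big/=; apply: eq_bigr => i _.
rewrite !mxE mulr_sumr; apply: eq_bigr => j _.
by rewrite mxE mulrA (mulrC (A j i)).
Qed.

Lemma l2norm_sqr m (v : 'cV[R]_m) : l2norm v ^+ 2 = dot v v.
Proof.
by rewrite /l2norm sqr_sqrtr//; apply: sumr_ge0 => i _; exact: sqr_ge0.
Qed.

Lemma l2norm_sqrE m (v : 'cV[R]_m) : l2norm v ^+ 2 = \sum_i v i 0 ^+ 2.
Proof. by rewrite l2norm_sqr. Qed.

Lemma l2norm_ge0 m (v : 'cV[R]_m) : 0 <= l2norm v.
Proof. exact: sqrtr_ge0. Qed.

#[local] Hint Extern 0 (is_true (0 <= l2norm _)) => exact: l2norm_ge0 : core.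

Lemma dot_ge0 m (v : 'cV[R]_m) : 0 <= dot v v.
Proof. by rewrite -l2norm_sqr sqr_ge0. Qed.

Lemma l2norm0 m : l2norm (0 : 'cV[R]_m) = 0.
Proof. by rewrite /l2norm big1 ?sqrtr0// => i _; rewrite mxE expr0n. Qed.

Lemma l2norm_eq0 m (v : 'cV[R]_m) : l2norm v = 0 -> v = 0.
Proof.
move=> v0; have : l2norm v ^+ 2 == 0 by rewrite v0 expr0n.
rewrite l2norm_sqrE psumr_eq0 => [|i _]; last exact: sqr_ge0.
move=> /allP vi; apply/colP => i; rewrite mxE.
by have := vi i (mem_index_enum _); rewrite /= sqrf_eq0 => /eqP.
Qed.

Lemma l2normZ m a (v : 'cV[R]_m) : l2norm (a *: v) = `|a| * l2norm v.
Proof.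
rewrite /l2norm; under eq_bigr do rewrite mxE exprMn.
by rewrite -mulr_sumr sqrtrM ?sqr_ge0// sqrtr_sqr.
Qed.

Lemma l2normN m (v : 'cV[R]_m) : l2norm (- v) = l2norm v.
Proof. by rewrite -scaleN1r l2normZ normrN1 mul1r. Qed.

Lemma l2normBC m (u v : 'cV[R]_m) : l2norm (u - v) = l2norm (v - u).
Proof. by rewrite -l2normN opprB. Qed.

(** Cauchy-Schwarz, from the nonnegativity of the square of |v| u - |u| v. *)
Lemma dot_le m (u v : 'cV[R]_m) : dot u v <= l2norm u * l2norm v.
Proof.
have [u0|u0] := eqVneq (l2norm u) 0.
  by rewrite (l2norm_eq0 u0) l2norm0 dot0l mul0r.
have [v0|v0] := eqVneq (l2norm v) 0.
  by rewrite (l2norm_eq0 v0) l2norm0 dot0r mulr0.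
have ugt : 0 < l2norm u by rewrite lt_def u0/=.
have vgt : 0 < l2norm v by rewrite lt_def v0/=.
have := dot_ge0 (l2norm v *: u - l2norm u *: v).
rewrite !(dotBl, dotBr, dotZl, dotZr) (dotC v u) -!l2norm_sqr => H.
have : 0 <= 2 * (l2norm u * l2norm v) * (l2norm u * l2norm v - dot u v) by nra.
by rewrite pmulr_rge0 ?subr_ge0// mulr_gt0// mulr_gt0.
Qed.

Lemma norm_dot_le m (u v : 'cV[R]_m) : `|dot u v| <= l2norm u * l2norm v.
Proof.
rewrite ler_norml dot_le andbT lerNl -dotNl.
by rewrite (le_trans (dot_le _ _))// l2normN.
Qed.

Lemma l2norm_sqrD m (u v : 'cV[R]_m) :
  l2norm (u + v) ^+ 2 = l2norm u ^+ 2 + 2 * dot u v + l2norm v ^+ 2.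
Proof. by rewrite !l2norm_sqr !(dotDl, dotDr) (dotC v u); ring. Qed.

Lemma l2norm_sqrB m (u v : 'cV[R]_m) :
  l2norm (u - v) ^+ 2 = l2norm u ^+ 2 - 2 * dot u v + l2norm v ^+ 2.
Proof. by rewrite l2norm_sqrD dotNr l2normN; ring. Qed.

Lemma ler_l2norm_sqr m n (u : 'cV[R]_m) (v : 'cV[R]_n) c : 0 <= c ->
  (l2norm u <= c * l2norm v) = (l2norm u ^+ 2 <= c ^+ 2 * l2norm v ^+ 2).
Proof. by move=> c0; rewrite -exprMn ler_pXn2r ?nnegrE ?mulr_ge0. Qed.

Lemma l2normD_le m (u v : 'cV[R]_m) : l2norm (u + v) <= l2norm u + l2norm v.
Proof.
rewrite -(@ler_pXn2r _ 2) ?nnegrE ?addr_ge0// l2norm_sqrD sqrrD.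
by rewrite lerD2r lerD2l -[leRHS]mulr_natl; have := dot_le u v; lra.
Qed.

Lemma l2normB_le m (u v : 'cV[R]_m) : l2norm (u - v) <= l2norm u + l2norm v.
Proof. by rewrite (le_trans (l2normD_le _ _))// l2normN. Qed.

Lemma l2norm_sum_le m (I : Type) (r : seq I) (v : I -> 'cV[R]_m) :
  l2norm (\sum_(i <- r) v i) <= \sum_(i <- r) l2norm (v i).
Proof.
elim: r => [|i r IH]; first by rewrite !big_nil l2norm0.
by rewrite !big_cons (le_trans (l2normD_le _ _))// lerD2l.
Qed.

Lemma coord_le_l2norm m (v : 'cV[R]_m) i : `|v i 0| <= l2norm v.
Proof.
rewrite -(@ler_pXn2r _ 2) ?nnegrE// l2norm_sqrE real_normK ?num_real//.
by rewrite (bigD1 i)//= lerDl sumr_ge0// => j _; exact: sqr_ge0.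
Qed.

Lemma l2norm_delta m (i : 'I_m) : l2norm (delta_mx i 0 : 'cV[R]_m) = 1.
Proof.
apply: (@pexpIrn _ 2) => //; rewrite ?nnegrE//.
by rewrite l2norm_sqr dot_delta mxE !eqxx expr1n.
Qed.

Lemma l2norm_le_sum m (v : 'cV[R]_m) : l2norm v <= \sum_i `|v i 0|.
Proof.
have {1}-> : v = \sum_i v i 0 *: delta_mx i 0.
  apply/colP => j; rewrite summxE (bigD1 j)//= !mxE !eqxx mulr1 big1 ?addr0//.
  by move=> k kj; rewrite !mxE eq_sym (negbTE kj) mulr0.
rewrite (le_trans (l2norm_sum_le _ _))//; apply: ler_sum => i _.
by rewrite l2normZ l2norm_delta mulr1.
Qed.

Lemma l2norm_col_mx_sqr m n (u : 'cV[R]_m) (v : 'cV[R]_n) :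
  l2norm (col_mx u v) ^+ 2 = l2norm u ^+ 2 + l2norm v ^+ 2.
Proof.
rewrite !l2norm_sqrE big_split_ord/=; congr (_ + _); apply: eq_bigr => i _.
  by rewrite col_mxEu.
by rewrite col_mxEd.
Qed.

Lemma l2norm_col_mx0 m n (u : 'cV[R]_m) : l2norm (col_mx u (0 : 'cV_n)) = l2norm u.
Proof.
apply: (@pexpIrn _ 2) => //; rewrite ?nnegrE//.
by rewrite l2norm_col_mx_sqr l2norm0 expr0n addr0.
Qed.

Lemma l2norm_col_0mx m n (v : 'cV[R]_n) : l2norm (col_mx (0 : 'cV_m) v) = l2norm v.
Proof.
apply: (@pexpIrn _ 2) => //; rewrite ?nnegrE//.
by rewrite l2norm_col_mx_sqr l2norm0 expr0n add0r.
Qed.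

Lemma l2norm_col_mxu m n (u : 'cV[R]_m) (v : 'cV[R]_n) : l2norm u <= l2norm (col_mx u v).
Proof. by rewrite -(@ler_pXn2r _ 2) ?nnegrE// l2norm_col_mx_sqr lerDl sqr_ge0. Qed.

Lemma l2norm_col_mxd m n (u : 'cV[R]_m) (v : 'cV[R]_n) : l2norm v <= l2norm (col_mx u v).
Proof. by rewrite -(@ler_pXn2r _ 2) ?nnegrE// l2norm_col_mx_sqr lerDr sqr_ge0. Qed.

Lemma l2norm_sqrD2_le m (u v : 'cV[R]_m) :
  l2norm (u + v) ^+ 2 <= 2 * l2norm u ^+ 2 + 2 * l2norm v ^+ 2.
Proof. by have := sqr_ge0 (l2norm (u - v)); rewrite l2norm_sqrB l2norm_sqrD; lra. Qed.

Lemma l2norm_sqrD3_le m (u v w : 'cV[R]_m) :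
  l2norm (u + v + w) ^+ 2
  <= 3 * l2norm u ^+ 2 + 3 * l2norm v ^+ 2 + 3 * l2norm w ^+ 2.
Proof.
have := sqr_ge0 (l2norm (u - v)); have := sqr_ge0 (l2norm (u - w)).
have := sqr_ge0 (l2norm (v - w)).
by rewrite !l2norm_sqrB !l2norm_sqrD dotDl; lra.
Qed.

(** Jensen for the square: the empirical variance around the mean is nonnegative. For n = 0 both
    sides vanish, the inverse of 0 being 0. *)
Lemma l2norm_avg_sqr_le m n (v : 'I_n -> 'cV[R]_m) :
  l2norm (n%:R^-1 *: \sum_i v i) ^+ 2 <= n%:R^-1 * \sum_i l2norm (v i) ^+ 2.
Proof.
case: n v => [|n] v; first by rewrite !big_ord0 scaler0 l2norm0 mulr0 expr0n.
set a := _ *: _.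
have : 0 <= n.+1%:R^-1 * \sum_i l2norm (v i - a) ^+ 2.
  by rewrite mulr_ge0 ?invr_ge0// sumr_ge0// => i _; exact: sqr_ge0.
under eq_bigr do rewrite l2norm_sqrB.
rewrite big_split/= sumr_const card_ord sumrB -mulr_sumr.
have -> : \sum_i dot (v i) a = n.+1%:R * l2norm a ^+ 2.
  transitivity (dot (\sum_i v i) a).
    elim/big_rec2: _ => [|i x y _ ->]; [by rewrite dot0l|by rewrite dotDl].
  have -> : \sum_i v i = n.+1%:R *: a by rewrite scalerA divff// scale1r.
  by rewrite dotZl l2norm_sqr.
rewrite -[l2norm a ^+ 2 *+ _]mulr_natl => H.
rewrite -subr_ge0; apply: le_trans H _; rewrite le_eqVlt; apply/orP; left; apply/eqP.
by field.
Qed.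

Lemma mulmx_l2norm_bounded m n (A : 'M[R]_(m, n)) (v : 'cV[R]_n) :
  l2norm (A *m v) <= (\sum_i \sum_j `|A i j|) * l2norm v.
Proof.
rewrite (le_trans (l2norm_le_sum _))// mulr_suml; apply: ler_sum => i _.
rewrite mxE (le_trans (ler_norm_sum _ _ _))// mulr_suml; apply: ler_sum => j _.
by rewrite normrM ler_wpM2l ?coord_le_l2norm.
Qed.

(** Without a bound, [sup] would only be a default value; the crude entrywise estimate is enough to
    make it the least upper bound. *)
Lemma specnorm_has_sup m n (A : 'M[R]_(m, n)) :
  has_sup [set l2norm (A *m v) | v in [set v : 'cV[R]_n | l2norm v <= 1]].
Proof.
split; first by exists (l2norm (A *m 0)), 0 => //=; rewrite l2norm0.
exists (\sum_i \sum_j `|A i j|) => _ [v /= v1 <-].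
rewrite (le_trans (mulmx_l2norm_bounded _ _))// ler_piMr//.
by rewrite sumr_ge0// => i _; rewrite sumr_ge0.
Qed.

Lemma specnorm_ge0 m n (A : 'M[R]_(m, n)) : 0 <= specnorm A.
Proof.
apply: (sup_upper_bound (specnorm_has_sup A)).
by exists 0 => /=; rewrite ?l2norm0// mulmx0 l2norm0.
Qed.

Lemma l2norm_mulmx_le m n (A : 'M[R]_(m, n)) (v : 'cV[R]_n) :
  l2norm (A *m v) <= specnorm A * l2norm v.
Proof.
have [v0|v0] := eqVneq (l2norm v) 0.
  by rewrite (l2norm_eq0 v0) mulmx0 !l2norm0 mulr0.
have vgt : 0 < l2norm v by rewrite lt_def v0/=.
rewrite -ler_pdivrMr//.
apply: (sup_upper_bound (specnorm_has_sup A)).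
exists ((l2norm v)^-1 *: v) => /=.
  by rewrite l2normZ ger0_norm ?invr_ge0// mulVf.
by rewrite -scalemxAr l2normZ ger0_norm ?invr_ge0// mulrC.
Qed.

(* Spares proving the symmetry of the Hessian. *)
Lemma l2norm_trmx_le m n (A : 'M[R]_(m, n)) c : 0 <= c ->
  (forall v, l2norm (A *m v) <= c * l2norm v) ->
  forall u, l2norm (A^T *m u) <= c * l2norm u.
Proof.
move=> c0 Ac u; have [u0|u0] := eqVneq (l2norm (A^T *m u)) 0.
  by rewrite u0 mulr_ge0.
have ugt : 0 < l2norm (A^T *m u) by rewrite lt_def u0/=.
rewrite -(ler_pM2l ugt) -expr2 l2norm_sqr -dot_mulmx.
by rewrite (le_trans (dot_le _ _))// mulrA (mulrC _ c) ler_wpM2r.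
Qed.

End EuclideanNorm.

#[export] Hint Extern 0 (is_true (0 <= l2norm _)) => exact: l2norm_ge0 : core.

(** * Borel measurability of vectors and matrices *)

Section BorelMatrices.
Context {R : realType}.

Lemma nbhs_l2normP m (x : 'cV[R]_m) (A : set 'cV[R]_m) :
  nbhs x A <-> exists2 e, 0 < e & forall y, l2norm (y - x) < e -> A y.
Proof.
split.
  move=> /nbhs_ballP[e /= e0 xA]; exists e => // y yx; apply: xA; split=> // i j.
  rewrite (ord1 j) -ball_normE/= distrC.
  by rewrite (le_lt_trans _ yx)//; have := coord_le_l2norm (y - x) i; rewrite !mxE.
(* The m coordinates of size e / (m + 1) add up to less than e, and the successor keeps the radius
   positive when m = 0. *)
move=> [e e0 xA]; apply/nbhs_ballP; exists (e / m.+1%:R) => /=; first by rewrite divr_gt0.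
move=> y [_ yx]; apply: xA; rewrite (le_lt_trans (l2norm_le_sum _))//.
rewrite (@le_lt_trans _ _ (m%:R * (e / m.+1%:R)))//.
  rewrite mulr_natl -[X in _ <= _ *+ X]card_ord -sumr_const.
  apply: ler_sum => i _; have /ltW := yx i 0.
  by rewrite !mxE /= distrC.
by rewrite mulrCA gtr_pMr// ltr_pdivrMr// mul1r ltr_nat.
Qed.

Lemma continuous_borel_measurable (T : ptopologicalType) (f : T -> R) :
  continuous f -> measurable_fun setT (f : borel T -> R).
Proof.
move=> /continuousP cf; apply: (measurability _ (RGenOpens.measurableE R)).
move=> _ [_ [a [b ->] <-]]; rewrite setTI; apply: sub_sigma_algebra.
exact/cf/interval_open.
Qed.

Lemma measurable_coord m n (i : 'I_m) (j : 'I_n) :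
  measurable_fun setT (fun A : borel 'M[R]_(m, n) => A i j).
Proof. apply: (@continuous_borel_measurable 'M[R]_(m, n)); exact: coord_continuous. Qed.

(** There are countably many such boxes and they form a base of the topology, which identifies the
    Borel sigma-algebra of matrices with the one generated by the entries. *)
Definition rational_box m n (p : 'M[rat]_(m, n) * 'M[rat]_(m, n)) : set 'M[R]_(m, n) :=
  [set A | forall i j, ratr (p.1 i j) < A i j < ratr (p.2 i j)].

Lemma open_rational_boxes m n (U : set 'M[R]_(m, n)) : open U ->
  U = \bigcup_(p in [set p | rational_box p `<=` U]) rational_box p.
Proof.
move=> oU; apply/seteqP; split => [A UA|A [p /= pU pA]]; last exact: pU.
move: oU => /(_ _ UA) /nbhs_ballP[e /= e0 AU].
have lo (x : R) : exists q : rat, x - e < ratr q < x.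
  have /rat_in_itvoo[q /itvP qre] : x - e < x by rewrite ltrBlDr ltrDl.
  by exists q; rewrite !qre.
have hi (x : R) : exists q : rat, x < ratr q < x + e.
  have /rat_in_itvoo[q /itvP qre] : x < x + e by rewrite ltrDl.
  by exists q; rewrite !qre.
exists (\matrix_(i, j) sval (cid (lo (A i j))), \matrix_(i, j) sval (cid (hi (A i j)))) => /=.
  move=> B /= pB; apply: AU; split=> // i j; have := pB i j; rewrite !mxE.
  case: (cid (lo _)) (cid (hi _)) => a /= /andP[a1 a2] [b /= /andP[b1 b2]] /andP[Ba Bb].
  by rewrite -ball_normE/= ltr_distl; apply/andP; split; lra.
move=> i j; rewrite !mxE.
by case: (cid (lo _)) (cid (hi _)) => a /= /andP[a1 a2] [b /= /andP[b1 b2]]; apply/andP.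
Qed.

Lemma measurable_mxP d (W : measurableType d) m n (X : W -> 'M[R]_(m, n)) :
  measurable_fun setT (X : W -> borel 'M[R]_(m, n))
  <-> forall i j, measurable_fun setT (fun w => X w i j).
Proof.
split=> [mX i j|mX].
  exact: measurableT_comp (measurable_coord i j) mX.
apply: (@measurability _ _ _ (borel 'M[R]_(m, n)) setT X (@open 'M[R]_(m, n)) erefl) => // _ [U oU <-].
rewrite setTI (open_rational_boxes oU) preimage_bigcup.
rewrite bigcup_mkcond.
apply: countable_bigcupT_measurable => [|p]; first exact: countableP.
case: ifPn => // _.
rewrite (_ : X @^-1` rational_box p
  = \bigcap_(k in [set: 'I_m * 'I_n])
      (fun w => X w k.1 k.2) @^-1` `]ratr (p.1 k.1 k.2), ratr (p.2 k.1 k.2)[%classic).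
  apply: fin_bigcap_measurable => // k _.
  by rewrite -[X in measurable X]setTI; exact: mX.
apply/seteqP; split => w /=.
  by move=> wp [i j] _ /=; rewrite in_itv/=; exact: wp.
by move=> wp i j; have := wp (i, j) I; rewrite /= in_itv.
Qed.

End BorelMatrices.

Section MeasurableVectors.
Context {R : realType} {d : measure_display} {W : measurableType d}.

Local Notation mfun X := (measurable_fun setT (X : W -> borel _)).

Lemma measurable_mxD m n (X Y : W -> 'M[R]_(m, n)) :
  mfun X -> mfun Y -> mfun (fun w => X w + Y w).
Proof.
move=> /measurable_mxP mX /measurable_mxP mY; apply/measurable_mxP => i j.
by under eq_fun do rewrite mxE; exact: measurable_funD.
Qed.

Lemma measurable_mxZ m n (c : R) (X : W -> 'M[R]_(m, n)) :
  mfun X -> mfun (fun w => c *: X w).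
Proof.
move=> /measurable_mxP mX; apply/measurable_mxP => i j.
by under eq_fun do rewrite mxE; exact: measurable_funM.
Qed.

Lemma measurable_mxN m n (X : W -> 'M[R]_(m, n)) :
  mfun X -> mfun (fun w => - X w).
Proof. by move=> /(measurable_mxZ (-1)); under eq_fun do rewrite scaleN1r. Qed.

Lemma measurable_mxB m n (X Y : W -> 'M[R]_(m, n)) :
  mfun X -> mfun Y -> mfun (fun w => X w - Y w).
Proof. by move=> mX mY; apply: measurable_mxD => //; exact: measurable_mxN. Qed.

Lemma measurable_mx_cst m n (A : 'M[R]_(m, n)) : mfun (fun=> A).
Proof. by apply/measurable_mxP => i j; exact: measurable_cst. Qed.

Lemma measurable_mx_shift m n (X : W -> 'M[R]_(m, n)) A :
  mfun X -> mfun (fun w => X w - A).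
Proof. by move=> mX; apply: measurable_mxB => //; exact: measurable_mx_cst. Qed.

Lemma measurable_mx_sum m n (I : Type) (r : seq I) (X : I -> W -> 'M[R]_(m, n)) :
  (forall i, mfun (X i)) -> mfun (fun w => \sum_(i <- r) X i w).
Proof.
move=> mX; apply/measurable_mxP => i j; under eq_fun do rewrite summxE.
by apply: measurable_sum => k; exact: (measurable_mxP (X k)).1.
Qed.

Lemma measurable_mulmx m n k (X : W -> 'M[R]_(m, n)) (Y : W -> 'M[R]_(n, k)) :
  mfun X -> mfun Y -> mfun (fun w => X w *m Y w).
Proof.
move=> /measurable_mxP mX /measurable_mxP mY; apply/measurable_mxP => i j.
under eq_fun do rewrite mxE.
by apply: measurable_sum => l; exact: measurable_funM.
Qed.

Lemma measurable_scalemx m n (c : W -> R) (X : W -> 'M[R]_(m, n)) :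
  measurable_fun setT c -> mfun X -> mfun (fun w => c w *: X w).
Proof.
move=> mc /measurable_mxP mX; apply/measurable_mxP => i j.
by under eq_fun do rewrite mxE; exact: measurable_funM.
Qed.

Lemma measurable_usubmx m n (X : W -> 'cV[R]_(m + n)) :
  mfun X -> mfun (fun w => usubmx (X w)).
Proof.
move=> /measurable_mxP mX; apply/measurable_mxP => i j.
by under eq_fun do rewrite mxE; exact: mX.
Qed.

Lemma measurable_dsubmx m n (X : W -> 'cV[R]_(m + n)) :
  mfun X -> mfun (fun w => dsubmx (X w)).
Proof.
move=> /measurable_mxP mX; apply/measurable_mxP => i j.
by under eq_fun do rewrite mxE; exact: mX.
Qed.

Lemma measurable_l2norm m (X : W -> 'cV[R]_m) :
  mfun X -> measurable_fun setT (fun w => l2norm (X w)).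
Proof.
move=> /measurable_mxP mX; apply: measurableT_comp => //.
  by apply: continuous_measurable_fun; exact: sqrt_continuous.
by apply: measurable_sum => i; exact: measurable_funX.
Qed.

Lemma measurable_l2norm_sqr m (X : W -> 'cV[R]_m) :
  mfun X -> measurable_fun setT (fun w => l2norm (X w) ^+ 2).
Proof. by move=> /measurable_l2norm mX; exact: measurable_funX. Qed.

End MeasurableVectors.

(** Meant for [grad (Phi p)], [ystar] and [zstar], whose measurability along the iterates comes from
    their Lipschitz constants. *)
Lemma lipschitz_measurable (R : realType) m n L (F : 'cV[R]_m -> 'cV[R]_n) :
  (forall x y, l2norm (F x - F y) <= L * l2norm (x - y)) ->
  measurable_fun setT (F : borel 'cV[R]_m -> borel 'cV[R]_n).
Proof.
move=> FL; apply/measurable_mxP => i j; rewrite (ord1 j).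
apply: (@continuous_borel_measurable R 'cV[R]_m (fun x => F x i 0)).
move=> x A /nbhs_ballP[e /= e0 eA]; apply/nbhs_l2normP.
(* The denominator is positive whatever the sign of L. *)
exists (e / (`|L| + 1)); first by rewrite divr_gt0.
move=> y yx; apply: eA; rewrite -ball_normE/= distrC.
have := coord_le_l2norm (F y - F x) i; rewrite !mxE => /le_lt_trans; apply.
apply: (le_lt_trans (FL y x)).
apply: (@le_lt_trans _ _ ((`|L| + 1) * l2norm (y - x))).
  by rewrite ler_wpM2r ?l2norm_ge0// (le_trans (ler_norm _))// lerDl.
by rewrite mulrC -ltr_pdivlMr.
Qed.

(** * Mean squares of random vectors *)

Section MeanSquare.
Context {R : realType} {d : measure_display} {W : measurableType d}.
Variable P : probability W R.

Lemma independent_elements_comp d1 d2 d3 d4 (T1 : measurableType d1)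
    (T2 : measurableType d2) (T3 : measurableType d3) (T4 : measurableType d4)
    (X : W -> T1) (Y : W -> T2) (f : T1 -> T3) (g : T2 -> T4) :
  measurable_fun setT f -> measurable_fun setT g ->
  independent_elements P X Y -> independent_elements P (f \o X) (g \o Y).
Proof.
move=> mf mg ind A B mA mB.
have mfA : measurable (f @^-1` A) by rewrite -[X in measurable X]setTI; exact: mf.
have mgB : measurable (g @^-1` B) by rewrite -[X in measurable X]setTI; exact: mg.
exact: ind mfA mgB.
Qed.

Lemma eq_sq_integrable (X Y : W -> R) : X =1 Y ->
  sq_integrable P X -> sq_integrable P Y.
Proof. by move=> /funext ->. Qed.

(** Bias-variance identity: after centering, the off-diagonal products have mean zero by pairwise
    independence. *)
Lemma Rintegral_sqr_independent_sum (I : finType) (a c : R) (X : I -> W -> R)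
    (m : I -> R) :
  (forall i, sq_integrable P (X i)) ->
  (forall i, \int[P]_w X i w = m i) ->
  (forall i j, i != j -> independent_elements P (X i) (X j)) ->
  \int[P]_w (a + c * \sum_i X i w) ^+ 2
  = (a + c * \sum_i m i) ^+ 2 + c ^+ 2 * \sum_i \int[P]_w (X i w - m i) ^+ 2.
Proof.
move=> iX mX ind; set b := a + _.
pose M i w := X i w - m i.
have iM i : sq_integrable P (M i).
  by apply: sq_integrableB => //; exact: sq_integrable_cst.
have jM i := sq_integrable_integrable (iM i).
have M0 i : \int[P]_w M i w = 0.
  rewrite RintegralB//; first by rewrite Rintegral_cstT mX subrr.
    exact: sq_integrable_integrable.
  exact: sq_integrable_integrable (sq_integrable_cst _ _).
have MM i j : i != j -> \int[P]_w (M i w * M j w) = 0.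
  move=> ij; rewrite Rintegral_mul_independent ?M0 ?mul0r//.
  have mB e : measurable_fun setT (fun x : R => x - e) by exact: measurable_funB.
  exact: (independent_elements_comp (mB (m i)) (mB (m j)) (ind _ _ ij)).
have E w : (a + c * \sum_i X i w) ^+ 2
  = b ^+ 2 + (2 * b * c * (\sum_i M i w) + c ^+ 2 * \sum_i \sum_j M i w * M j w).
  have -> : \sum_i \sum_j M i w * M j w = (\sum_i M i w) ^+ 2.
    by rewrite expr2 mulr_suml; apply: eq_bigr => i _; rewrite mulr_sumr.
  have -> : a + c * \sum_i X i w = b + c * \sum_i M i w.
    rewrite /b -addrA -mulrDr -big_split/=; congr (_ + _ * _).
    by apply: eq_bigr => i _; rewrite /M addrC subrK.
  ring.
under eq_Rintegral do rewrite E.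
have [S1 iS1] := Rintegral_sum (index_enum I) jM.
have iMM i j := integrable_mul_sq (iM i) (iM j).
have S2 i := Rintegral_sum (index_enum I) (iMM i).
have [S3 iS3] := Rintegral_sum (index_enum I) (fun i => (S2 i).2).
have i1 : P.-integrable setT (EFin \o (fun w => 2 * b * c * \sum_i M i w)).
  exact: (integrableZl measurableT _ iS1).
have i2 : P.-integrable setT (EFin \o (fun w => c ^+ 2 * \sum_i \sum_j M i w * M j w)).
  exact: (integrableZl measurableT _ iS3).
rewrite RintegralD//; last 2 first.
- exact: finite_measure_integrable_cst.
- by apply: (integrableD measurableT i1 i2).
rewrite Rintegral_cstT RintegralD// !RintegralZl// S1 S3.
rewrite big1 ?mulr0 ?add0r// ?(fun i _ => M0 i)//.
congr (_ + _ * _); apply: eq_bigr => i _.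
rewrite (S2 i).1 (bigD1 i)//= [X in _ + X]big1 ?addr0.
  by apply: eq_Rintegral => w _; rewrite -expr2.
by move=> j ji; rewrite MM// eq_sym.
Qed.

Definition vec_sq_integrable m (V : W -> 'cV[R]_m) : Prop :=
  forall i, sq_integrable P (fun w => V w i 0).

Definition vec_mean m (V : W -> 'cV[R]_m) (mu : 'cV[R]_m) : Prop :=
  forall i, \int[P]_w V w i 0 = mu i 0.

(** Meaningful only together with [vec_sq_integrable]: the real-valued integral is 0 when the
    extended one is infinite. *)
Definition mean_sq m (V : W -> 'cV[R]_m) : R := \int[P]_w l2norm (V w) ^+ 2.

Lemma vec_sq_integrableB m (V : W -> 'cV[R]_m) mu :
  vec_sq_integrable V -> vec_sq_integrable (fun w => V w - mu).
Proof.
move=> iV i; have := sq_integrableB (iV i) (sq_integrable_cst P (mu i 0)).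
by apply: eq_sq_integrable => w; rewrite !mxE.
Qed.

Lemma mean_sqE m (V : W -> 'cV[R]_m) : vec_sq_integrable V ->
  mean_sq V = \sum_i \int[P]_w (V w i 0) ^+ 2
  /\ P.-integrable setT (EFin \o (fun w => l2norm (V w) ^+ 2)).
Proof.
move=> iV; have [S iS] := Rintegral_sum (index_enum 'I_m) (fun i => (iV i).2).
split.
  by rewrite -S; apply: eq_Rintegral => w _; rewrite l2norm_sqrE.
by move: iS; apply: eq_integrable => // w _ /=; rewrite l2norm_sqrE.
Qed.

Lemma mean_sq_independent_sum m (I : finType) (a : 'cV[R]_m) (c : R)
    (N : I -> W -> 'cV[R]_m) (mu : I -> 'cV[R]_m) :
  (forall i, vec_sq_integrable (N i)) -> (forall i, vec_mean (N i) (mu i)) ->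
  (forall i j, i != j -> forall k,
    independent_elements P (fun w => N i w k 0) (fun w => N j w k 0)) ->
  mean_sq (fun w => a + c *: \sum_i N i w)
  = l2norm (a + c *: \sum_i mu i) ^+ 2
    + c ^+ 2 * \sum_i mean_sq (fun w => N i w - mu i).
Proof.
move=> iN mN ind.
have iS : vec_sq_integrable (fun w => a + c *: \sum_i N i w).
  move=> k; have := sq_integrableD (sq_integrable_cst P (a k 0))
    (sq_integrableZ c (sq_integrable_sum (index_enum I) (p := xpredT) (fun i _ => iN i k))).
  by apply: eq_sq_integrable => w; rewrite !mxE summxE.
rewrite (mean_sqE iS).1 l2norm_sqrE.
rewrite [X in _ + _ * X](eq_bigr _ (fun i _ => (mean_sqE (vec_sq_integrableB (mu i) (iN i))).1)).
rewrite exchange_big/= mulr_sumr -big_split/=; apply: eq_bigr => k _.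
rewrite (_ : \int[P]_w _ = \int[P]_w (a k 0 + c * \sum_i N i w k 0) ^+ 2); last first.
  by apply: eq_Rintegral => w _; rewrite !mxE summxE.
rewrite (@Rintegral_sqr_independent_sum _ _ _ _ (fun i => mu i k 0)) => [||i|i j ij].
- rewrite !mxE summxE; congr (_ + _ * _); apply: eq_bigr => i _.
  by apply: eq_Rintegral => w _; rewrite !mxE.
- by move=> i; exact: iN.
- exact: mN.
- exact: ind.
Qed.

Lemma mean_sq_deviation m (V : W -> 'cV[R]_m) mu a :
  vec_sq_integrable V -> vec_mean V mu ->
  mean_sq (fun w => V w - a) = mean_sq (fun w => V w - mu) + l2norm (mu - a) ^+ 2.
Proof.
move=> iV mV.
(* A sum with a single term, indexed by [unit], for which independence is vacuous. *)
have := @mean_sq_independent_sum m unit (- a) 1 (fun=> V) (fun=> mu) (fun=> iV) (fun=> mV).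
rewrite !big_const !card_unit/= !addr0 !scale1r !expr1n mul1r => H.
rewrite addrC [mu - a]addrC -H; last by case=> -[].
apply: eq_Rintegral => w _; rewrite !big_const !card_unit/= addr0 scale1r.
by rewrite addrC.
Qed.

Lemma measurable_vec_coord m (V : W -> 'cV[R]_m) :
  measurable_fun setT (V : W -> borel 'cV[R]_m) ->
  forall i, measurable_fun setT (fun w => V w i 0).
Proof. by move=> /measurable_mxP mV i; exact: mV. Qed.

(** Entry point from the extended-real error bounds: a finite mean square around one point dominates
    every coordinate and gives square integrability, after which real-valued integrals can be
    used. *)
Lemma mean_sq_bound m (V : W -> 'cV[R]_m) a e :
  measurable_fun setT (V : W -> borel 'cV[R]_m) ->
  (\int[P]_w (l2norm (V w - a) ^+ 2)%:E <= e%:E)%E ->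
  vec_sq_integrable V /\ mean_sq (fun w => V w - a) <= e.
Proof.
move=> mV Ve.
have iVa : vec_sq_integrable (fun w => V w - a).
  move=> i; apply: sq_integrable_lty.
    apply: measurable_vec_coord; exact: measurable_mx_shift.
  apply: (le_lt_trans (y := e%:E)); last exact: ltry.
  apply: le_trans Ve; apply: ge0_le_integral => //.
  - by move=> w _; rewrite lee_fin sqr_ge0.
  - apply/measurable_EFinP/measurable_funX; apply: measurable_vec_coord.
    exact: measurable_mx_shift.
  - apply/measurable_EFinP; apply: measurable_l2norm_sqr.
    exact: measurable_mx_shift.
  - move=> w _; rewrite lee_fin -[leLHS]real_normK ?num_real//.
    by rewrite ler_pXn2r ?nnegrE// coord_le_l2norm.
split.
  move=> i; have := vec_sq_integrableB (- a) iVa i.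
  by apply: eq_sq_integrable => w; rewrite opprK subrK.
rewrite -lee_fin fineK//.
by apply: integrable_fin_num => //; exact: (mean_sqE iVa).2.
Qed.

Lemma integral_mean_sq m (V : W -> 'cV[R]_m) : vec_sq_integrable V ->
  (\int[P]_w (l2norm (V w) ^+ 2)%:E = (mean_sq V)%:E)%E.
Proof.
move=> iV; rewrite /mean_sq fineK//.
by apply: integrable_fin_num => //; exact: (mean_sqE iV).2.
Qed.

End MeanSquare.

(** * Unbiased estimators: oracles, laws and compression *)

Section Estimators.
Context {R : realType}.

(* Unlike [ge0_le_integral], no measurability: the spectral norm of a random
   matrix is compared with measurable functions this way. *)
Lemma ge0_le_integral_setT d (T : measurableType d) (mu : {measure set T -> \bar R})
    (f g : T -> \bar R) : (forall x, 0 <= f x)%E -> (forall x, f x <= g x)%E ->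
  (\int[mu]_x f x <= \int[mu]_x g x)%E.
Proof.
move=> f0 fg; have g0 x : (0 <= g x)%E by exact: le_trans (fg x).
rewrite !ge0_integralTE//; apply: ereal_sup_le => _ [h /= hf <-].
by exists h => // x; exact: le_trans (fg x).
Qed.

Definition estimator d (W : measurableType d) (P : probability W R) m
    (V : W -> 'cV[R]_m) (mu : 'cV[R]_m) (e : R) : Prop :=
  [/\ measurable_fun setT (V : W -> borel 'cV[R]_m),
      vec_sq_integrable P V, vec_mean P V mu
    & mean_sq P (fun w => V w - mu) <= e].

Lemma estimator_of_mse d (W : measurableType d) (P : probability W R) m
    (V : W -> 'cV[R]_m) mu e :
  measurable_fun setT (V : W -> borel 'cV[R]_m) ->
  unbiased P V mu -> mse_le P (@l2norm R m) V mu e -> estimator P V mu e.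
Proof.
move=> mV uV; rewrite /mse_le unlock => Ve.
have [iV Ve'] := mean_sq_bound mV Ve.
by split=> // i; have := uV i 0; rewrite unlock /Rintegral => ->.
Qed.

(** The spectral norm enters only through the pointwise bound |(H - A) v| <= ||H - A|| |v|, so its
    measurability as a function of the sample is never invoked. *)
Lemma estimator_mulmx d (W : measurableType d) (P : probability W R) m n
    (H : W -> 'M[R]_(m, n)) A e (z : 'cV[R]_n) :
  measurable_fun setT (H : W -> borel 'M[R]_(m, n)) ->
  unbiased P H A -> mse_le P (@specnorm R m n) H A e ->
  estimator P (fun w => H w *m z) (A *m z) (e * l2norm z ^+ 2).
Proof.
move=> mH uH; rewrite /mse_le unlock => He.
have mHv v : measurable_fun setT ((fun w => H w *m v) : W -> borel 'cV[R]_m).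
  by apply: measurable_mulmx => //; exact: measurable_mx_cst.
have bnd (v : 'cV[R]_n) :
    (\int[P]_w (l2norm (H w *m v - A *m v) ^+ 2)%:E <= (e * l2norm v ^+ 2)%:E)%E.
  have [v0|v0] := eqVneq (l2norm v) 0.
    rewrite (l2norm_eq0 v0) !l2norm0 expr0n mulr0.
    by rewrite integral0_eq// => w _; rewrite !mulmx0 subr0 l2norm0 expr0n.
  have vgt : 0 < l2norm v ^+ 2 by rewrite exprn_gt0// lt_def v0/=.
  (* The factor |v|^2 goes to the left, so that scaling is applied to the measurable integrand |(H -
     A) v|^2 and not to the spectral norm. *)
  rewrite mulrC EFinM -lee_pdivrMl//.
  apply: le_trans He.
  rewrite -ge0_integralZl//; last 3 first.
  - apply/measurable_EFinP/measurable_l2norm_sqr.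
    exact: measurable_mx_shift.
  - by move=> w _; rewrite lee_fin sqr_ge0.
  - by rewrite lee_fin invr_ge0 ltW.
  apply: ge0_le_integral_setT => w; first by rewrite -EFinM lee_fin mulr_ge0 ?sqr_ge0// invr_ge0 ltW.
  rewrite -EFinM lee_fin mulrC ler_pdivrMr// -mulmxBl -exprMn.
  by rewrite ler_pXn2r ?nnegrE ?l2norm_mulmx_le ?mulr_ge0 ?specnorm_ge0.
have [iHz Hz] := mean_sq_bound (mHv z) (bnd z).
split=> // i.
(* Linearity of the expectation requires each entry to be integrable; an entry is a coordinate of H
   applied to a basis vector. *)
have iH j : P.-integrable setT (EFin \o (fun w => H w i j)).
  have [iHj _] := mean_sq_bound (mHv (delta_mx j 0)) (bnd (delta_mx j 0)).
  have := sq_integrable_integrable (iHj i).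
  apply: eq_integrable => // w _ /=; congr EFin.
  rewrite mxE (bigD1 j)//= mxE !eqxx mulr1 big1 ?addr0// => k kj.
  by rewrite mxE (negbTE kj) mulr0.
have iHz' j : P.-integrable setT (EFin \o (fun w => H w i j * z j 0)).
  have := integrableZl measurableT (z j 0) (iH j).
  by apply: eq_integrable => // w _ /=; rewrite mulrC EFinM.
have [S _] := Rintegral_sum (index_enum 'I_n) iHz'.
transitivity (\int[P]_w \sum_j (H w i j * z j 0)).
  by apply: eq_Rintegral => w _; rewrite mxE.
rewrite S mxE; apply: eq_bigr => j _.
by rewrite RintegralZr//; have := uH i j; rewrite unlock /Rintegral => ->.
Qed.

Section Law.
Context d (W : measurableType d) (P : probability W R).
Context d' (S : measurableType d') (D : probability S R) (X : W -> S).
Hypothesis lawX : has_law P X D.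

Lemma ge0_integral_has_law (f : S -> \bar R) :
  measurable_fun setT f -> (forall s, 0 <= f s)%E ->
  (\int[P]_w f (X w) = \int[D]_s f s)%E.
Proof.
case: lawX => mX PX mf f0.
rewrite -[LHS](@ge0_integral_pushforward _ _ _ _ _ X mX P setT f)//.
by apply: eq_measure_integral => A mA _; exact: PX.
Qed.

Lemma Rintegral_has_law (f : S -> R) : D.-integrable setT (EFin \o f) ->
  \int[P]_w f (X w) = \int[D]_s f s.
Proof.
move=> intf; have [mf foo] := integrableP _ _ _ intf.
have [mX PX] := lawX; congr fine.
rewrite -[LHS](@integral_pushforward _ _ _ _ _ X mX P setT (EFin \o f))//.
  by apply: eq_measure_integral => A mA _; exact: PX.
apply/integrableP; split; first exact: measurableT_comp.
rewrite (ge0_integral_has_law (f := fun s => `|(EFin \o f) s|%E))//.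
exact: measurableT_comp.
Qed.

Lemma estimator_has_law m (V : S -> 'cV[R]_m) mu e :
  estimator D V mu e -> estimator P (V \o X) mu e.
Proof.
move=> [mV iV muV Ve].
have mVX : measurable_fun setT (V \o X : W -> borel 'cV[R]_m).
  by apply: measurableT_comp => //; case: lawX.
have [iVX VXe] : vec_sq_integrable P (V \o X)
    /\ mean_sq P (fun w => (V \o X) w - mu) <= e.
  apply: mean_sq_bound => //.
  rewrite (ge0_integral_has_law (f := fun s => (l2norm (V s - mu) ^+ 2)%:E)).
  - by rewrite integral_mean_sq ?lee_fin//; exact: vec_sq_integrableB.
  - apply/measurable_EFinP/measurable_l2norm_sqr.
    exact: measurable_mx_shift.
  - by move=> s; rewrite lee_fin sqr_ge0.
split=> // i; rewrite -muV.
exact: (Rintegral_has_law (sq_integrable_integrable (iV i))).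
Qed.

End Law.

Section Combination.
Context d (W : measurableType d) (P : probability W R).

Lemma estimator_mean_sq m (V : W -> 'cV[R]_m) mu e a : estimator P V mu e ->
  mean_sq P (fun w => V w - a) <= e + l2norm (mu - a) ^+ 2.
Proof. by move=> [_ iV muV Ve]; rewrite (mean_sq_deviation a iV muV) lerD2r. Qed.

Lemma estimator_col_mx m n (V : W -> 'cV[R]_(m + n)) mu nu e :
  estimator P V (col_mx mu nu) e ->
  estimator P (fun w => usubmx (V w)) mu e /\ estimator P (fun w => dsubmx (V w)) nu e.
Proof.
move=> [mV iV muV Ve].
have iU : vec_sq_integrable P (fun w => usubmx (V w)).
  by move=> i; have := iV (lshift n i); apply: eq_sq_integrable => w; rewrite mxE.
have iD : vec_sq_integrable P (fun w => dsubmx (V w)).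
  by move=> i; have := iV (rshift m i); apply: eq_sq_integrable => w; rewrite mxE.
have iE k (U : W -> 'cV[R]_k) u (iV' : vec_sq_integrable P U) := (mean_sqE (vec_sq_integrableB u iV')).2.
split; split=> //; do ?[exact: measurable_usubmx|exact: measurable_dsubmx].
- by move=> i; rewrite -[RHS](col_mxEu mu nu) -muV; apply: eq_Rintegral => w _; rewrite mxE.
- apply: le_trans Ve; apply: le_Rintegral; do ?[exact: iE] => // w _.
  rewrite -[V w]vsubmxK opp_col_mx add_col_mx col_mxKu.
  by rewrite l2norm_col_mx_sqr lerDl sqr_ge0.
- by move=> i; rewrite -[RHS](col_mxEd mu nu) -muV; apply: eq_Rintegral => w _; rewrite mxE.
- apply: le_trans Ve; apply: le_Rintegral; do ?[exact: iE] => // w _.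
  rewrite -[V w]vsubmxK opp_col_mx add_col_mx col_mxKd.
  by rewrite l2norm_col_mx_sqr lerDr sqr_ge0.
Qed.

Lemma independent_coord m n (U : W -> 'cV[R]_m) (V : W -> 'cV[R]_n) i j :
  independent_elements P (U : W -> borel 'cV[R]_m) (V : W -> borel 'cV[R]_n) ->
  independent_elements P (fun w => U w i 0) (fun w => V w j 0).
Proof.
move=> ind.
exact: (independent_elements_comp (measurable_coord i 0) (measurable_coord j 0) ind).
Qed.

Lemma mean_sq_estimator_sum m (I : finType) (a : 'cV[R]_m) (c : R)
    (N : I -> W -> 'cV[R]_m) mu e :
  (forall i, estimator P (N i) (mu i) (e i)) ->
  (forall i j, i != j -> independent_elements P
     (N i : W -> borel 'cV[R]_m) (N j : W -> borel 'cV[R]_m)) ->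
  mean_sq P (fun w => a + c *: \sum_i N i w)
    <= l2norm (a + c *: \sum_i mu i) ^+ 2 + c ^+ 2 * \sum_i e i.
Proof.
move=> Ne ind; rewrite (@mean_sq_independent_sum _ _ _ _ _ _ _ _ _ mu).
- by rewrite lerD2l ler_wpM2l ?sqr_ge0//; apply: ler_sum => i _; case: (Ne i).
- by move=> i; case: (Ne i).
- by move=> i; case: (Ne i).
- by move=> i j ij k; apply: independent_coord; exact: ind.
Qed.

Lemma estimatorD m (U V : W -> 'cV[R]_m) mu nu e e' :
  estimator P U mu e -> estimator P V nu e' ->
  independent_elements P (U : W -> borel 'cV[R]_m) (V : W -> borel 'cV[R]_m) ->
  estimator P (fun w => U w + V w) (mu + nu) (e + e').
Proof.
move=> Ue Ve ind; have [[mU iU muU _] [mV iV muV _]] := (Ue, Ve).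
split.
- exact: measurable_mxD.
- move=> i; have := sq_integrableD (iU i) (iV i).
  by apply: eq_sq_integrable => w; rewrite mxE.
- move=> i; rewrite mxE -muU -muV -RintegralD//; last 2 first.
  + exact: sq_integrable_integrable (iU i).
  + exact: sq_integrable_integrable (iV i).
  by apply: eq_Rintegral => w _; rewrite mxE.
(* Two independent terms as a sum over [bool]; the shift by -(mu + nu) makes the bias term
   vanish. *)
have := @mean_sq_estimator_sum m bool (- (mu + nu)) 1
  (fun b => if b then U else V) (fun b => if b then mu else nu)
  (fun b => if b then e else e').
rewrite !big_bool/= expr1n mul1r scale1r addNr l2norm0 expr0n add0r => H.
apply: (le_trans _ (H _ _)); last 2 first.
- by case.
- case=> -[] // _; move=> A B mA mB; rewrite setIC muleC; exact: ind.
rewrite le_eqVlt; apply/orP; left; apply/eqP.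
by apply: eq_Rintegral => w _; rewrite scale1r big_bool addrC.
Qed.

(** Law of total variance: given V, the compression error is at most omega |V|^2 on average, to
    which the error e of V itself is added, and E|V|^2 <= e + |mu|^2. Independence of V and the seed
    allows the seed to be integrated first with V frozen. *)
Lemma estimator_compress d' (S : measurableType d') (Q : probability S R) m
    (omega : R) (C : 'cV[R]_m -> S -> 'cV[R]_m) (seed : W -> S)
    (V : W -> 'cV[R]_m) mu e :
  0 <= omega -> unbiased_compressor Q omega C -> has_law P seed Q ->
  estimator P V mu e -> independent_elements P (V : W -> borel 'cV[R]_m) seed ->
  estimator P (fun w => C (V w) (seed w)) mu
    ((1 + omega) * e + omega * l2norm mu ^+ 2).
Proof.
move=> omega0 [mC CE] lawS Ve ind; have [mV iV muV Ve'] := Ve.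
have mS : measurable_fun setT seed by case: lawS.
have mVS : measurable_fun setT (fun w => (V w, seed w) : borel 'cV[R]_m * S).
  exact: measurable_fun_pair.
have mN : measurable_fun setT ((fun w => C (V w) (seed w)) : W -> borel 'cV[R]_m).
  exact: measurableT_comp mC mVS.
have estC v : estimator P (fun w => C v (seed w)) v (omega * l2norm v ^+ 2).
  apply: (@estimator_has_law _ _ _ _ _ _ _ lawS _ (C v)).
  have [uC eC] := CE v; apply: estimator_of_mse => //.
  exact: measurableT_comp mC (pair1_measurable (v : borel 'cV[R]_m)).
pose f (p : borel 'cV[R]_m * S) : \bar R := (l2norm (C p.1 p.2 - mu) ^+ 2)%:E.
have mf : measurable_fun setT f.
  apply/measurable_EFinP/measurable_l2norm_sqr.
  exact: measurable_mx_shift.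
have f0 p : (0 <= f p)%E by rewrite lee_fin sqr_ge0.
have [intf _] := ge0_integral_independent mV mS ind mf f0.
have [iN Ne] : vec_sq_integrable P (fun w => C (V w) (seed w))
    /\ mean_sq P (fun w => C (V w) (seed w) - mu)
       <= (1 + omega) * e + omega * l2norm mu ^+ 2.
  apply: mean_sq_bound => //; rewrite [leLHS]intf.
  apply: (@le_trans _ _ (\int[P]_w (omega%:E * (l2norm (V w) ^+ 2)%:E
                                    + (l2norm (V w - mu) ^+ 2)%:E))%E).
    apply: ge0_le_integral_setT => w; first by apply: integral_ge0 => w' _.
    rewrite /f/= (integral_mean_sq (vec_sq_integrableB mu _)); last by case: (estC (V w)).
    by rewrite -EFinM -EFinD lee_fin; exact: estimator_mean_sq.
  have mVm := measurable_mx_shift mu mV.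
  rewrite ge0_integralD//; last 4 first.
  - by move=> w _; rewrite -EFinM lee_fin mulr_ge0 ?sqr_ge0.
  - apply: measurable_funeM; apply/measurable_EFinP.
    exact: measurable_l2norm_sqr.
  - by move=> w _; rewrite lee_fin sqr_ge0.
  - by apply/measurable_EFinP; exact: measurable_l2norm_sqr.
  rewrite ge0_integralZl//; last 2 first.
  - by apply/measurable_EFinP; exact: measurable_l2norm_sqr.
  - by move=> w _; rewrite lee_fin sqr_ge0.
  rewrite (integral_mean_sq iV) (integral_mean_sq (vec_sq_integrableB mu iV)).
  rewrite -EFinM -EFinD lee_fin.
  have : mean_sq P V <= e + l2norm mu ^+ 2.
    have := estimator_mean_sq 0 Ve; rewrite subr0; apply: le_trans.
    by rewrite le_eqVlt; apply/orP; left; apply/eqP/eq_Rintegral => w _; rewrite subr0.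
  by move=> /(ler_wpM2l omega0); lra.
split=> // i.
pose g (p : borel 'cV[R]_m * S) : \bar R := (C p.1 p.2 i 0)%:E.
have mg : measurable_fun setT g.
  by apply/measurable_EFinP; exact: (measurable_vec_coord mC).
have jN := sq_integrable_integrable (iN i).
have fx v : P.-integrable setT (fun w => g (v, seed w)).
  by have [_ iCv _ _] := estC v; exact: sq_integrable_integrable (iCv i).
have mga : measurable_fun setT (fun p => `|g p|%E) by exact: measurableT_comp.
have [ga _] := ge0_integral_independent mV mS ind mga (fun=> abse_ge0 _).
(* The mean square bound already makes the compressed coordinate integrable; Tonelli read backwards
   then gives the hypothesis of Fubini, from which unbiasedness follows. *)
have goo : (\int[P]_w \int[P]_w' `|g (V w, seed w')| < +oo)%E.
  by rewrite -ga; have [] := integrableP _ _ _ jN.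
have [_ E] := integral_independent mV mS ind mg fx goo.
rewrite -muV /Rintegral; congr fine; apply: etrans E _.
apply: eq_integral => w _; have [_ iCv mCv _] := estC (V w).
by rewrite -mCv /Rintegral fineK// integrable_fin_num//; exact: fx.
Qed.

End Combination.
End Estimators.

(** * Gradients and strong convexity *)

Section Gradients.
Context {R : realType}.

(* The library differentiates with respect to the maximum norm; the epsilon-delta
   notions below are relative to [l2norm]. *)
Definition has_grad m (f : 'cV[R]_m -> R) (x g : 'cV[R]_m) : Prop :=
  forall e, 0 < e -> exists2 d, 0 < d & forall h, l2norm h < d ->
    `|f (x + h) - f x - dot g h| <= e * l2norm h.

Definition has_grad2 m n (f : 'cV[R]_m -> 'cV[R]_n -> R) x y gx gy : Prop :=
  forall e, 0 < e -> exists2 d, 0 < d & forall h k, l2norm h < d -> l2norm k < d ->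
    `|f (x + h) (y + k) - f x y - (dot gx h + dot gy k)|
    <= e * (l2norm h + l2norm k).

(* A and B are transposed Jacobians, the layout of [hess_xy] and [hess_yy]. *)
Definition has_jac2 m n p (F : 'cV[R]_m -> 'cV[R]_n -> 'cV[R]_p) x y
    (A : 'M[R]_(m, p)) (B : 'M[R]_(n, p)) : Prop :=
  forall e, 0 < e -> exists2 d, 0 < d & forall h k, l2norm h < d -> l2norm k < d ->
    l2norm (F (x + h) (y + k) - F x y - (A^T *m h + B^T *m k))
    <= e * (l2norm h + l2norm k).

Lemma has_grad_grad m (f : 'cV[R]_m -> R) x g : has_grad f x g -> grad f x = g.
Proof.
move=> fg; apply/colP => i; rewrite mxE /derive; apply: cvg_lim => //.
apply/cvgrPdist_le => e e0; have [d d0 fgd] := fg e e0.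
apply/nbhs_ballP; exists d => //= t td t0.
have td' : `|t| < d by move: td; rewrite /ball/= sub0r normrN.
have tgt : 0 < `|t| by rewrite normr_gt0.
have tv : l2norm (t *: delta_mx i 0 : 'cV[R]_m) = `|t|.
  by rewrite l2normZ l2norm_delta mulr1.
have := fgd (t *: delta_mx i 0); rewrite tv => /(_ td').
rewrite dotZr dot_delta (addrC x) => H.
rewrite -(ler_pM2r tgt) -normrM; apply: le_trans H.
rewrite distrC mulrBl /GRing.scale/= mulrAC mulVf// mul1r [t * _]mulrC.
by rewrite lexx.
Qed.

Lemma has_grad_is_derive m (f : 'cV[R]_m -> R) x h g (t : R) :
  has_grad f (x + t *: h) g ->
  is_derive t 1 (fun s => f (x + s *: h)) (dot g h).
Proof.
move=> fg.
suff fh : (fun s : R => s^-1 *: (((fun s => f (x + s *: h)) \o shift t) (s *: 1) - f (x + t *: h))) @ 0^' --> dot g h.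
  by split; [apply/cvg_ex; exists (dot g h)|apply: cvg_lim].
apply/cvgrPdist_le => e e0.
have h0 : 0 < l2norm h + 1 by rewrite ltr_wpDl.
have [d d0 fgd] := fg (e / (l2norm h + 1)) (divr_gt0 e0 h0).
apply/nbhs_ballP; exists (d / (l2norm h + 1)); first by rewrite /= divr_gt0.
move=> s /=; rewrite /ball/= sub0r normrN => sd s0.
have sgt : 0 < `|s| by rewrite normr_gt0.
have sh : l2norm (s *: h) < d.
  rewrite l2normZ; apply: (@le_lt_trans _ _ (`|s| * (l2norm h + 1))).
    by rewrite ler_wpM2l// lerDl.
  by rewrite -ltr_pdivlMr.
have := fgd (s *: h) sh; rewrite dotZr l2normZ.
have -> : x + t *: h + s *: h = x + (t + s) *: h by rewrite -addrA -scalerDl.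
move=> H.
rewrite -(ler_pM2r sgt) -normrM.
have -> : (dot g h - s^-1 *: (f (x + (s *: 1 + t) *: h) - f (x + t *: h))) * s
  = - (f (x + (t + s) *: h) - f (x + t *: h) - s * dot g h).
  rewrite /GRing.scale/= mulr1 (addrC s).
  by field.
rewrite normrN (le_trans H)//.
have -> : e / (l2norm h + 1) * (`|s| * l2norm h) = e * `|s| * (l2norm h / (l2norm h + 1)) by ring.
by rewrite ler_piMr ?mulr_ge0 ?(ltW e0)// ler_pdivrMr// mul1r lerDl.
Qed.

Lemma has_grad2_l m n (f : 'cV[R]_m -> 'cV[R]_n -> R) x y gx gy :
  has_grad2 f x y gx gy -> has_grad (f^~ y) x gx.
Proof.
move=> fg e /fg [d d0 H]; exists d => // h hd.
by have := H h 0 hd; rewrite l2norm0 dot0r !addr0; apply.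
Qed.

Lemma has_grad2_r m n (f : 'cV[R]_m -> 'cV[R]_n -> R) x y gx gy :
  has_grad2 f x y gx gy -> has_grad (f x) y gy.
Proof.
move=> fg e /fg [d d0 H]; exists d => // k kd.
by have := H 0 k _ kd; rewrite l2norm0 dot0r !addr0 !add0r; apply.
Qed.

Lemma has_grad2E m n (f : 'cV[R]_m -> 'cV[R]_n -> R) x y gx gy :
  has_grad2 f x y gx gy -> gx = grad_x f x y /\ gy = grad_y f x y.
Proof.
move=> fg; split; apply/esym/has_grad_grad.
  exact: has_grad2_l fg.
exact: has_grad2_r fg.
Qed.

Lemma has_grad2_avg m n p (f : 'I_p -> 'cV[R]_m -> 'cV[R]_n -> R) x y gx gy a :
  (forall i, has_grad2 (f i) x y (gx i) (gy i)) ->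
  has_grad2 (fun x y => a * \sum_i f i x y) x y
    (a *: \sum_i gx i) (a *: \sum_i gy i).
Proof.
move=> fg e e0.
have c0 : 0 < `|a| * p%:R + 1 by rewrite ltr_wpDl// mulr_ge0.
have /all_sig2[d d0 H] i := cid2 (fg i (e / (`|a| * p%:R + 1)) (divr_gt0 e0 c0)).
exists (\big[Num.min/1]_i d i).
  by elim/big_ind: _ => // u v u0 v0; rewrite lt_min u0.
move=> h k hd kd.
have dle i : \big[Num.min/1]_i d i <= d i by exact: bigmin_le_cond.
have dot_sum q (g : 'I_p -> 'cV[R]_q) v : dot (a *: \sum_i g i) v = a * \sum_i dot (g i) v.
  rewrite dotZl; congr (_ * _).
  by elim/big_rec2: _ => [|i u w _ <-]; [rewrite dot0l|rewrite dotDl].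
rewrite !dot_sum -mulrDr -!mulrBr -big_split/= -!sumrB normrM.
apply: (@le_trans _ _ (`|a| * \sum_i (e / (`|a| * p%:R + 1) * (l2norm h + l2norm k)))).
  rewrite ler_wpM2l// (le_trans (ler_norm_sum _ _ _))//; apply: ler_sum => i _.
  apply: H; exact: lt_le_trans (dle i).
rewrite sumr_const card_ord -[_ *+ p]mulr_natl; set c := _ + 1; set s := _ + l2norm k.
have -> : `|a| * (p%:R * (e / c * s)) = (e * s) * ((`|a| * p%:R) / c) by ring.
rewrite ler_piMr//; first by rewrite mulr_ge0 ?addr_ge0// ltW.
by rewrite ler_pdivrMr// mul1r lerDl.
Qed.

(** The differential is determined by its values on the basis vectors, where it is a directional
    derivative, that is, an entry of [grad_x] or [grad_y]. The remainder transfers because the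
    maximum norm is below the Euclidean one. *)
Lemma joint_has_grad2 m n (f : 'cV[R]_m -> 'cV[R]_n -> R) x y :
  joint_differentiable f -> has_grad2 f x y (grad_x f x y) (grad_y f x y).
Proof.
move=> /(_ (x, y)); set F := (fun q => _) => dF.
have dE (p : 'cV[R]_m * 'cV[R]_n) : 'd F (x, y) p = dot (grad_x f x y) p.1 + dot (grad_y f x y) p.2.
  have p1 : p.1 = \sum_i p.1 i 0 *: delta_mx i 0.
    apply/colP => j; rewrite summxE (bigD1 j)//= !mxE !eqxx mulr1 big1 ?addr0//.
    by move=> k kj; rewrite !mxE eq_sym (negbTE kj) mulr0.
  have p2 : p.2 = \sum_i p.2 i 0 *: delta_mx i 0.
    apply/colP => j; rewrite summxE (bigD1 j)//= !mxE !eqxx mulr1 big1 ?addr0//.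
    by move=> k kj; rewrite !mxE eq_sym (negbTE kj) mulr0.
  transitivity ('d F (x, y) ((\sum_i p.1 i 0 *: (delta_mx i 0, 0)) + (\sum_i p.2 i 0 *: (0, delta_mx i 0)))).
    congr ('d F (x, y) _).
    rewrite {1}(surjective_pairing p) {1}p1 {1}p2.
    have e1 (I : finType) (c : I -> R) (v : I -> 'cV[R]_m) :
      \sum_i c i *: (v i, 0 : 'cV[R]_n) = (\sum_i c i *: v i, 0).
      by elim/big_rec2: _ => // i u w _ ->; congr pair; rewrite /= ?scaler0 ?addr0.
    have e2 (I : finType) (c : I -> R) (v : I -> 'cV[R]_n) :
      \sum_i c i *: (0 : 'cV[R]_m, v i) = (0, \sum_i c i *: v i).
      by elim/big_rec2: _ => // i u w _ ->; congr pair; rewrite /= ?scaler0 ?addr0.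
    by rewrite e1 e2; congr pair; rewrite /= ?addr0 ?add0r.
  rewrite linearD !linear_sum /dot; congr (_ + _); apply: eq_bigr => i _.
    rewrite linearZ/= -deriveE// mxE mulrC; congr (_ * _).
    apply: (congr1 (fun u : R -> R => lim (u @ 0^'))); apply/funext => t.
    by rewrite /F /= scaler0 add0r.
  rewrite linearZ/= -deriveE// mxE mulrC; congr (_ * _).
  apply: (congr1 (fun u : R -> R => lim (u @ 0^'))); apply/funext => t.
  by rewrite /F /= scaler0 add0r.
move=> e e0.
have /eqaddoP Fo := diff_locally dF.
have := Fo e e0; rewrite near_simpl => /nbhs_ballP[d /= d0 H].
exists d => // h k hd kd.
have sup_l2 q (v : 'cV[R]_q) : `|v| <= l2norm v.
  rewrite [`|v|]mx_normrE; apply/bigmax_leP; split=> // -[i j] _ /=.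
  by rewrite (ord1 j) coord_le_l2norm.
have hk : ball (0 : 'cV[R]_m * 'cV[R]_n) d (h, k).
  split; rewrite /= -ball_normE/= sub0r normrN.
    exact: le_lt_trans (sup_l2 _ _) hd.
  exact: le_lt_trans (sup_l2 _ _) kd.
have E : (F \o shift (x, y) - (cst (F (x, y)) + 'd F (x, y))) (h, k)
    = f (x + h) (y + k) - f x y - (dot (grad_x f x y) h + dot (grad_y f x y) k).
  transitivity (F ((h, k) + (x, y)) - (F (x, y) + 'd F (x, y) (h, k))); first by [].
  by rewrite dE /F/= opprD addrA (addrC x) (addrC y).
have := H _ hk; rewrite E => /le_trans; apply; rewrite ler_wpM2l ?(ltW e0)//.
rewrite prod_normE/= ge_max; apply/andP; split.
  by rewrite (le_trans (sup_l2 _ _))// lerDl.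
by rewrite (le_trans (sup_l2 _ _))// lerDr.
Qed.

Lemma has_jac2_coord m n p (F : 'cV[R]_m -> 'cV[R]_n -> 'cV[R]_p) x y A B :
  (forall j, has_grad2 (fun x y => F x y j 0) x y (col j A) (col j B)) ->
  has_jac2 F x y A B.
Proof.
move=> FAB e e0.
have p0 : 0 < p%:R + 1 :> R by rewrite ltr_wpDl.
have /all_sig2[d d0 H] j := cid2 (FAB j (e / (p%:R + 1)) (divr_gt0 e0 p0)).
exists (\big[Num.min/1]_i d i).
  by elim/big_ind: _ => // u v u0 v0; rewrite lt_min u0.
move=> h k hd kd.
have dle i : \big[Num.min/1]_i d i <= d i by exact: bigmin_le_cond.
rewrite (le_trans (l2norm_le_sum _))//.
have dotE q (M : 'M[R]_(q, p)) v j : (M^T *m v) j 0 = dot (col j M) v.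
  by rewrite mxE; apply: eq_bigr => i _; rewrite !mxE.
apply: (@le_trans _ _ (\sum_(j < p) (e / (p%:R + 1) * (l2norm h + l2norm k)))).
  apply: ler_sum => j _.
  have := H j h k (lt_le_trans hd (dle j)) (lt_le_trans kd (dle j)).
  by apply: le_trans; rewrite !mxE -!dotE !mxE.
rewrite sumr_const card_ord -[_ *+ p]mulr_natl; set s := _ + l2norm k.
have -> : p%:R * (e / (p%:R + 1) * s) = (e * s) * (p%:R / (p%:R + 1)) by ring.
rewrite ler_piMr//; first by rewrite mulr_ge0 ?addr_ge0// ltW.
by rewrite ler_pdivrMr// mul1r lerDl.
Qed.

(** A Lipschitz constant passes to the derivative. This turns the bounds on gradients, and the
    contraction of a gradient step, into bounds on the Hessian blocks. *)
Lemma has_jac2_lipschitz_l m n p (F : 'cV[R]_m -> 'cV[R]_n -> 'cV[R]_p) x y A B L :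
  has_jac2 F x y A B ->
  (forall x' , l2norm (F x' y - F x y) <= L * l2norm (x' - x)) ->
  forall h, l2norm (A^T *m h) <= L * l2norm h.
Proof.
move=> FAB FL h; apply/ler_addgt0Pr => e e0.
have h0 : 0 < l2norm h + 1 by rewrite ltr_wpDl.
have [d d0 H] := FAB (e / (l2norm h + 1)) (divr_gt0 e0 h0).
pose t := d / 2 / (l2norm h + 1).
have t0 : 0 < t by rewrite !divr_gt0.
have th : l2norm (t *: h) < d.
  rewrite l2normZ gtr0_norm// (@le_lt_trans _ _ (t * (l2norm h + 1)))//.
    by rewrite ler_wpM2l ?(ltW t0)// lerDl.
  by rewrite /t divfK ?gt_eqF// ltr_pdivrMr// ltr_pMr// ltr1n.
have := H (t *: h) 0 th; rewrite l2norm0 => /(_ d0).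
rewrite mulmx0 !addr0 => H1.
have := FL (x + t *: h); rewrite [x + _ - x]addrC addKr => H2.
rewrite -(ler_pM2l t0).
have -> : t * l2norm (A^T *m h) = l2norm (A^T *m (t *: h)).
  by rewrite -scalemxAr l2normZ gtr0_norm.
have -> : A^T *m (t *: h) = (F (x + t *: h) y - F x y)
    - (F (x + t *: h) y - F x y - A^T *m (t *: h)) by rewrite subKr.
rewrite (le_trans (l2normB_le _ _))//.
rewrite (le_trans (lerD H2 H1))// l2normZ gtr0_norm//.
rewrite mulrDr mulrCA lerD2l mulrCA ler_pM2l// mulrAC ler_pdivrMr//.
by rewrite ler_pM2l// lerDl.
Qed.

Lemma has_jac2_swap m n p (F : 'cV[R]_m -> 'cV[R]_n -> 'cV[R]_p) x y A B :
  has_jac2 F x y A B -> has_jac2 (fun y x => F x y) y x B A.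
Proof.
move=> FAB e /FAB [d d0 H]; exists d => // h k hd kd.
by rewrite [B^T *m h + _]addrC [l2norm h + _]addrC; exact: H.
Qed.

Lemma has_grad_derivable m (f : 'cV[R]_m -> R) g x h :
  (forall y, has_grad f y (g y)) ->
  forall t : R, is_derive t 1 (fun s => f (x + s *: h)) (dot (g (x + t *: h)) h).
Proof. by move=> fg t; apply: has_grad_is_derive. Qed.

(** Along the segment, f minus its quadratic model has a nonpositive derivative on (0, 1), so the
    mean value theorem replaces the usual integral of the gradient. *)
Lemma quadratic_upper_bound m (f : 'cV[R]_m -> R) g L :
  (forall x, has_grad f x (g x)) ->
  (forall x y, l2norm (g x - g y) <= L * l2norm (x - y)) ->
  forall x h, f (x + h) <= f x + dot (g x) h + L / 2 * l2norm h ^+ 2.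
Proof.
move=> fg gL x h.
pose q (t : R) := f (x + t *: h) - (t * dot (g x) h + L / 2 * l2norm h ^+ 2 * t ^+ 2).
pose dq (t : R) := dot (g (x + t *: h)) h - (dot (g x) h + L * l2norm h ^+ 2 * t).
have Dq (t : R) : is_derive t 1 q (dq t).
  have D1 := has_grad_derivable x h fg t.
  have D2 : is_derive t 1 (fun t : R => t * dot (g x) h + L / 2 * l2norm h ^+ 2 * t ^+ 2)
      (dot (g x) h + L * l2norm h ^+ 2 * t).
    by apply: is_derive_eq; rewrite /GRing.scale/=; field.
  exact: is_deriveB.
have [c /[!in_itv]/= /andP[c0 c1] qE] : exists2 c, c \in `]0, 1[%R & q 1 - q 0 = dq c * (1 - 0).
  apply: MVT => //.
  by apply: derivable_within_continuous => t _; case: (Dq t).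
have dqc : dq c <= 0.
  rewrite /dq opprD addrA -dotBl subr_le0 (le_trans (dot_le _ _))//.
  apply: (@le_trans _ _ (L * l2norm (x + c *: h - x) * l2norm h)).
    by rewrite ler_wpM2r.
  by rewrite [x + _ - x]addrC addKr l2normZ gtr0_norm// expr2; lra.
have : q 1 <= q 0 by rewrite -subr_le0 qE subr0 mulr1.
rewrite /q scale1r scale0r addr0 mul1r mul0r expr1n expr0n/=; lra.
Qed.

(** The secant inequality between x and x + h divided by t, for t tending to 0. The limit is
    replaced by one small t for each tolerance e. *)
Lemma strongly_convex_lower_bound m (f : 'cV[R]_m -> R) x g mu :
  has_grad f x g ->
  (forall y y' t, 0 <= t <= 1 -> f (t *: y + (1 - t) *: y')
     <= t * f y + (1 - t) * f y' - mu / 2 * t * (1 - t) * l2norm (y - y') ^+ 2) ->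
  forall h, f x + dot g h + mu / 2 * l2norm h ^+ 2 <= f (x + h).
Proof.
move=> fg fc h.
suff H e : 0 < e -> f x + dot g h + mu / 2 * l2norm h ^+ 2 <= f (x + h) + e.
  by apply/ler_addgt0Pr => e e0; exact: H.
move=> e0.
(* M dominates both |h| and |mu/2| |h|^2, so that the derivative error and the curvature term of
   order t cost at most e/2 each. *)
pose M := `|mu / 2| * l2norm h ^+ 2 + l2norm h + 1.
have M0 : 0 < M by rewrite ltr_wpDl// addr_ge0// mulr_ge0// sqr_ge0.
pose e' := e / (2 * M).
have e'0 : 0 < e' by rewrite divr_gt0// mulr_gt0.
have [d d0 H] := fg e' e'0.
pose t := Num.min 1 (Num.min (d / (2 * M)) e').
have t0 : 0 < t by rewrite !lt_min ltr01 e'0 divr_gt0// mulr_gt0.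
have t1 : t <= 1 by rewrite ge_min lexx.
have td : t <= d / (2 * M) by rewrite !ge_min lexx orbT.
have te : t <= e' by rewrite !ge_min lexx !orbT.
have hM : l2norm h <= M by rewrite /M -addrA addrCA lerDl addr_ge0// mulr_ge0// sqr_ge0.
have th : l2norm (t *: h) < d.
  rewrite l2normZ gtr0_norm// (@le_lt_trans _ _ (d / (2 * M) * M))//.
    by rewrite ler_pM// ltW.
  have -> : d / (2 * M) * M = d / 2 by field; rewrite gt_eqF.
  by rewrite ltr_pdivrMr// ltr_pMr// ltr1n.
have := H _ th; rewrite l2normZ (gtr0_norm t0) ler_norml dotZr => /andP[H1 _].
have := fc (x + h) x t; rewrite (ltW t0) t1 => /(_ isT).
have -> : t *: (x + h) + (1 - t) *: x = x + t *: h.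
  by apply/colP => i; rewrite !mxE; ring.
rewrite [x + h - x]addrC addKr => H2.
have : t * (dot g h - e' * l2norm h) <= t * (f (x + h) - f x - mu / 2 * (1 - t) * l2norm h ^+ 2).
  by move: H1 H2; lra.
rewrite ler_pM2l// => H3.
have K1 : e' * l2norm h <= e / 2.
  have -> : e / 2 = e' * M by rewrite /e'; field; rewrite gt_eqF.
  by rewrite ler_wpM2l// ltW.
have K2 : mu / 2 * t * l2norm h ^+ 2 <= e / 2.
  have -> : e / 2 = e' * M by rewrite /e'; field; rewrite gt_eqF.
  apply: (@le_trans _ _ (t * (`|mu / 2| * l2norm h ^+ 2))).
    rewrite mulrAC [_ * t]mulrC ler_wpM2l ?(ltW t0)// ler_wpM2r ?sqr_ge0//.
    exact: ler_norm.
  apply: ler_pM => //; rewrite ?(ltW t0)// ?mulr_ge0 ?sqr_ge0//.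
  by rewrite /M -addrA lerDl addr_ge0.
by move: H3 K1 K2; lra.
Qed.

End Gradients.

(** * Strong convexity: cocoercivity, contraction, existence of a minimizer *)

Section StrongConvexity.
Context {R : realType}.

Section OnePoint.
Context {m : nat} (f : 'cV[R]_m -> R) (g : 'cV[R]_m -> 'cV[R]_m) (mu L : R).
Hypothesis muL : mu <= L.
Hypothesis lower : forall x h, f x + dot (g x) h + mu / 2 * l2norm h ^+ 2 <= f (x + h).
Hypothesis upper : forall x h, f (x + h) <= f x + dot (g x) h + L / 2 * l2norm h ^+ 2.

(** Cocoercivity of f - mu/2 |.|^2, which is convex with a quadratic upper bound of constant L - mu;
    w is the increment of its gradient. Only the two quadratic bounds are used. *)
Lemma strong_cocoercivity x y :
  mu * L * l2norm (y - x) ^+ 2 + l2norm (g y - g x) ^+ 2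
  <= (mu + L) * dot (g y - g x) (y - x).
Proof.
set D := y - x; set G := g y - g x; pose w := G - mu *: D.
(* The point b - s v is estimated from below starting at a and from above starting at b. Exchanging
   a and b and adding cancels the function values. *)
have half (a b d v : 'cV[R]_m) (s : R) : d = b - a -> v = g b - g a - mu *: d ->
    (s - (L - mu) / 2 * s ^+ 2) * l2norm v ^+ 2
    <= f b - f a - dot (g a) d - mu / 2 * l2norm d ^+ 2.
  move=> dE vE.
  have H1 := lower a (d - s *: v); have H2 := upper b (- (s *: v)).
  have E : a + (d - s *: v) = b + - (s *: v).
    by rewrite dE addrA [a + _]addrC subrK.
  have vv : l2norm v ^+ 2 = dot (g b) v - dot (g a) v - mu * dot d v.
    by rewrite l2norm_sqr {1}vE !dotBl dotZl.
  rewrite E in H1; have := le_trans H1 H2.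
  rewrite l2normN l2norm_sqrB !l2normZ !exprMn real_normK ?num_real//.
  rewrite !(dotBr, dotNr, dotZr).
  have := congr1 (fun z => s * z) vv.
  move: (dot (g a) v) (dot (g b) v) (dot d v) (l2norm v ^+ 2) => p q r n.
  lra.
have H s : (2 * s - (L - mu) * s ^+ 2) * l2norm w ^+ 2 <= dot w D.
  have h1 := half x y D w s erefl erefl.
  have h2 : (s - (L - mu) / 2 * s ^+ 2) * l2norm (- w) ^+ 2
      <= f x - f y - dot (g y) (- D) - mu / 2 * l2norm (- D) ^+ 2.
    apply: half; first by rewrite opprB.
    by rewrite /w /G /D; apply/colP => i; rewrite !mxE; ring.
  move: h2; rewrite !l2normN dotNr.
  have -> : dot w D = dot (g y) D - dot (g x) D - mu * l2norm D ^+ 2.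
    by rewrite /w dotBl dotZl -l2norm_sqr /G dotBl.
  move: h1; lra.
have : l2norm w ^+ 2 <= (L - mu) * dot w D.
  (* For L = mu the left side of [H] is linear in s, and a large s forces w = 0; otherwise s = 1/(L
     - mu) maximizes it. *)
  have [M0|Mn0] := eqVneq (L - mu) 0.
    rewrite M0 mul0r leNgt; apply/negP => w0.
    have := H ((dot w D + 1) / (2 * l2norm w ^+ 2)); rewrite M0.
    have -> : (2 * ((dot w D + 1) / (2 * l2norm w ^+ 2))
       - 0 * ((dot w D + 1) / (2 * l2norm w ^+ 2)) ^+ 2) * l2norm w ^+ 2 = dot w D + 1.
      by field; have := gt_eqF w0; rewrite sqrf_eq0 => ->.
    lra.
  have Mgt : 0 < L - mu by rewrite lt_def Mn0 subr_ge0.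
  have := H (L - mu)^-1.
  have -> : (2 * (L - mu)^-1 - (L - mu) * (L - mu)^-1 ^+ 2) * l2norm w ^+ 2
      = l2norm w ^+ 2 / (L - mu) by field.
  by rewrite ler_pdivrMr// mulrC.
rewrite /w; clear half H w; clearbody D G.
rewrite l2norm_sqrB l2normZ exprMn real_normK ?num_real// dotZr dotBl dotZl -l2norm_sqr.
by move: (dot G D) (l2norm G ^+ 2) (l2norm D ^+ 2) => p q r; lra.
Qed.

End OnePoint.

(** Once cocoercivity has replaced the inner product, |v|^2 has the coefficient b^2 - 2 b / (mu + L)
    <= 0, so |v| may be replaced by its lower bound mu |u|, and what remains is the perfect square
    (1 - b mu)^2 |u|^2. *)
Lemma contraction_of_cocoercivity m (u v : 'cV[R]_m) mu L b :
  0 < mu -> mu <= L -> 0 <= b -> b <= 2 / (mu + L) ->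
  mu * L * l2norm u ^+ 2 + l2norm v ^+ 2 <= (mu + L) * dot v u ->
  l2norm (u - b *: v) <= (1 - b * mu) * l2norm u.
Proof.
move=> mu0 muL b0 bL H.
have L0 : 0 < L by exact: lt_le_trans muL.
have bL' : b * (mu + L) <= 2 by rewrite -ler_pdivlMr// addr_gt0.
have bmu : b * mu <= 1 by nra.
(* Cocoercivity and Cauchy-Schwarz give (mu |u| - |v|) (L |u| - |v|) <= 0. *)
have vu : mu * l2norm u <= l2norm v.
  rewrite leNgt; apply/negP => vlt.
  have u0 := l2norm_ge0 u; have v0 := l2norm_ge0 v; have := dot_le v u.
  move: H vlt u0 v0; move: (dot v u) (l2norm u) (l2norm v) => p q r H vlt u0 v0 pr.
  have : 0 < (mu * q - r) * (L * q - r).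
    rewrite mulr_gt0 ?subr_gt0// (lt_le_trans vlt)//.
    by rewrite ler_wpM2r.
  have : (mu + L) * p <= (mu + L) * (r * q) by rewrite ler_wpM2l// addr_ge0 ?ltW.
  lra.
rewrite ler_l2norm_sqr ?subr_ge0// l2norm_sqrB l2normZ exprMn real_normK ?num_real//.
rewrite dotZr (dotC u).
have vu2 : mu ^+ 2 * l2norm u ^+ 2 <= l2norm v ^+ 2.
  by rewrite -exprMn ler_pXn2r ?nnegrE ?mulr_ge0// ltW.
have S0 : 0 < mu + L by rewrite addr_gt0.
rewrite -(ler_pM2l S0).
move: H vu2; move: (dot v u) (l2norm u ^+ 2) (l2norm v ^+ 2) => p q r H vu2.
have : 0 <= b * (2 - b * (mu + L)) * (r - mu ^+ 2 * q).
  by rewrite !mulr_ge0// subr_ge0.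
have : 0 <= 2 * b * ((mu + L) * p - (mu * L * q + r)).
  by rewrite !mulr_ge0// subr_ge0.
lra.
Qed.

Lemma has_grad_lipschitz m (f : 'cV[R]_m -> R) x g C :
  has_grad f x g -> (forall y, `|f y - f x| <= C * l2norm (y - x)) -> 0 <= C ->
  l2norm g <= C.
Proof.
move=> fg fC C0.
have [g0|g0] := eqVneq (l2norm g) 0; first by rewrite g0.
have gp : 0 < l2norm g by rewrite lt_def g0/=.
apply/ler_addgt0Pr => e e0; have [d d0 H] := fg e e0.
pose t := d / 2 / l2norm g.
have t0 : 0 < t by rewrite !divr_gt0.
have th : l2norm (t *: g) < d.
  rewrite l2normZ (gtr0_norm t0) /t divfK//.
  by rewrite ltr_pdivrMr// ltr_pMr// ltr1n.
have := H _ th; have := fC (x + t *: g).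
rewrite [x + _ - x]addrC addKr l2normZ (gtr0_norm t0) dotZr -l2norm_sqr.
rewrite !ler_norml => /andP[_ H1] /andP[H2 _].
have : t * l2norm g * l2norm g <= t * l2norm g * (C + e) by lra.
by rewrite ler_pM2l// mulr_gt0.
Qed.

Lemma has_grad_min m (f : 'cV[R]_m -> R) x g :
  has_grad f x g -> (forall y, f x <= f y) -> g = 0.
Proof.
move=> fg fmin; apply: l2norm_eq0; apply/eqP; rewrite eq_le l2norm_ge0 andbT.
rewrite leNgt; apply/negP => gp.
have [d d0 H] := fg (l2norm g / 2) (divr_gt0 gp (ltr0Sn _ 1)).
pose t := d / 2 / l2norm g.
have t0 : 0 < t by rewrite !divr_gt0.
have th : l2norm (- t *: g) < d.
  rewrite l2normZ normrN (gtr0_norm t0) /t divfK ?gt_eqF//.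
  by rewrite ltr_pdivrMr// ltr_pMr// ltr1n.
have := H _ th; have := fmin (x + - t *: g).
rewrite l2normZ normrN (gtr0_norm t0) dotZr -l2norm_sqr ler_norml => H1 /andP[_ H2].
have : 0 < t * l2norm g ^+ 2 by rewrite mulr_gt0// exprn_gt0.
by move: H1 H2; rewrite expr2; lra.
Qed.

Lemma has_grad_continuous m (f : 'cV[R]_m -> R) g :
  (forall x, has_grad f x (g x)) -> continuous f.
Proof.
move=> fg x A /nbhs_ballP[e /= e0 eA]; apply/nbhs_l2normP.
have [d d0 H] := fg x 1 ltr01.
have c0 : 0 < l2norm (g x) + 1 by rewrite ltr_wpDl.
exists (Num.min d (e / (l2norm (g x) + 1))); first by rewrite lt_min d0 divr_gt0.
move=> y; rewrite lt_min => /andP[yd ye].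
have := H _ yd; rewrite [x + _]addrC subrK mul1r => Hy.
apply: eA; rewrite -ball_normE/= distrC -[f y - f x](subrK (dot (g x) (y - x))).
rewrite (le_lt_trans (ler_normD _ _))//.
apply: (@le_lt_trans _ _ ((l2norm (g x) + 1) * l2norm (y - x))).
  by rewrite mulrDl mul1r addrC lerD// norm_dot_le.
by rewrite mulrC -ltr_pdivlMr.
Qed.

(** Coercivity: the quadratic lower bound at 0 exceeds f 0 as soon as |y| >= 2 |g 0| / mu, so a
    minimizer over the compact box of that half-width is global. The box consists of row vectors to
    match the extreme value theorem. *)
Lemma strongly_convex_min m (f : 'cV[R]_m -> R) g mu :
  0 < mu -> (forall x, has_grad f x (g x)) ->
  (forall x h, f x + dot (g x) h + mu / 2 * l2norm h ^+ 2 <= f (x + h)) ->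
  exists y, forall y', f y <= f y'.
Proof.
move=> mu0 fg lower.
pose r := 2 * l2norm (g 0) / mu.
have r0 : 0 <= r by rewrite !mulr_ge0 ?invr_ge0 ?(ltW mu0).
pose A : set 'rV[R]_m := [set v | forall i, v 0 i \in `[-r, r]].
have cA : compact A by apply: (@rV_compact R m (fun=> `[-r, r]%classic)) => i; exact: segment_compact.
have out y : ~ A y^T -> f 0 <= f y.
  move=> nA; have [i yi] : exists i, r < `|y i 0|.
    apply: contrapT => /forallNP H; apply: nA => i; rewrite mxE in_itv/= -ler_norml.
    by rewrite leNgt; apply/negP/H.
  have yr : r < l2norm y by exact: lt_le_trans yi (coord_le_l2norm _ _).
  have := lower 0 y; rewrite add0r; apply: le_trans.
  rewrite -addrA lerDl.
  have := norm_dot_le (g 0) y; rewrite ler_norml => /andP[H _].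
  apply: (@le_trans _ _ (- (l2norm (g 0) * l2norm y) + mu / 2 * l2norm y ^+ 2)); last by rewrite lerD2r.
  have : mu * r = 2 * l2norm (g 0) by rewrite /r; field; rewrite gt_eqF.
  move=> mur; have : 0 <= mu * (l2norm y * (l2norm y - r)).
    by rewrite !mulr_ge0 ?(ltW mu0)// subr_ge0 ltW.
  have -> : l2norm (g 0) = mu * r / 2 by rewrite mur mulrAC divff ?mul1r.
  lra.
have A0 : A !=set0 by exists 0 => i; rewrite mxE in_itv/= oppr_le0 r0.
have ct : continuous (fun v : 'rV[R]_m => f v^T).
  move=> v; apply: continuous_comp; last exact: has_grad_continuous fg _.
  move=> B /nbhs_ballP[e /= e0 eB]; apply/nbhs_ballP; exists e => // u [_ vu].
  by apply: eB; split=> // i j; rewrite !mxE; exact: vu.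
have [c cA' cmin] := @EVT_min_rV R m (fun v => f v^T) A A0 cA (continuous_subspaceT ct).
exists c^T => y.
have [Ay|nAy] := pselect (A y^T).
  by have := cmin y^T; rewrite trmxK; apply; rewrite inE.
apply: le_trans (out y nAy); have := cmin 0; rewrite trmx0; apply.
by rewrite inE => i; rewrite mxE in_itv/= oppr_le0 r0.
Qed.

End StrongConvexity.

(** * The bilevel problem *)

Section Averages.
Context {R : realType}.

Definition avg (V : lmodType R) n (v : 'I_n -> V) : V := n%:R^-1 *: \sum_i v i.

Lemma avgB (V : lmodType R) n (u v : 'I_n -> V) :
  avg u - avg v = avg (fun i => u i - v i).
Proof. by rewrite /avg -scalerBr sumrB. Qed.

Lemma avgD (V : lmodType R) n (u v : 'I_n -> V) :
  avg u + avg v = avg (fun i => u i + v i).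
Proof. by rewrite /avg -scalerDr big_split. Qed.

Lemma avg_cst (V : lmodType R) n (v : V) : (0 < n)%N -> avg (fun _ : 'I_n => v) = v.
Proof.
move=> n0; rewrite /avg sumr_const card_ord -[v *+ n]scaler_nat scalerA mulVf ?scale1r//.
by rewrite pnatr_eq0 -lt0n.
Qed.

Lemma avg_mulmx n m k l (A : 'I_n -> 'M[R]_(m, k)) (v : 'M[R]_(k, l)) :
  avg A *m v = avg (fun i => A i *m v).
Proof. by rewrite /avg -scalemxAl mulmx_suml. Qed.

Lemma trmxZ_mulmx m n k (a : R) (M : 'M[R]_(m, n)) (h : 'M[R]_(m, k)) :
  (a *: M)^T *m h = a *: (M^T *m h).
Proof. by rewrite linearZ/= scalemxAl. Qed.

Lemma trmx_1BZ_mulmx m (a : R) (M : 'M[R]_m) (h : 'cV[R]_m) :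
  (1%:M - a *: M)^T *m h = h - a *: (M^T *m h).
Proof. by rewrite linearB/= trmx1 mulmxBl mul1mx trmxZ_mulmx. Qed.

Lemma gradient_step_diff m (a : R) (u u' v v' : 'cV[R]_m) :
  u - u' - a *: (v - v') = (u - a *: v) - (u' - a *: v').
Proof. by apply/colP => i; rewrite !mxE; ring. Qed.

Lemma gradient_step_deriv m (a : R) (u h v v' A B : 'cV[R]_m) :
  u + h - a *: v' - (u - a *: v) - (h - a *: A + - a *: B)
  = - (a *: (v' - v - (A + B))).
Proof. by apply/colP => i; rewrite !mxE; ring. Qed.

Lemma l2norm_avg_le n m (v : 'I_n -> 'cV[R]_m) C : 0 <= C ->
  (forall i, l2norm (v i) <= C) -> l2norm (avg v) <= C.
Proof.
case: n v => [|n] v C0 vC; first by rewrite /avg big_ord0 scaler0 l2norm0.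
rewrite /avg l2normZ ger0_norm ?invr_ge0// mulrC ler_pdivrMr//.
rewrite (le_trans (l2norm_sum_le _ _))// -[X in _ <= _ * X%:R]card_ord mulr_natr -sumr_const.
by apply: ler_sum => i _.
Qed.

Lemma l2norm_sqr_avg_le n m (v : 'I_n -> 'cV[R]_m) C : 0 <= C ->
  (forall i, l2norm (v i) ^+ 2 <= C) -> l2norm (avg v) ^+ 2 <= C.
Proof.
move=> C0 vC; rewrite (le_trans (l2norm_avg_sqr_le _))//.
case: n v vC => [|n] v vC; first by rewrite big_ord0 mulr0.
rewrite mulrC ler_pdivrMr//.
rewrite -[X in _ <= _ * X%:R]card_ord mulr_natr -sumr_const.
by apply: ler_sum => i _.
Qed.

Lemma has_grad2_avgE n dx dy (f : 'I_n -> 'cV[R]_dx -> 'cV[R]_dy -> R) x y gx gy :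
  (forall i, has_grad2 (f i) x y (gx i) (gy i)) ->
  has_grad2 (fun x y => n%:R^-1 * \sum_i f i x y) x y (avg gx) (avg gy).
Proof. exact: has_grad2_avg. Qed.

End Averages.

Section ConvexSquares.
Context {R : realType}.

(** Convexity of the square with weights 1 - t and t at the points r and |d|/t. Every contraction of
    a norm becomes in this way a contraction of the squared error with the same factor, the
    perturbation being divided by t. *)
Lemma l2norm_sqrD_convex m (v d : 'cV[R]_m) t r : 0 < t -> t <= 1 -> 0 <= r ->
  l2norm v <= (1 - t) * r ->
  l2norm (v + d) ^+ 2 <= (1 - t) * r ^+ 2 + l2norm d ^+ 2 / t.
Proof.
move=> t0 t1 r0 vr.
have H : l2norm (v + d) <= (1 - t) * r + l2norm d.
  by rewrite (le_trans (l2normD_le _ _))// lerD2r.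
have : l2norm (v + d) ^+ 2 <= ((1 - t) * r + l2norm d) ^+ 2.
  by rewrite ler_pXn2r ?nnegrE// addr_ge0// mulr_ge0// subr_ge0.
move=> /le_trans; apply.
rewrite -subr_ge0.
have -> : (1 - t) * r ^+ 2 + l2norm d ^+ 2 / t - ((1 - t) * r + l2norm d) ^+ 2
  = (1 - t) * t * (r - l2norm d / t) ^+ 2 by field; rewrite gt_eqF.
by rewrite mulr_ge0 ?sqr_ge0// mulr_ge0 ?subr_ge0// ltW.
Qed.

Lemma affine_diff m k (A B : 'M[R]_(m, k)) (u v : 'cV[R]_k) (a b : 'cV[R]_m) :
  (A *m u + a) - (B *m v + b) = A *m (u - v) + (A - B) *m v + (a - b).
Proof.
rewrite mulmxBr mulmxBl; move: (A *m u) (A *m v) (B *m v) => p q r.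
by apply/colP => i; rewrite !mxE; ring.
Qed.

Lemma gradient_step_split m t (u v w q r : 'cV[R]_m) :
  u - v - t *: q + (- (t *: r) + (v - w)) = u - t *: (q + r) - w.
Proof. by apply/colP => i; rewrite !mxE; ring. Qed.

Lemma momentum_step_split m t (u v v' w : 'cV[R]_m) :
  (1 - t) *: (u - v) + (t *: (w - v) + (v - v')) = (1 - t) *: u + t *: w - v'.
Proof. by apply/colP => i; rewrite !mxE; ring. Qed.

Lemma affine_diffl m k (A B : 'M[R]_(m, k)) (v : 'cV[R]_k) (a b : 'cV[R]_m) :
  (A *m v + a) - (B *m v + b) = (A - B) *m v + (a - b).
Proof. by rewrite affine_diff subrr mulmx0 add0r. Qed.

Lemma ler_sqr_l2norm m (v : 'cV[R]_m) b : l2norm v <= b -> l2norm v ^+ 2 <= b ^+ 2.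
Proof. by move=> vb; rewrite ler_pXn2r ?nnegrE// (le_trans _ vb). Qed.

Lemma l2norm_mulmx_sqr_le m k (A : 'M[R]_(m, k)) v b r :
  specnorm A ^+ 2 <= b -> l2norm v ^+ 2 <= r ->
  l2norm (A *m v) ^+ 2 <= b * r.
Proof.
move=> Ab vr; rewrite (le_trans (ler_sqr_l2norm (l2norm_mulmx_le A v)))//.
by rewrite exprMn ler_pM ?sqr_ge0.
Qed.

End ConvexSquares.

(** * Derivatives of the averages, the minimizer, the hypergradient *)

Section Problem.
Context {R : realType} {n dx dy : nat} {d_f d_g : measure_display}.
Context {Sf : measurableType d_f} {Sg : measurableType d_g}.
Variables (c : regularity R) (p : problem R n dx dy Sf Sg).
Hypothesis n_gt0 : (0 < n)%N.
Hypothesis dy_gt0 : (0 < dy)%N.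
Hypothesis wp : well_posed p.
Hypothesis ct : continuity p c.
Hypothesis sc : strong_convexity p (mu_g c).
Hypothesis lip : lipschitz_constants p c.

Local Notation f i := (f_ p i).
Local Notation g i := (g_ p i).
Local Notation fa := (f_avg p).
Local Notation ga := (g_avg p).
Local Notation ys := (ystar p).
Local Notation zs := (zstar p).
Local Notation mu := (mu_g c).
Local Notation L := (L_g c).

Let mu_gt0 : 0 < mu. Proof. by case: sc. Qed.

Lemma has_grad2_f i x y : has_grad2 (f i) x y (grad_x (f i) x y) (grad_y (f i) x y).
Proof. by apply: joint_has_grad2; case: wp => _ [/(_ i) [] ]. Qed.

Lemma has_grad2_g i x y : has_grad2 (g i) x y (grad_x (g i) x y) (grad_y (g i) x y).
Proof. by apply: joint_has_grad2; case: wp => _ [/(_ i) [_ []] ]. Qed.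

Lemma has_grad2_fa x y : has_grad2 fa x y (grad_x fa x y) (grad_y fa x y).
Proof.
have H := has_grad2_avgE (fun i => has_grad2_f i x y).
by have [<- <-] := has_grad2E H.
Qed.

Lemma has_grad2_ga x y : has_grad2 ga x y (grad_x ga x y) (grad_y ga x y).
Proof.
have H := has_grad2_avgE (fun i => has_grad2_g i x y).
by have [<- <-] := has_grad2E H.
Qed.

Lemma grad_faE x y : grad_x fa x y = avg (fun i => grad_x (f i) x y)
  /\ grad_y fa x y = avg (fun i => grad_y (f i) x y).
Proof.
by have [-> ->] := has_grad2E (has_grad2_avgE (fun i => has_grad2_f i x y)).
Qed.

Lemma grad_gaE x y : grad_y ga x y = avg (fun i => grad_y (g i) x y).
Proof.
by have [_ ->] := has_grad2E (has_grad2_avgE (fun i => has_grad2_g i x y)).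
Qed.

Lemma has_grad2_grad_g i x y j :
  has_grad2 (fun x y => grad_y (g i) x y j 0) x y
    (col j (hess_xy (g i) x y)) (col j (hess_yy (g i) x y)).
Proof.
have -> : col j (hess_xy (g i) x y) = grad_x (fun x y => grad_y (g i) x y j 0) x y.
  by apply/colP => k; rewrite !mxE.
have -> : col j (hess_yy (g i) x y) = grad_y (fun x y => grad_y (g i) x y j 0) x y.
  by apply/colP => k; rewrite !mxE.
apply: joint_has_grad2 => q.
have dg : differentiable (fun q : 'cV[R]_dx * 'cV[R]_dy => grad_y (g i) q.1 q.2) q.
  by case: wp => _ [/(_ i) [_ [_ ]] + _]; apply.
apply: (@differentiable_comp _ _ _ _ (fun q : 'cV[R]_dx * 'cV[R]_dy => grad_y (g i) q.1 q.2) (fun v : 'cV[R]_dy => v j 0)) => //.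
exact: differentiable_coord.
Qed.

Lemma has_grad2_grad_ga x y j :
  has_grad2 (fun x y => grad_y ga x y j 0) x y
    (avg (fun i => col j (hess_xy (g i) x y)))
    (avg (fun i => col j (hess_yy (g i) x y))).
Proof.
have -> : (fun x y => grad_y ga x y j 0)
    = (fun x y => n%:R^-1 * \sum_i grad_y (g i) x y j 0).
  by apply/funext => x'; apply/funext => y'; rewrite grad_gaE !mxE summxE.
by apply: has_grad2_avgE => i; exact: has_grad2_grad_g.
Qed.

Lemma hess_gaE x y : hess_xy ga x y = avg (fun i => hess_xy (g i) x y)
  /\ hess_yy ga x y = avg (fun i => hess_yy (g i) x y).
Proof.
split; apply/matrixP => k j; rewrite mxE;
  have [E1 E2] := has_grad2E (has_grad2_grad_ga x y j).
  by rewrite -E1 !mxE !summxE; congr (_ * _); apply: eq_bigr => i _; rewrite !mxE.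
by rewrite -E2 !mxE !summxE; congr (_ * _); apply: eq_bigr => i _; rewrite !mxE.
Qed.

Lemma has_jac2_g i x y :
  has_jac2 (grad_y (g i)) x y (hess_xy (g i) x y) (hess_yy (g i) x y).
Proof. by apply: has_jac2_coord => j; exact: has_grad2_grad_g. Qed.

Lemma has_jac2_ga x y : has_jac2 (grad_y ga) x y (hess_xy ga x y) (hess_yy ga x y).
Proof.
apply: has_jac2_coord => j; have [-> ->] := hess_gaE x y.
have := has_grad2_grad_ga x y j; congr has_grad2.
  by apply/colP => k; rewrite !mxE !summxE; congr (_ * _); apply: eq_bigr => i _; rewrite !mxE.
by apply/colP => k; rewrite !mxE !summxE; congr (_ * _); apply: eq_bigr => i _; rewrite !mxE.
Qed.

Lemma grad_f_lipschitz i x y y' :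
  l2norm (grad_x (f i) x y - grad_x (f i) x y') <= L_f c * l2norm (y - y')
  /\ l2norm (grad_y (f i) x y - grad_y (f i) x y') <= L_f c * l2norm (y - y').
Proof.
have [_ [+ _]] := ct i; move=> /(_ x y x y'); rewrite (subrr x) l2norm_col_0mx => H.
move: H; rewrite /grad_full opp_col_mx add_col_mx => H.
by split; apply: le_trans H; [exact: l2norm_col_mxu|exact: l2norm_col_mxd].
Qed.

Lemma grad_g_lipschitz i x y x' y' :
  l2norm (grad_y (g i) x y - grad_y (g i) x' y') <= L * l2norm (col_mx (x - x') (y - y')).
Proof.
have [_ [_ [+ _]]] := ct i; move=> /(_ x y x' y'); apply: le_trans.
by rewrite /grad_full opp_col_mx add_col_mx; exact: l2norm_col_mxd.
Qed.

Lemma g_upper i x y h :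
  g i x (y + h) <= g i x y + dot (grad_y (g i) x y) h + L / 2 * l2norm h ^+ 2.
Proof.
apply: quadratic_upper_bound => [y'|y1 y2].
  exact: has_grad2_r (has_grad2_g i x y').
by have := grad_g_lipschitz i x y1 x y2; rewrite (subrr x) l2norm_col_0mx.
Qed.

Lemma g_lower i x y h :
  g i x y + dot (grad_y (g i) x y) h + mu / 2 * l2norm h ^+ 2 <= g i x (y + h).
Proof.
apply: strongly_convex_lower_bound; first exact: has_grad2_r (has_grad2_g i x y).
by move=> y1 y2 t t01; case: sc => _; apply.
Qed.

Lemma dot_avg m (v : 'I_n -> 'cV[R]_m) h : dot (avg v) h = n%:R^-1 * \sum_i dot (v i) h.
Proof.
rewrite dotZl; congr (_ * _).
by elim/big_rec2: _ => [|i u w _ <-]; [rewrite dot0l|rewrite dotDl].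
Qed.

Let nV_gt0 : 0 < n%:R^-1 :> R. Proof. by rewrite invr_gt0 ltr0n. Qed.
Let avg1 (a : R) : n%:R^-1 * \sum_(i < n) a = a.
Proof. exact: (@avg_cst R R^o n a n_gt0). Qed.

Lemma ga_upper x y h :
  ga x (y + h) <= ga x y + dot (grad_y ga x y) h + L / 2 * l2norm h ^+ 2.
Proof.
rewrite /g_avg grad_gaE dot_avg -[L / 2 * _]avg1 -!mulrDr -!big_split/=.
by rewrite ler_pM2l//; apply: ler_sum => i _; exact: g_upper.
Qed.

Lemma ga_lower x y h :
  ga x y + dot (grad_y ga x y) h + mu / 2 * l2norm h ^+ 2 <= ga x (y + h).
Proof.
rewrite /g_avg grad_gaE dot_avg -[mu / 2 * _]avg1 -!mulrDr -!big_split/=.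
by rewrite ler_pM2l//; apply: ler_sum => i _; exact: g_lower.
Qed.

(** The two quadratic bounds compared along a unit vector, which exists because dy > 0. *)
Lemma mu_le_L : mu <= L.
Proof.
pose h : 'cV[R]_dy := delta_mx (Ordinal dy_gt0) 0.
have := le_trans (ga_lower 0 0 h) (ga_upper 0 0 h).
rewrite lerD2l l2norm_delta expr1n !mulr1 => H.
by move: H; lra.
Qed.

Let L_gt0 : 0 < L. Proof. exact: lt_le_trans mu_le_L. Qed.

(** Existence of a minimizer rules out the default value of [xget]. *)
Lemma ystar_min x y : ga x (ys x) <= ga x y.
Proof.
have [y0 y0min] := strongly_convex_min mu_gt0
  (fun y => has_grad2_r (has_grad2_ga x y)) (ga_lower x).
rewrite /ystar; case: xgetP => [y1 _ y1min|H]; first exact: y1min.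
by have := H y0 y0min.
Qed.

Lemma grad_ystar x : grad_y ga x (ys x) = 0.
Proof. by apply: has_grad_min (has_grad2_r (has_grad2_ga x (ys x))) _; exact: ystar_min. Qed.

Lemma grad_ga_contraction x y y' b : 0 <= b -> b <= 2 / (mu + L) ->
  l2norm ((y - b *: grad_y ga x y) - (y' - b *: grad_y ga x y'))
  <= (1 - b * mu) * l2norm (y - y').
Proof.
move=> b0 bL.
have := contraction_of_cocoercivity mu_gt0 mu_le_L b0 bL
  (strong_cocoercivity mu_le_L (ga_lower x) (ga_upper x) y' y).
by rewrite gradient_step_diff.
Qed.

Lemma ystep_contraction x y b : 0 <= b -> b <= 2 / (mu + L) ->
  l2norm (y - b *: grad_y ga x y - ys x) <= (1 - b * mu) * l2norm (y - ys x).
Proof.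
move=> b0 bL; have := grad_ga_contraction x y (ys x) b0 bL.
by rewrite grad_ystar scaler0 subr0.
Qed.

(* The gradient step is (1 - b mu)-Lipschitz in y, hence so is its derivative,
   which involves the transpose of [hess_yy]. *)
Lemma hess_yy_contraction x y b z : 0 <= b -> b <= 2 / (mu + L) ->
  l2norm (z - b *: (hess_yy ga x y *m z)) <= (1 - b * mu) * l2norm z.
Proof.
move=> b0 bL.
have bmu : 0 <= 1 - b * mu.
  rewrite subr_ge0; apply: (@le_trans _ _ (2 / (mu + L) * mu)).
    by rewrite ler_wpM2r ?(ltW mu_gt0).
  by rewrite mulrAC ler_pdivrMr ?addr_gt0// mul1r; have := mu_le_L; lra.
(* The arguments are swapped so that the derivative in y is the first block, the one bounded by
   [has_jac2_lipschitz_l]. *)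
have J : has_jac2 (fun y' x' => y' - b *: grad_y ga x' y') y x
    (1%:M - b *: hess_yy ga x y) (- b *: hess_xy ga x y).
  move=> e e0.
  have b1 : 0 < b + 1 by rewrite ltr_wpDl.
  have [d d0 H] := has_jac2_swap (has_jac2_ga x y) (divr_gt0 e0 b1).
  exists d => // h k hd kd; have := H h k hd kd.
  set r := l2norm (_ - _ - _) => Hr.
  have -> : y + h - b *: grad_y ga (x + k) (y + h) - (y - b *: grad_y ga x y)
      - ((1%:M - b *: hess_yy ga x y)^T *m h + (- b *: hess_xy ga x y)^T *m k)
    = - (b *: (grad_y ga (x + k) (y + h) - grad_y ga x y
          - ((hess_yy ga x y)^T *m h + (hess_xy ga x y)^T *m k))).
    by rewrite trmx_1BZ_mulmx trmxZ_mulmx gradient_step_deriv.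
  rewrite l2normN l2normZ ger0_norm// -/r.
  apply: (@le_trans _ _ (b * (e / (b + 1) * (l2norm h + l2norm k)))).
    by rewrite ler_wpM2l.
  have -> : b * (e / (b + 1) * (l2norm h + l2norm k))
    = e * (l2norm h + l2norm k) * (b / (b + 1)) by ring.
  rewrite ler_piMr//; first by rewrite mulr_ge0 ?addr_ge0// ltW.
  by rewrite ler_pdivrMr// mul1r lerDl.
have H := has_jac2_lipschitz_l J (fun y' => grad_ga_contraction x y' y b0 bL).
have := l2norm_trmx_le bmu H z.
by rewrite trmxK mulmxBl mul1mx -scalemxAl.
Qed.

(** The contraction and the triangle inequality give |z| <= (1 - b mu) |z| + b |H z|. Both the
    invertibility of the Hessian and the bound C_f / mu on zstar come from here. *)
Lemma hess_yy_lower x y z : mu * l2norm z <= l2norm (hess_yy ga x y *m z).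
Proof.
pose b := 2 / (mu + L).
have b0 : 0 < b by rewrite divr_gt0// addr_gt0.
have := hess_yy_contraction x y z (ltW b0) (lexx _).
have := l2normD_le (z - b *: (hess_yy ga x y *m z)) (b *: (hess_yy ga x y *m z)).
rewrite subrK l2normZ (gtr0_norm b0) => H1 H2.
by rewrite -(ler_pM2l b0); lra.
Qed.

Lemma hess_yy_unit x y : hess_yy ga x y \in unitmx.
Proof.
rewrite -unitmx_tr unitmxE unitfE; apply/negP => /eqP d0.
have /det0P[v v0 vH] : \det (hess_yy ga x y)^T == 0 by rewrite d0.
have := hess_yy_lower x y v^T.
rewrite -[hess_yy _ _ _ *m _]trmxK trmx_mul trmxK vH trmx0 l2norm0.
rewrite pmulr_rle0// => vle.
have /l2norm_eq0/(congr1 trmx) : l2norm v^T = 0 by apply/eqP; rewrite eq_le vle l2norm_ge0.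
by rewrite trmxK trmx0; apply/eqP.
Qed.

Lemma hess_zstar x : hess_yy ga x (ys x) *m zs x = - grad_y fa x (ys x).
Proof. by rewrite /zstar mulmxN mulmxA mulmxV ?hess_yy_unit// mul1mx. Qed.

Lemma grad_y_fa_le x y : 0 <= C_f c -> l2norm (grad_y fa x y) <= C_f c.
Proof.
move=> C0; have [_ ->] := grad_faE x y; apply: l2norm_avg_le => // i.
apply: has_grad_lipschitz (has_grad2_r (has_grad2_f i x y)) _ C0 => y'.
by have [+ _] := ct i; apply.
Qed.

Lemma zstar_le x : 0 <= C_f c -> l2norm (zs x) <= C_f c / mu.
Proof.
move=> C0; rewrite ler_pdivlMr// mulrC (le_trans (hess_yy_lower x (ys x) _))//.
by rewrite hess_zstar l2normN grad_y_fa_le.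
Qed.

Lemma hess_xy_le i x y z : l2norm (hess_xy (g i) x y *m z) <= L * l2norm z.
Proof.
have H := has_jac2_lipschitz_l (has_jac2_g i x y) (L := L) _.
rewrite -[hess_xy _ _ _]trmxK; apply: l2norm_trmx_le (ltW L_gt0) _ z.
apply: H => x'; have := grad_g_lipschitz i x' y x y.
by rewrite (subrr y) l2norm_col_mx0.
Qed.

Lemma hess_yy_le i x y z : l2norm (hess_yy (g i) x y *m z) <= L * l2norm z.
Proof.
have H := has_jac2_lipschitz_l (has_jac2_swap (has_jac2_g i x y)) (L := L) _.
rewrite -[hess_yy _ _ _]trmxK; apply: l2norm_trmx_le (ltW L_gt0) _ z.
apply: H => y'; have := grad_g_lipschitz i x y' x y.
by rewrite (subrr x) l2norm_col_0mx.
Qed.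

(* Only the Lipschitz continuity of [ystar] is used, not its derivative:
   differentiating the optimality condition and testing it against [zstar]
   eliminates the increment of [ystar]. *)
Lemma has_grad_Phi x :
  has_grad (Phi p) x (grad_x fa x (ys x) + hess_xy ga x (ys x) *m zs x).
Proof.
move=> e e0.
have [_ /(_ x)] := lip => ysL.
have Ly0 : 0 < L_ystar c by case: lip => [[]].
set Ly := L_ystar c.
set y := ys x; set z := zs x.
pose Mz := l2norm z + 1.
have Mz0 : 0 < Mz by rewrite ltr_wpDl.
(* Two remainders of size E (|h| + |k|) will occur, with |k| <= Ly |h|, so that each costs at most
   e/2 |h|. The second is tested against z, hence the tolerance E / Mz. *)
pose E := e / (2 * (1 + Ly)).
have E0 : 0 < E by rewrite divr_gt0// mulr_gt0// addr_gt0.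
have [d1 d10 H1] := has_grad2_fa x y E0.
have [d2 d20 H2] := has_jac2_ga x y (divr_gt0 E0 Mz0).
pose d := Num.min d1 d2.
have d0 : 0 < d by rewrite lt_min d10.
exists (Num.min d (d / Ly)); first by rewrite lt_min d0 divr_gt0.
move=> h; rewrite lt_min => /andP[hd hLy].
pose k := ys (x + h) - y.
have kL : l2norm k <= Ly * l2norm h.
  have [_ + _] := ysL (x + h); rewrite /k l2normBC.
  by rewrite opprD addrA subrr sub0r l2normN.
have kd : l2norm k < d by rewrite (le_lt_trans kL)// mulrC -ltr_pdivlMr.
have yk : y + k = ys (x + h) by rewrite /k addrC subrK.
have [/andP[hd1 hd2] /andP[kd1 kd2]] : (l2norm h < d1) && (l2norm h < d2)
    /\ (l2norm k < d1) && (l2norm k < d2) by rewrite -!lt_min.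
have A1 := H1 h k hd1 kd1; have A2 := H2 h k hd2 kd2.
(* Optimality at x and at x + h removes both gradients, and the linear part J is itself as small as
   a remainder. *)
rewrite yk !grad_ystar subrr sub0r l2normN in A2.
set J := (hess_xy ga x y)^T *m h + (hess_yy ga x y)^T *m k in A2.
have A3 : `|dot z J| <= E * (l2norm h + l2norm k).
  rewrite (le_trans (norm_dot_le _ _))//.
  apply: (@le_trans _ _ (Mz * (E / Mz * (l2norm h + l2norm k)))).
    by rewrite ler_pM// lerDl.
  by rewrite mulrA mulrCA divff ?mulr1// gt_eqF.
(* As the Hessian sends zstar to - grad_y f, the k-part of J reproduces the k-part of [A1], which
   can then be traded for an h-part. *)
have zJ : dot z J = dot (hess_xy ga x y *m z) h - dot (grad_y fa x y) k.
  by rewrite /J dotDr -!dot_mulmx hess_zstar dotNl.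
rewrite /Phi -/y -yk.
have hk : l2norm h + l2norm k <= (1 + Ly) * l2norm h by rewrite mulrDl mul1r lerD2l.
have Ehk : E * (l2norm h + l2norm k) <= e / 2 * l2norm h.
  apply: (@le_trans _ _ (E * ((1 + Ly) * l2norm h))); first by rewrite ler_wpM2l// ltW.
  rewrite /E mulrA le_eqVlt; apply/orP; left; apply/eqP; congr (_ * _).
  by field; rewrite gt_eqF// addr_gt0.
move: A1 A3; rewrite zJ dotDl !ler_norml => /andP[a1 a2] /andP[a3 a4].
by apply/andP; split; lra.
Qed.

Lemma grad_PhiE x : grad (Phi p) x = grad_x fa x (ys x) + hess_xy ga x (ys x) *m zs x.
Proof. exact: has_grad_grad (has_grad_Phi x). Qed.

Lemma Phi_descent x h :
  Phi p (x + h) <= Phi p x + dot (grad (Phi p) x) h + L_Phi c / 2 * l2norm h ^+ 2.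
Proof.
apply: quadratic_upper_bound => [x'|x1 x2]; first by rewrite grad_PhiE; exact: has_grad_Phi.
by case: lip => _ /(_ x1 x2) [].
Qed.

Variables (bf bg : R) (a : parameters R).
Hypothesis het : bounded_heterogeneity p bf bg.
Hypothesis rhoC : C_f c / mu_g c <= rho a.

(** * Drift of the averaged iteration *)

Definition mean_Dx i x y z : 'cV[R]_dx := hess_xy (g i) x y *m z + grad_x (f i) x y.
Definition mean_Dy i x y : 'cV[R]_dy := grad_y (g i) x y.
Definition mean_Dz i x y z : 'cV[R]_dy := hess_yy (g i) x y *m z + grad_y (f i) x y.

Definition err_y x y : R := l2norm (y - ys x) ^+ 2.
Definition err_z x z : R := l2norm (z - zs x) ^+ 2.

Lemma C_f_ge0 : 0 <= C_f c.
Proof.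
have [+ _] := ct (Ordinal n_gt0).
move=> /(_ 0 (delta_mx (Ordinal dy_gt0) 0) 0); rewrite subr0 l2norm_delta mulr1.
exact: le_trans.
Qed.

Lemma zstar_rho x : l2norm (zs x) ^+ 2 <= rho a ^+ 2.
Proof.
apply: ler_sqr_l2norm; apply: le_trans rhoC.
exact: (zstar_le x C_f_ge0).
Qed.

Lemma grad_f_lipschitz_sqr i x y :
  l2norm (grad_x (f i) x y - grad_x (f i) x (ys x)) ^+ 2 <= L_f c ^+ 2 * err_y x y
  /\ l2norm (grad_y (f i) x y - grad_y (f i) x (ys x)) ^+ 2 <= L_f c ^+ 2 * err_y x y.
Proof.
have [H1 H2] := grad_f_lipschitz i x y (ys x).
by rewrite /err_y -!exprMn; split; exact: ler_sqr_l2norm.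
Qed.

Lemma hess_lipschitz_sqr i x y :
  specnorm (hess_xy (g i) x y - hess_xy (g i) x (ys x)) ^+ 2 <= L_gxy c ^+ 2 * err_y x y
  /\ specnorm (hess_yy (g i) x y - hess_yy (g i) x (ys x)) ^+ 2 <= L_gyy c ^+ 2 * err_y x y.
Proof.
have [_ [_ [_ [/(_ x y x (ys x)) H1 /(_ x y x (ys x)) H2]]]] := ct i.
move: H1 H2; rewrite (subrr x) l2norm_col_0mx /err_y -!exprMn => H1 H2.
have sqr_le (u v : R) : 0 <= u -> u <= v -> u ^+ 2 <= v ^+ 2.
  by move=> u0 uv; rewrite ler_pXn2r ?nnegrE// (le_trans u0).
by split; apply: sqr_le => //; exact: specnorm_ge0.
Qed.

(** In the split, the Hessian acts on z - zstar and its increment on zstar, which is bounded by rho;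
    this is why rho appears in [L2sq]. *)
Lemma mean_Dx_dev i x y z :
  l2norm (mean_Dx i x y z - mean_Dx i x (ys x) (zs x)) ^+ 2
  <= 3 * L ^+ 2 * err_z x z + 3 * L2sq c a * err_y x y.
Proof.
rewrite /mean_Dx affine_diff (le_trans (l2norm_sqrD3_le _ _ _))//.
have H1 := ler_sqr_l2norm (hess_xy_le i x y (z - zs x)).
rewrite exprMn in H1.
have [H2 _] := hess_lipschitz_sqr i x y.
have H3 := l2norm_mulmx_sqr_le H2 (zstar_rho x).
have [H4 _] := grad_f_lipschitz_sqr i x y.
rewrite /err_z /L2sq; lra.
Qed.

Lemma mean_Dx_het i x :
  l2norm (mean_Dx i x (ys x) (zs x) - grad (Phi p) x) ^+ 2
  <= 2 * (bf ^+ 2 + rho a ^+ 2 * bg ^+ 2).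
Proof.
rewrite grad_PhiE [grad_x fa _ _ + _]addrC.
rewrite /mean_Dx affine_diffl (le_trans (l2norm_sqrD2_le _ _))//.
have [H1 [_ [H2 _]]] := het x i.
have H3 := l2norm_mulmx_sqr_le H2 (zstar_rho x).
have H4 : l2norm (grad_x (f i) x (ys x) - grad_x fa x (ys x)) ^+ 2 <= bf ^+ 2.
  apply: le_trans H1; apply: ler_sqr_l2norm.
  by rewrite /grad_full opp_col_mx add_col_mx; exact: l2norm_col_mxu.
lra.
Qed.

Definition dev_x x y z : R := 3 * L ^+ 2 * err_z x z + 3 * L2sq c a * err_y x y.

Lemma dev_x_ge0 x y z : 0 <= dev_x x y z.
Proof.
apply: le_trans (mean_Dx_dev (Ordinal n_gt0) x y z); exact: sqr_ge0.
Qed.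

Lemma mean_Dx_bound i x y z :
  l2norm (mean_Dx i x y z) ^+ 2
  <= 3 * dev_x x y z + 6 * (bf ^+ 2 + rho a ^+ 2 * bg ^+ 2)
     + 3 * l2norm (grad (Phi p) x) ^+ 2.
Proof.
have H1 := mean_Dx_dev i x y z; have H2 := mean_Dx_het i x.
have := l2norm_sqrD3_le (mean_Dx i x y z - mean_Dx i x (ys x) (zs x))
  (mean_Dx i x (ys x) (zs x) - grad (Phi p) x) (grad (Phi p) x).
rewrite addrA subrK subrK /dev_x; lra.
Qed.

(** Heterogeneity cancels in the average at the solution, so it affects the variance of the messages
    but not the bias of their mean. *)
Lemma avg_mean_Dx x : avg (fun i => mean_Dx i x (ys x) (zs x)) = grad (Phi p) x.
Proof.
rewrite grad_PhiE.
have [-> _] := grad_faE x (ys x); have [-> _] := hess_gaE x (ys x).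
by rewrite avg_mulmx addrC avgD.
Qed.

Lemma avg_mean_Dx_dev x y z :
  l2norm (avg (fun i => mean_Dx i x y z) - grad (Phi p) x) ^+ 2 <= dev_x x y z.
Proof.
rewrite -avg_mean_Dx avgB; apply: l2norm_sqr_avg_le; first exact: dev_x_ge0.
by move=> i; exact: mean_Dx_dev.
Qed.

Lemma mean_Dy_bound i x y :
  l2norm (mean_Dy i x y) ^+ 2 <= 2 * L ^+ 2 * err_y x y + 2 * bg ^+ 2.
Proof.
rewrite -[mean_Dy i x y](subrK (grad_y (g i) x (ys x))) (le_trans (l2norm_sqrD2_le _ _))//.
have [_ [+ _]] := het x i.
rewrite (grad_ystar x) subr0 => H1.
have := ler_sqr_l2norm (grad_g_lipschitz i x y x (ys x)).
rewrite (subrr x) l2norm_col_0mx exprMn /err_y /mean_Dy => H2; lra.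
Qed.

(** The part of the z-direction caused by y differing from ystar. It is kept apart from the Hessian
    acting on z - zstar, which contracts after averaging. *)
Definition residual_z i x y : 'cV[R]_dy :=
  (hess_yy (g i) x y - hess_yy (g i) x (ys x)) *m zs x
  + (grad_y (f i) x y - grad_y (f i) x (ys x)).

Lemma residual_z_bound i x y :
  l2norm (residual_z i x y) ^+ 2 <= 2 * L1sq c a * err_y x y.
Proof.
rewrite (le_trans (l2norm_sqrD2_le _ _))//.
have [_ H2] := hess_lipschitz_sqr i x y.
have H3 := l2norm_mulmx_sqr_le H2 (zstar_rho x).
have [_ H4] := grad_f_lipschitz_sqr i x y.
rewrite /L1sq; lra.
Qed.

Lemma mean_DzE i x y z :
  mean_Dz i x y z
  = hess_yy (g i) x y *m (z - zs x) + residual_z i x y + mean_Dz i x (ys x) (zs x).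
Proof.
have E : mean_Dz i x y z - mean_Dz i x (ys x) (zs x)
    = hess_yy (g i) x y *m (z - zs x) + residual_z i x y.
  by rewrite /mean_Dz affine_diff; exact/esym/addrA.
by rewrite -E subrK.
Qed.

Lemma avg_mean_Dz x : avg (fun i => mean_Dz i x (ys x) (zs x)) = 0.
Proof.
have := hess_zstar x.
have [_ ->] := grad_faE x (ys x); have [_ ->] := hess_gaE x (ys x).
by rewrite avg_mulmx => /eqP; rewrite -addr_eq0 avgD => /eqP.
Qed.

Lemma mean_Dz_het i x :
  l2norm (mean_Dz i x (ys x) (zs x)) ^+ 2 <= 2 * (bf ^+ 2 + rho a ^+ 2 * bg ^+ 2).
Proof.
have E : hess_yy ga x (ys x) *m zs x + grad_y fa x (ys x) = 0.
  by rewrite (hess_zstar x) addNr.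
rewrite -[mean_Dz _ _ _ _]subr0 -E /mean_Dz affine_diffl.
rewrite (le_trans (l2norm_sqrD2_le _ _))//.
have [H1 [_ [_ H2]]] := het x i.
have H3 := l2norm_mulmx_sqr_le H2 (zstar_rho x).
have H4 : l2norm (grad_y (f i) x (ys x) - grad_y fa x (ys x)) ^+ 2 <= bf ^+ 2.
  apply: le_trans H1; apply: ler_sqr_l2norm.
  by rewrite /grad_full opp_col_mx add_col_mx; exact: l2norm_col_mxd.
lra.
Qed.

Lemma mean_Dz_bound i x y z :
  l2norm (mean_Dz i x y z) ^+ 2
  <= 3 * L ^+ 2 * err_z x z + 6 * L1sq c a * err_y x y
     + 6 * (bf ^+ 2 + rho a ^+ 2 * bg ^+ 2).
Proof.
rewrite mean_DzE (le_trans (l2norm_sqrD3_le _ _ _))//.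
have H1 := ler_sqr_l2norm (hess_yy_le i x y (z - zs x)).
rewrite exprMn -/(err_z x z) in H1.
have H2 := residual_z_bound i x y; have H3 := mean_Dz_het i x; lra.
Qed.

Lemma avg_mean_DzE x y z :
  avg (fun i => mean_Dz i x y z)
  = hess_yy ga x y *m (z - zs x) + avg (fun i => residual_z i x y).
Proof.
have [_ ->] := hess_gaE x y; rewrite avg_mulmx avgD -[RHS]addr0 -(avg_mean_Dz x) avgD.
by congr avg; apply/funext => i; exact: mean_DzE.
Qed.

Section Drift.
Variables (x h : 'cV[R]_dx) (y z : 'cV[R]_dy).
Local Notation x' := (x - alpha a *: h).
Local Notation H := (alpha a ^+ 2 * l2norm h ^+ 2).

Lemma step_sqr : l2norm (x - x') ^+ 2 = H.
Proof.
by rewrite opprB addrCA subrr addr0 l2normZ exprMn real_normK ?num_real.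
Qed.

Lemma drift_y : 0 < beta a -> beta a <= 2 / (mu + L) ->
  l2norm (y - beta a *: avg (fun i => mean_Dy i x y) - ys x') ^+ 2
  <= (1 - beta a * mu) * err_y x y + L_ystar c ^+ 2 * H / (beta a * mu).
Proof.
move=> b0 bL.
have bm : beta a * mu <= 1.
  apply: (@le_trans _ _ (2 / (mu + L) * mu)); first by rewrite ler_wpM2r ?(ltW mu_gt0).
  rewrite mulrAC ler_pdivrMr ?addr_gt0// mul1r.
  by have := mu_le_L; lra.
have H1 := ystep_contraction x y (ltW b0) bL.
rewrite grad_gaE in H1.
have := l2norm_sqrD_convex (ys x - ys x') (mulr_gt0 b0 mu_gt0) bm (l2norm_ge0 _) H1.
rewrite addrA subrK => /le_trans; apply; rewrite lerD2l ler_wpM2r//.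
  by rewrite invr_ge0 mulr_ge0// ltW.
rewrite -step_sqr -exprMn; apply: ler_sqr_l2norm.
by case: lip => _ /(_ x x') [].
Qed.

Lemma drift_z : 0 < gamma a -> gamma a <= L^-1 ->
  l2norm (z - gamma a *: avg (fun i => mean_Dz i x y z) - zs x') ^+ 2
  <= (1 - gamma a * mu) * err_z x z
     + (4 * gamma a ^+ 2 * L1sq c a * err_y x y + 2 * L_zstar c ^+ 2 * H)
       / (gamma a * mu).
Proof.
move=> c0 cL.
have muL := mu_le_L.
have cL1 : gamma a * L <= 1 by rewrite -ler_pdivlMr// mul1r.
have cm : gamma a * mu <= 1.
  by apply: le_trans cL1; rewrite ler_pM2l.
have cL2 : gamma a <= 2 / (mu + L).
  by rewrite ler_pdivlMr ?addr_gt0// mulrDr; lra.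
have H1 := hess_yy_contraction x y (z - zs x) (ltW c0) cL2.
set r := avg (fun i => residual_z i x y).
have := l2norm_sqrD_convex (- (gamma a *: r) + (zs x - zs x')) (mulr_gt0 c0 mu_gt0) cm (l2norm_ge0 _) H1.
have -> : z - zs x - gamma a *: (hess_yy ga x y *m (z - zs x))
    + (- (gamma a *: r) + (zs x - zs x'))
  = z - gamma a *: avg (fun i => mean_Dz i x y z) - zs x'.
  by rewrite avg_mean_DzE -/r gradient_step_split.
move=> /le_trans; apply; rewrite lerD2l ler_wpM2r//.
  by rewrite invr_ge0 mulr_ge0// ltW.
rewrite (le_trans (l2norm_sqrD2_le _ _))// l2normN l2normZ exprMn real_normK ?num_real//.
have H2 : l2norm r ^+ 2 <= 2 * L1sq c a * err_y x y.
  apply: l2norm_sqr_avg_le => [|i]; last exact: residual_z_bound.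
  apply: le_trans (residual_z_bound (Ordinal n_gt0) x y); exact: sqr_ge0.
have H3 : l2norm (zs x - zs x') ^+ 2 <= L_zstar c ^+ 2 * H.
  rewrite -step_sqr -exprMn; apply: ler_sqr_l2norm.
  by case: lip => _ /(_ x x') [].
have H4 : gamma a ^+ 2 * l2norm r ^+ 2 <= gamma a ^+ 2 * (2 * L1sq c a * err_y x y).
  by rewrite ler_wpM2l ?sqr_ge0.
have -> : 4 * gamma a ^+ 2 * L1sq c a * err_y x y + 2 * L_zstar c ^+ 2 * H
  = 2 * (gamma a ^+ 2 * (2 * L1sq c a * err_y x y)) + 2 * (L_zstar c ^+ 2 * H) by ring.
by apply: lerD; rewrite ler_pM2l.
Qed.

Lemma drift_h : 0 < theta a -> theta a <= 1 ->
  l2norm ((1 - theta a) *: h + theta a *: avg (fun i => mean_Dx i x y z)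
          - grad (Phi p) x') ^+ 2
  <= (1 - theta a) * l2norm (h - grad (Phi p) x) ^+ 2
     + 2 * theta a * dev_x x y z + 2 * L_Phi c ^+ 2 * H / theta a.
Proof.
move=> t0 t1.
set G := grad (Phi p) x; set G' := grad (Phi p) x'.
set D := avg (fun i => mean_Dx i x y z).
have H1 : l2norm ((1 - theta a) *: (h - G)) <= (1 - theta a) * l2norm (h - G).
  by rewrite l2normZ ger0_norm ?subr_ge0.
have := l2norm_sqrD_convex (theta a *: (D - G) + (G - G')) t0 t1 (l2norm_ge0 _) H1.
have -> : (1 - theta a) *: (h - G) + (theta a *: (D - G) + (G - G'))
  = (1 - theta a) *: h + theta a *: D - G'.
  exact: momentum_step_split.
move=> /le_trans; apply; rewrite -addrA lerD2l ler_pdivrMr//.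
rewrite (le_trans (l2norm_sqrD2_le _ _))// l2normZ exprMn real_normK ?num_real//.
have H2 : l2norm (D - G) ^+ 2 <= dev_x x y z by exact: avg_mean_Dx_dev.
have H3 : l2norm (G - G') ^+ 2 <= L_Phi c ^+ 2 * H.
  rewrite -step_sqr -exprMn; apply: ler_sqr_l2norm.
  by case: lip => _ /(_ x x') [].
have H4 : theta a ^+ 2 * l2norm (D - G) ^+ 2 <= theta a ^+ 2 * dev_x x y z.
  by rewrite ler_wpM2l ?sqr_ge0.
have -> : (2 * theta a * dev_x x y z + 2 * L_Phi c ^+ 2 * H / theta a) * theta a
  = 2 * (theta a ^+ 2 * dev_x x y z) + 2 * (L_Phi c ^+ 2 * H) by field; rewrite gt_eqF.
by apply: lerD; rewrite ler_pM2l.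
Qed.

(* The inner product <grad, h> of the descent lemma is polarized. *)
Lemma drift_Phi : 0 < alpha a -> alpha a <= (2 * L_Phi c)^-1 ->
  Phi p x' <= Phi p x - alpha a / 2 * l2norm (grad (Phi p) x) ^+ 2
    - alpha a / 4 * l2norm h ^+ 2
    + alpha a / 2 * l2norm (h - grad (Phi p) x) ^+ 2.
Proof.
move=> a0 aL.
have LP0 : 0 < L_Phi c by case: lip => [[]].
have aL1 : alpha a * L_Phi c <= 1 / 2.
  have : alpha a * (2 * L_Phi c) <= 1 by rewrite -ler_pdivlMr ?mul1r// mulr_gt0.
  lra.
have := Phi_descent x (- (alpha a *: h)).
move=> /le_trans; apply.
rewrite l2normN l2normZ exprMn real_normK ?num_real// dotNr dotZr l2norm_sqrB (dotC h).
have : alpha a * L_Phi c * (alpha a * l2norm h ^+ 2) <= 1 / 2 * (alpha a * l2norm h ^+ 2).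
  by rewrite ler_wpM2r// mulr_ge0 ?sqr_ge0// ltW.
by move: (dot _ h) (l2norm h ^+ 2) (l2norm (grad _ _) ^+ 2) => u v w; lra.
Qed.

End Drift.

End Problem.

(** * Sigma-algebras generated by the sources of randomness *)

Section GeneratedSubalgebras.
Context {R : realType} {d : measure_display} {W : measurableType d}.
Variable P : probability W R.
Context {I : eqType} (E : I -> set (set W)).

Definition cylinder (A : set I) : set (set W) :=
  [set S | exists2 J : seq I, uniq J & exists B : I -> set W,
     (forall i, i \in J -> A i /\ E i (B i)) /\ S = \big[setI/setT]_(i <- J) B i].

(** The space W with only the events generated by the sources in A: measurability of a map on it
    expresses that the map depends on these sources alone. *)
Definition sub_salg (A : set I) := g_sigma_algebraType (cylinder A).

Hypothesis ET : forall i, E i setT.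
Hypothesis EI : forall i, setI_closed (E i).
Hypothesis mE : forall i, E i `<=` measurable.
Hypothesis ind : mutually_independent P E.

Lemma cylinder_measurable A : cylinder A `<=` measurable.
Proof.
move=> _ [J _ [B [JB ->]]]; rewrite big_seq.
by apply: bigsetI_measurable => i /JB [_ /mE].
Qed.

Lemma bigsetIP (J : seq I) (B : I -> set W) w :
  (\big[setI/setT]_(i <- J) B i) w <-> forall i, i \in J -> B i w.
Proof.
elim: J => [|j J IH]; first by rewrite big_nil.
rewrite big_cons; split=> [[Bj /IH H] i|H]; first by rewrite inE => /predU1P[->//|/H].
by split; [apply: H; rewrite mem_head|apply/IH => i iJ; apply: H; rewrite inE iJ orbT].
Qed.

Lemma bigsetI_incl (J K : seq I) (B : I -> set W) : uniq J -> uniq K -> {subset J <= K} ->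
  \big[setI/setT]_(i <- J) B i
  = \big[setI/setT]_(i <- K) (if i \in J then B i else setT).
Proof.
move=> uJ uK JK; apply/seteqP; split => w /bigsetIP H; apply/bigsetIP => i.
  by move=> _; case: ifPn => // iJ; exact: H.
by move=> iJ; have := H i (JK _ iJ); rewrite iJ.
Qed.

Lemma cylinderI A : setI_closed (cylinder A).
Proof.
move=> _ _ [J uJ [B [JB ->]]] [K uK [C [KC ->]]].
exists (undup (J ++ K)); first exact: undup_uniq.
(* A source missing from one list contributes [setT], which is an event of every source. *)
exists (fun i => (if i \in J then B i else setT) `&` (if i \in K then C i else setT)).
split.
  move=> i; rewrite mem_undup mem_cat => iJK; split.
    by move: iJK => /orP[/JB []|/KC []].
  by apply: EI; case: ifPn => [iJ|_]; rewrite ?(JB _ iJ).2//;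
    first [exact: (JB _ iJ).2 | exact: (KC _ iJ).2 | exact: ET].
rewrite big_split/=; congr (_ `&` _); apply: bigsetI_incl; rewrite ?undup_uniq//.
  by move=> i iJ; rewrite mem_undup mem_cat iJ.
by move=> i iK; rewrite mem_undup mem_cat iK orbT.
Qed.

Lemma cylinder_independent A A' : A `&` A' = set0 ->
  independent_systems P (cylinder A) (cylinder A').
Proof.
move=> AA' _ _ [J uJ [B [JB ->]]] [K uK [C [KC ->]]].
have JK i : i \in K -> i \notin J.
  move=> /KC [A'i _]; apply/negP => /JB [Ai _].
  by have : (A `&` A') i by []; rewrite AA'.
(* The two lists of sources being disjoint, one family covers both, and mutual independence is
   applied to the concatenation and to each list. *)
pose D i := if i \in J then B i else C i.
have BD : \big[setI/setT]_(i <- J) B i = \big[setI/setT]_(i <- J) D i.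
  by apply: eq_big_seq => i iJ; rewrite /D iJ.
have CD : \big[setI/setT]_(i <- K) C i = \big[setI/setT]_(i <- K) D i.
  by apply: eq_big_seq => i iK; rewrite /D (negbTE (JK i iK)).
have ED i : i \in J ++ K -> E i (D i).
  by rewrite mem_cat /D; case: ifPn => [/JB []|] //= _ /KC [].
rewrite BD CD -big_cat/= ind//; last first.
  rewrite cat_uniq uJ uK/= andbT; apply/hasPn => i iK; exact: JK.
rewrite big_cat/= !ind//.
- by move=> i iK; apply: ED; rewrite mem_cat iK orbT.
- by move=> i iJ; apply: ED; rewrite mem_cat iJ.
Qed.

Lemma sub_salg_independent A A' : A `&` A' = set0 ->
  independent_systems P <<s cylinder A >> <<s cylinder A' >>.
Proof.
move=> AA'; apply: independent_systems_sigma.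
- exact: cylinder_measurable.
- exact: cylinderI.
- exact: cylinder_measurable.
- exact: cylinderI.
- exact: cylinder_independent.
Qed.

Lemma sub_salg_measurable A : <<s cylinder A >> `<=` measurable.
Proof.
by apply: smallest_sub; [exact: sigma_algebra_measurable|exact: cylinder_measurable].
Qed.

Lemma measurable_sub_salg A : measurable_fun setT (id : W -> sub_salg A).
Proof. by move=> _ B mB; rewrite setTI; exact: sub_salg_measurable mB. Qed.

Lemma measurable_from_sub_salg d' (T : measurableType d') A (X : W -> T) :
  measurable_fun setT (X : sub_salg A -> T) -> measurable_fun setT X.
Proof.
move=> mX _ B mB; rewrite setTI; apply: (@sub_salg_measurable A).
by have := mX measurableT B mB; rewrite setTI.
Qed.

Lemma sub_salgS A A' : A `<=` A' -> measurable_fun setT (id : sub_salg A' -> sub_salg A).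
Proof.
move=> AA' _ B mB; rewrite setTI; move: B mB.
apply: smallest_sub; first exact: smallest_sigma_algebra.
move=> S [J uJ [B [JB SE]]]; apply: sub_gen_smallest.
by exists J => //; exists B; split=> // i /JB [/AA'].
Qed.

Lemma measurable_sub_salgS d' (T : measurableType d') A A' (X : W -> T) :
  A `<=` A' -> measurable_fun setT (X : sub_salg A -> T) ->
  measurable_fun setT (X : sub_salg A' -> T).
Proof. by move=> AA' mX; exact: measurableT_comp mX (sub_salgS AA'). Qed.

Lemma measurable_source d' (T : measurableType d') (A : set I) i (X : W -> T) :
  A i -> E i = preimage_set_system setT X measurable ->
  measurable_fun setT (X : sub_salg A -> T).
Proof.
move=> Ai EX _ B mB; rewrite setTI; apply: sub_gen_smallest.
exists [:: i] => //; exists (fun=> X @^-1` B); split; last by rewrite big_seq1.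
by move=> j; rewrite inE => /eqP ->; split=> //; rewrite EX; exists B => //; rewrite setTI.
Qed.

Lemma sub_salg_independent_elements d1 d2 (T1 : measurableType d1)
    (T2 : measurableType d2) A A' (X : W -> T1) (Y : W -> T2) :
  A `&` A' = set0 -> measurable_fun setT (X : sub_salg A -> T1) ->
  measurable_fun setT (Y : sub_salg A' -> T2) -> independent_elements P X Y.
Proof.
move=> AA' mX mY B C mB mC; apply: (sub_salg_independent AA').
  by have := mX measurableT B mB; rewrite setTI.
by have := mY measurableT C mC; rewrite setTI.
Qed.

(** The identity of W, read as a random element of each of the two sub-sigma-algebras, yields two
    independent elements. A function on the diagonal is thus integrated as if the sources in A and
    in A' were drawn separately. *)
Lemma ge0_integral_decouple A A' (F : W * W -> \bar R) :
  A `&` A' = set0 -> measurable_fun setT (F : sub_salg A * sub_salg A' -> \bar R) ->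
  (forall q, 0 <= F q)%E ->
  (\int[P]_w F (w, w) = \int[P]_w \int[P]_w' F (w, w'))%E
  /\ measurable_fun setT (fun w => \int[P]_w' F (w, w'))%E.
Proof.
move=> AA' mF F0.
pose X : W -> sub_salg A := id; pose Y : W -> sub_salg A' := id.
have XY : independent_elements P X Y.
  by move=> B C mB mC; apply: (sub_salg_independent AA').
exact: (ge0_integral_independent (@measurable_sub_salg A) (@measurable_sub_salg A') XY mF F0).
Qed.

End GeneratedSubalgebras.

(** * Measurability of the iteration *)

Section Clip.
Context {R : realType} {m : nat}.

Lemma clipE rad (v : 'cV[R]_m) : 0 < rad ->
  clip rad v = if l2norm v <= rad then v else (rad / l2norm v) *: v.
Proof.
move=> r0; rewrite /clip; case: ifPn => [vr|]; last first.
  rewrite -ltNge => rv; congr (_ *: _); apply/min_idPr.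
  by rewrite ler_pdivrMr ?mul1r ?ltW// (lt_trans r0).
have [v0|v0] := eqVneq (l2norm v) 0; first by rewrite (l2norm_eq0 v0) scaler0.
have vp : 0 < l2norm v by rewrite lt_def v0/=.
by rewrite (min_idPl _) ?scale1r// ler_pdivlMr ?mul1r.
Qed.

Lemma clip_le rad (v : 'cV[R]_m) : 0 < rad -> l2norm (clip rad v) <= rad.
Proof.
move=> r0; rewrite clipE//; case: ifPn => //; rewrite -ltNge => rv.
have vp : 0 < l2norm v by exact: lt_trans rv.
have s0 : 0 <= rad / l2norm v by rewrite divr_ge0// ltW.
by rewrite l2normZ (ger0_norm s0) divfK// gt_eqF.
Qed.

(** With s = rad / |v| <= 1, |v - w|^2 - |s v - w|^2 = (1 - s)^2 |v|^2 + 2 (1 - s) (s |v|^2 - <v,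
    w>), and <v, w> <= |v| rad = s |v|^2. *)
Lemma clip_nonexpansive rad (v w : 'cV[R]_m) : 0 < rad -> l2norm w <= rad ->
  l2norm (clip rad v - w) ^+ 2 <= l2norm (v - w) ^+ 2.
Proof.
move=> r0 wr; rewrite clipE//; case: ifPn => //; rewrite -ltNge => rv.
have vp : 0 < l2norm v by exact: lt_trans rv.
set s := rad / l2norm v.
have s0 : 0 < s by rewrite divr_gt0.
have s1 : s <= 1 by rewrite ler_pdivrMr ?mul1r// ltW.
have radE : rad = s * l2norm v by rewrite /s divfK// gt_eqF.
rewrite !l2norm_sqrB l2normZ (gtr0_norm s0) dotZl exprMn.
have H : dot v w <= s * l2norm v ^+ 2.
  by rewrite (le_trans (dot_le _ _))// expr2 mulrA mulrC ler_wpM2r// -radE.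
have : 0 <= (1 - s) * (s * l2norm v ^+ 2 - dot v w) by rewrite mulr_ge0 ?subr_ge0.
have : 0 <= (1 - s) ^+ 2 * l2norm v ^+ 2 by rewrite -exprMn sqr_ge0.
by move: (dot v w) (l2norm v ^+ 2) (l2norm w ^+ 2) => q r t; lra.
Qed.

Lemma measurable_clip d (V : measurableType d) rad (v : V -> 'cV[R]_m) :
  measurable_fun setT (v : V -> borel 'cV[R]_m) ->
  measurable_fun setT ((fun w => clip rad (v w)) : V -> borel 'cV[R]_m).
Proof.
move=> mv; apply: measurable_scalemx => //.
apply: measurable_minr; first exact: measurable_cst.
(* The power -1 is a measurable function and agrees with the inverse on nonnegative reals, including
   at 0. *)
have -> : (fun w => rad / l2norm (v w)) = (fun w => rad * (l2norm (v w) `^ (-1))).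
  by apply/funext => w; rewrite powR_inv1.
apply: measurable_funM => //.
exact: (measurableT_comp (measurable_powR (-1)) (measurable_l2norm mv)).
Qed.

End Clip.

Section Oracles.
Context {R : realType} {n dx dy : nat} {d_f d_g d_u d_l : measure_display}.
Context {Sf : measurableType d_f} {Sg : measurableType d_g}.
Context {Su : measurableType d_u} {Sl : measurableType d_l}.
Variables (p : problem R n dx dy Sf Sg) (C : compressors R n dx dy Su Sl).
Hypothesis wp : well_posed p.

Section Measurability.
Context {d : measure_display} {V : measurableType d}.
Variables (x : V -> 'cV[R]_dx) (y z : V -> 'cV[R]_dy) (s : V -> Sf) (s' : V -> Sg).
Hypothesis mx : measurable_fun setT (x : V -> borel 'cV[R]_dx).
Hypothesis my : measurable_fun setT (y : V -> borel 'cV[R]_dy).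
Hypothesis mz : measurable_fun setT (z : V -> borel 'cV[R]_dy).
Hypothesis ms : measurable_fun setT s.
Hypothesis ms' : measurable_fun setT s'.

Let mxy : measurable_fun setT (fun v => (x v, y v) : borel 'cV[R]_dx * borel 'cV[R]_dy).
Proof. exact: measurable_fun_pair. Qed.

Lemma measurable_oracle_f : measurable_fun setT
  ((fun v => grad_full (F_at p (s v)) (x v) (y v)) : V -> borel 'cV[R]_(dx + dy)).
Proof.
have [_ [_ [_ [_ [m _]]]]] := wp.
exact: (measurableT_comp m (measurable_fun_pair mxy ms)).
Qed.

Lemma measurable_oracle_grad_y : measurable_fun setT
  ((fun v => grad_y (G_at p (s' v)) (x v) (y v)) : V -> borel 'cV[R]_dy).
Proof.
have [_ [_ [_ [_ [_ [m _]]]]]] := wp.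
exact: (measurableT_comp m (measurable_fun_pair mxy ms')).
Qed.

Lemma measurable_oracle_hess_xy : measurable_fun setT
  ((fun v => hess_xy (G_at p (s' v)) (x v) (y v)) : V -> borel 'M[R]_(dx, dy)).
Proof.
have [_ [_ [_ [_ [_ [_ [m _]]]]]]] := wp.
exact: (measurableT_comp m (measurable_fun_pair mxy ms')).
Qed.

Lemma measurable_oracle_hess_yy : measurable_fun setT
  ((fun v => hess_yy (G_at p (s' v)) (x v) (y v)) : V -> borel 'M[R]_dy).
Proof.
have [_ [_ [_ [_ [_ [_ [_ m]]]]]]] := wp.
exact: (measurableT_comp m (measurable_fun_pair mxy ms')).
Qed.

Lemma measurable_oracle_x : measurable_fun setT
  ((fun v => hess_xy (G_at p (s' v)) (x v) (y v) *m z v + grad_x (F_at p (s v)) (x v) (y v))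
   : V -> borel 'cV[R]_dx).
Proof.
apply: measurable_mxD; first exact: measurable_mulmx measurable_oracle_hess_xy mz.
have := measurable_usubmx measurable_oracle_f.
by under eq_fun do rewrite /grad_full col_mxKu.
Qed.

Lemma measurable_oracle_z : measurable_fun setT
  ((fun v => hess_yy (G_at p (s' v)) (x v) (y v) *m z v + grad_y (F_at p (s v)) (x v) (y v))
   : V -> borel 'cV[R]_dy).
Proof.
apply: measurable_mxD; first exact: measurable_mulmx measurable_oracle_hess_yy mz.
have := measurable_dsubmx measurable_oracle_f.
by under eq_fun do rewrite /grad_full col_mxKd.
Qed.

End Measurability.

Lemma measurable_compressed d (V : measurableType d) d' (S : measurableType d')
    (Q : probability S R) m omega (K : 'cV[R]_m -> S -> 'cV[R]_m)
    (v : V -> 'cV[R]_m) (s : V -> S) :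
  unbiased_compressor Q omega K ->
  measurable_fun setT (v : V -> borel 'cV[R]_m) -> measurable_fun setT s ->
  measurable_fun setT ((fun t => K (v t) (s t)) : V -> borel 'cV[R]_m).
Proof.
move=> [mK _] mv ms.
exact: (measurableT_comp mK (measurable_fun_pair (mv : measurable_fun setT (v : V -> borel _)) ms)).
Qed.

Section Step.
Variables (ou ol : R) (a : parameters R).
Hypothesis uc : unbiased_compression C ou ol.
Context {d : measure_display} {V : measurableType d}.
Variables (r : randomness n Sf Sg Su Sl V) (k : nat).
Hypothesis mr : forall i,
  [/\ measurable_fun setT (phi r k i), measurable_fun setT (xi r k i),
      measurable_fun setT (seed_x r k i), measurable_fun setT (seed_y r k i)
    & measurable_fun setT (seed_z r k i)].
Variable s : V -> iterate R dx dy.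

Definition measurable_iterate (s : V -> iterate R dx dy) : Prop :=
  [/\ measurable_fun setT ((fun v => it_x (s v)) : V -> borel 'cV[R]_dx),
      measurable_fun setT ((fun v => it_y (s v)) : V -> borel 'cV[R]_dy),
      measurable_fun setT ((fun v => it_z (s v)) : V -> borel 'cV[R]_dy)
    & measurable_fun setT ((fun v => it_h (s v)) : V -> borel 'cV[R]_dx)].

Lemma measurable_step : measurable_iterate s ->
  measurable_iterate (fun v => cm_soba_step p C a r v k (s v)).
Proof.
move=> [mx my mz mh].
have E v : cm_soba_step p C a r v k (s v)
    = cm_soba_step p C a r v k (Iterate (it_x (s v)) (it_y (s v)) (it_z (s v)) (it_h (s v))).
  by case: (s v).
have [_ _ cu] := uc.
split; under eq_fun do rewrite E /=.
- by apply: measurable_mxB => //; exact: measurable_mxZ.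
- apply: measurable_mxB => //; apply/measurable_mxZ/measurable_mx_sum => i.
  have [_ mxi _ msy _] := mr i; have [_ cl] := cu i.
  by apply: (measurable_compressed cl) => //; exact: measurable_oracle_grad_y.
- apply/measurable_clip; apply: measurable_mxB => //; apply/measurable_mxZ/measurable_mx_sum => i.
  have [mphi mxi _ _ msz] := mr i; have [_ cl] := cu i.
  by apply: (measurable_compressed cl) => //; exact: measurable_oracle_z.
- apply: measurable_mxD; first exact: measurable_mxZ.
  apply/measurable_mxZ/measurable_mx_sum => i.
  have [mphi mxi msx _ _] := mr i; have [cu' _] := cu i.
  by apply: (measurable_compressed cu') => //; exact: measurable_oracle_x.
Qed.

End Step.
End Oracles.

(** * Mean and variance of the compressed messages *)

Section Fresh.
Context {R : realType} {n dx dy : nat} {d_f d_g d_u d_l : measure_display}.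
Context {Sf : measurableType d_f} {Sg : measurableType d_g}.
Context {Su : measurableType d_u} {Sl : measurableType d_l}.
Context {d : measure_display} {W : measurableType d}.
Variables (P : probability W R) (p : problem R n dx dy Sf Sg).
Variables (C : compressors R n dx dy Su Sl) (r : randomness n Sf Sg Su Sl W).
Variables (sg ou ol : R) (a : parameters R).
Hypothesis n_gt0 : (0 < n)%N.
Hypothesis wp : well_posed p.
Hypothesis sn : stochastic_noise p sg.
Hypothesis uc : unbiased_compression C ou ol.
Hypothesis fr : fresh_randomness P p C r.

Local Notation E := (source_events r).

Lemma source_eventsT i : E i setT.
Proof. by case: i => [[k i] []] /=; exists setT; rewrite ?preimage_setT ?setTI. Qed.

Lemma source_eventsI i : setI_closed (E i).
Proof.
case: i => [[k i] []] /= _ _ [A mA <-] [B mB <-];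
  exists (A `&` B); rewrite ?preimage_setI ?setTI//; exact: measurableI.
Qed.

Lemma source_events_measurable i : E i `<=` measurable.
Proof.
have [laws _] := fr; case: i => [[k i] c] A.
have [[m1 _] [m2 _] [m3 _] [m4 _] [m5 _]] := laws k i.
by case: c => /= -[B mB <-]; [exact: m1|exact: m2|exact: m3|exact: m4|exact: m5].
Qed.

Local Notation salg A := (sub_salg E A).

Let ind : mutually_independent P E. Proof. by case: fr. Qed.

Lemma independent_sources d1 d2 (T1 : measurableType d1)
    (T2 : measurableType d2) A A' (X : W -> T1) (Y : W -> T2) :
  A `&` A' = set0 -> measurable_fun setT (X : salg A -> T1) ->
  measurable_fun setT (Y : salg A' -> T2) -> independent_elements P X Y.
Proof.
exact: (sub_salg_independent_elements source_eventsT source_eventsI source_events_measurable ind).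
Qed.

Lemma measurable_sources (A : set (nat * 'I_n * source)) k i :
  [/\ A (k, i, SrcF) -> measurable_fun setT (phi r k i : salg A -> Sf),
      A (k, i, SrcG) -> measurable_fun setT (xi r k i : salg A -> Sg),
      A (k, i, SrcX) -> measurable_fun setT (seed_x r k i : salg A -> Su),
      A (k, i, SrcY) -> measurable_fun setT (seed_y r k i : salg A -> Sl)
    & A (k, i, SrcZ) -> measurable_fun setT (seed_z r k i : salg A -> Sl)].
Proof. by split=> Ai; apply: measurable_source Ai _. Qed.

Section FixedState.
Variables (k : nat) (x : 'cV[R]_dx) (y z : 'cV[R]_dy).
Hypothesis z_rho : l2norm z <= rho a.

Local Notation sigma1 := (sg ^+ 2 * (1 + rho a ^+ 2)).

Definition oracle_x i w := hess_xy (G_at p (xi r k i w)) x y *m z + grad_x (F_at p (phi r k i w)) x y.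
Definition oracle_y i w := grad_y (G_at p (xi r k i w)) x y.
Definition oracle_z i w := hess_yy (G_at p (xi r k i w)) x y *m z + grad_y (F_at p (phi r k i w)) x y.

Definition at_sources (i : 'I_n) (cs : seq source) : set (nat * 'I_n * source) :=
  [set q | q.1 = (k, i) /\ q.2 \in cs].

Lemma at_sources_disjoint_worker i j cs cs' : i != j ->
  at_sources i cs `&` at_sources j cs' = set0.
Proof.
move=> ij; apply/seteqP; split=> // q [] [qi _] [].
by rewrite qi => -[ij']; rewrite ij' eqxx in ij.
Qed.

Lemma at_sources_disjoint i cs cs' : ~~ has [in cs'] cs ->
  at_sources i cs `&` at_sources i cs' = set0.
Proof.
move=> /hasPn H; apply/seteqP; split=> // q [] [_ qc] [_ qc'].
by have := H _ qc; rewrite qc'.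
Qed.

Lemma measurable_oracles i (A : set (nat * 'I_n * source)) :
  A (k, i, SrcG) ->
  [/\ A (k, i, SrcF) -> measurable_fun setT (oracle_x i : salg A -> borel 'cV[R]_dx),
      measurable_fun setT (oracle_y i : salg A -> borel 'cV[R]_dy)
    & A (k, i, SrcF) -> measurable_fun setT (oracle_z i : salg A -> borel 'cV[R]_dy)].
Proof.
move=> AG; have [mF mG _ _ _] := measurable_sources A k i.
split=> [AF||AF].
- by apply: measurable_oracle_x => //; [exact: mF|exact: mG].
- by apply: measurable_oracle_grad_y => //; exact: mG.
- by apply: measurable_oracle_z => //; [exact: mF|exact: mG].
Qed.

(** The two data samples of a worker are independent, so the variances sigma^2 |z|^2 and sigma^2 add
    up without a factor 2, and |z| <= rho gives sigma_1^2. *)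
Lemma oracle_estimators i :
  [/\ estimator P (oracle_x i) (mean_Dx p i x y z) sigma1,
      estimator P (oracle_y i) (mean_Dy p i x y) (sg ^+ 2)
    & estimator P (oracle_z i) (mean_Dz p i x y z) sigma1].
Proof.
have [/(_ k i) [lF lG _ _ _] _] := fr.
have [[uF eF] [[uG eG] [[uxy exy] [uyy eyy]]]] := sn i x y.
have [mF mG _ _ _] := measurable_sources setT k i.
have mid d' (S : measurableType d') : measurable_fun setT (id : S -> S) by exact: measurable_id.
have EF : estimator P (fun w => grad_full (F_at p (phi r k i w)) x y)
    (grad_full (f_ p i) x y) (sg ^+ 2).
  apply: (estimator_has_law lF (V := fun s => grad_full (F_at p s) x y)).
  apply: estimator_of_mse => //; exact: (measurable_oracle_f wp _ _ (mid _ _)).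
have EG : estimator P (oracle_y i) (mean_Dy p i x y) (sg ^+ 2).
  apply: (estimator_has_law lG (V := fun s => grad_y (G_at p s) x y)).
  apply: estimator_of_mse => //; exact: (measurable_oracle_grad_y wp _ _ (mid _ _)).
have s1 : sg ^+ 2 * l2norm z ^+ 2 + sg ^+ 2 <= sigma1.
  rewrite mulrDr mulr1 addrC lerD2l ler_wpM2l ?sqr_ge0//.
  by rewrite ler_pXn2r ?nnegrE// (le_trans _ z_rho).
have incl (s : source) : at_sources i [:: s] (k, i, s) by split=> //; rewrite inE eqxx.
have [_ mG' _ _ _] := measurable_sources (at_sources i [:: SrcG]) k i.
have [mF' _ _ _ _] := measurable_sources (at_sources i [:: SrcF]) k i.
have disj : at_sources i [:: SrcG] `&` at_sources i [:: SrcF] = set0.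
  by apply: at_sources_disjoint; rewrite /= !inE orbF; apply/eqP.
have combine m (M : Sg -> 'M[R]_(m, dy)) A (q : Sf -> 'cV[R]_m) b :
    measurable_fun setT (M : Sg -> borel _) -> unbiased (D_g p i) M A ->
    mse_le (D_g p i) (@specnorm R _ _) M A (sg ^+ 2) ->
    estimator P (q \o phi r k i) b (sg ^+ 2) ->
    measurable_fun setT (q \o phi r k i : salg (at_sources i [:: SrcF]) -> borel _) ->
    estimator P (fun w => M (xi r k i w) *m z + q (phi r k i w)) (A *m z + b) sigma1.
  move=> mM uM eM Eq mq.
  have EM : estimator P (fun w => M (xi r k i w) *m z) (A *m z) (sg ^+ 2 * l2norm z ^+ 2).
    by apply: (estimator_has_law lG (V := fun s => M s *m z)); exact: estimator_mulmx.
  have [|? ? ? Ve] := estimatorD EM Eq; last by split=> //; exact: le_trans s1.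
  apply: (independent_sources disj) => //; apply: measurable_mulmx => //.
  exact: measurableT_comp mM (mG' (incl _)).
have mFf : measurable_fun setT
    ((fun w => grad_full (F_at p (phi r k i w)) x y) : salg (at_sources i [:: SrcF]) -> borel _).
  by apply: measurable_oracle_f => //; exact: mF'.
split; [|exact: EG|].
- apply: (combine _ _ _ (fun s => grad_x (F_at p s) x y) (grad_x (f_ p i) x y) _ uxy exy).
    exact: (measurable_oracle_hess_xy wp _ _ (mid _ _)).
    by have := (estimator_col_mx EF).1; under eq_fun do rewrite /grad_full col_mxKu.
  by have := measurable_usubmx mFf; under eq_fun do rewrite /grad_full col_mxKu.
- apply: (combine _ _ _ (fun s => grad_y (F_at p s) x y) (grad_y (f_ p i) x y) _ uyy eyy).
    exact: (measurable_oracle_hess_yy wp _ _ (mid _ _)).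
    by have := (estimator_col_mx EF).2; under eq_fun do rewrite /grad_full col_mxKd.
  by have := measurable_dsubmx mFf; under eq_fun do rewrite /grad_full col_mxKd.
Qed.

Definition message_x i w := C_u C i (oracle_x i w) (seed_x r k i w).
Definition message_y i w := C_l C i (oracle_y i w) (seed_y r k i w).
Definition message_z i w := C_l C i (oracle_z i w) (seed_z r k i w).

(** The three messages of a worker share data samples; independence is claimed only between workers,
    so one set of sources serves all three. *)
Definition message_sources i := at_sources i [:: SrcF; SrcG; SrcX; SrcY; SrcZ].

Lemma measurable_messages i :
  [/\ measurable_fun setT (message_x i : salg (message_sources i) -> borel 'cV[R]_dx),
      measurable_fun setT (message_y i : salg (message_sources i) -> borel 'cV[R]_dy)
    & measurable_fun setT (message_z i : salg (message_sources i) -> borel 'cV[R]_dy)].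
Proof.
have [_ _ /(_ i) [cu cl]] := uc.
have [mF mG mX mY mZ] := measurable_sources (message_sources i) k i.
have inF c : c \in [:: SrcF; SrcG; SrcX; SrcY; SrcZ] -> message_sources i (k, i, c) by [].
have AG : message_sources i (k, i, SrcG) by apply: inF; rewrite !inE eqxx ?orbT.
have [ox oy oz] := measurable_oracles AG.
split.
- apply: (measurable_compressed cu); first by apply: ox; apply: inF; rewrite !inE eqxx.
  by apply: mX; apply: inF; rewrite !inE eqxx ?orbT.
- apply: (measurable_compressed cl) => //.
  by apply: mY; apply: inF; rewrite !inE eqxx ?orbT.
- apply: (measurable_compressed cl); first by apply: oz; apply: inF; rewrite !inE eqxx.
  by apply: mZ; apply: inF; rewrite !inE eqxx ?orbT.
Qed.

Lemma message_estimators i :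
  [/\ estimator P (message_x i) (mean_Dx p i x y z)
        ((1 + ou) * sigma1 + ou * l2norm (mean_Dx p i x y z) ^+ 2),
      estimator P (message_y i) (mean_Dy p i x y)
        ((1 + ol) * sg ^+ 2 + ol * l2norm (mean_Dy p i x y) ^+ 2)
    & estimator P (message_z i) (mean_Dz p i x y z)
        ((1 + ol) * sigma1 + ol * l2norm (mean_Dz p i x y z) ^+ 2)].
Proof.
have [ou0 ol0 /(_ i) [cu cl]] := uc.
have [/(_ k i) [_ _ lX lY lZ] _] := fr.
have [ex ey ez] := oracle_estimators i.
pose A := at_sources i [:: SrcF; SrcG].
have AG : A (k, i, SrcG) by split=> //; rewrite !inE eqxx ?orbT.
have [ox oy oz] := measurable_oracles AG.
have AF : A (k, i, SrcF) by split=> //; rewrite !inE eqxx.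
have neq (c : source) : c \in [:: SrcX; SrcY; SrcZ] -> A `&` at_sources i [:: c] = set0.
  move=> cin; apply: at_sources_disjoint; rewrite /= !inE !orbF negb_or.
  by move: cin; rewrite !inE => /or3P[] /eqP ->; apply/andP; split; apply/eqP.
have incl (c : source) : at_sources i [:: c] (k, i, c) by split=> //; rewrite inE eqxx.
split.
- apply: (estimator_compress ou0 cu lX ex).
  apply: (independent_sources (neq SrcX _)); rewrite ?inE ?eqxx ?orbT//; first exact: ox.
  by have [_ _ + _ _] := measurable_sources (at_sources i [:: SrcX]) k i; apply.
- apply: (estimator_compress ol0 cl lY ey).
  apply: (independent_sources (neq SrcY _)); rewrite ?inE ?eqxx ?orbT//.
  by have [_ _ _ + _] := measurable_sources (at_sources i [:: SrcY]) k i; apply.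
- apply: (estimator_compress ol0 cl lZ ez).
  apply: (independent_sources (neq SrcZ _)); rewrite ?inE ?eqxx ?orbT//; first exact: oz.
  by have [_ _ _ _ +] := measurable_sources (at_sources i [:: SrcZ]) k i; apply.
Qed.

Lemma messages_independent i j : i != j ->
  [/\ independent_elements P (message_x i : W -> borel 'cV[R]_dx) (message_x j : W -> borel 'cV[R]_dx),
      independent_elements P (message_y i : W -> borel 'cV[R]_dy) (message_y j : W -> borel 'cV[R]_dy)
    & independent_elements P (message_z i : W -> borel 'cV[R]_dy) (message_z j : W -> borel 'cV[R]_dy)].
Proof.
move=> ij; have [mx my mz] := measurable_messages i; have [mx' my' mz'] := measurable_messages j.
have D : message_sources i `&` message_sources j = set0 by exact: at_sources_disjoint_worker.
by split; apply: (independent_sources D).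
Qed.

End FixedState.
End Fresh.

(** * The Lyapunov function *)

(** Independence across workers divides the variance by n: n errors of size at most B carry the
    weight (c/n)^2. *)
Lemma integral_avg_step (R : realType) d (W : measurableType d) (P : probability W R)
    m n (a : 'cV[R]_m) (c : R) (N : 'I_n -> W -> 'cV[R]_m) mu e B :
  (0 < n)%N -> (forall i, estimator P (N i) (mu i) (e i)) -> (forall i, e i <= B) ->
  (forall i j, i != j -> independent_elements P
     (N i : W -> borel 'cV[R]_m) (N j : W -> borel 'cV[R]_m)) ->
  (\int[P]_w (l2norm (a + (c / n%:R) *: \sum_i N i w)%R ^+ 2)%:E
   <= (l2norm (a + c *: avg mu) ^+ 2 + c ^+ 2 / n%:R * B)%:E)%E.
Proof.
move=> n0 Ne eB ind.
have iS : vec_sq_integrable P (fun w => a + (c / n%:R) *: \sum_i N i w).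
  move=> k; have iN i : sq_integrable P (fun w => N i w k 0) by case: (Ne i).
  have := sq_integrableD (sq_integrable_cst P (a k 0))
    (sq_integrableZ (c / n%:R) (sq_integrable_sum (index_enum 'I_n) (p := xpredT) (fun i _ => iN i))).
  by apply: eq_sq_integrable => w; rewrite !mxE summxE.
rewrite (integral_mean_sq iS) lee_fin (le_trans (mean_sq_estimator_sum _ _ Ne ind))//.
rewrite /avg scalerA lerD2l.
have nn : 0 < n%:R :> R by rewrite ltr0n.
have -> : c ^+ 2 / n%:R * B = (c / n%:R) ^+ 2 * \sum_(i < n) B.
  rewrite sumr_const card_ord -[B *+ n]mulr_natl; field; by rewrite gt_eqF.
by rewrite ler_wpM2l ?sqr_ge0// ler_sum.
Qed.

(** The bookkeeping of one step as linear arithmetic, where lz, l2 and kl stand for L^2 Z, L2sq Y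
    and kappa^2 L1sq Y. The z-decrease 22/3 lz covers the 27/4 lz of the h-step; the y-decrease
    covers the 27/4 l2 of the h-step and the 100/3 kl of the z-step. *)
Lemma lyapunov_combination (R : realType) (P' P0 A B' Z' X Xt Y Z G hh cu cv cw fx fy fz H lz l2 kl : R) :
  0 <= lz -> 0 <= kl ->
  A <= Xt - X + 9 / 4 * (3 * lz + 3 * l2) + G / 4 + cu * H + fx ->
  B' <= Y - 27 / 4 * (l2 + 25 * kl) + cv * H + fy ->
  Z' <= Z - 22 / 3 * lz + 100 / 3 * kl + cw * H + fz ->
  P' <= P0 - G - hh / 2 + X -> (cu + cv + cw) * H <= hh / 2 ->
  P' + (A + (B' + Z')) + 3 / 4 * G <= P0 + Xt + Y + Z + (fx + fy + fz).
Proof. by move=> *; lra. Qed.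

Ltac nonneg :=
  repeat first [assumption | apply: ltW; assumption | lazymatch goal with
  | |- is_true (0 <= _ + _) => apply: addr_ge0
  | |- is_true (0 <= _ * _) => apply: mulr_ge0
  | |- is_true (0 <= _ ^+ 2) => exact: sqr_ge0
  | |- is_true (0 <= _^-1) => rewrite invr_ge0
  | |- is_true (0 <= _%:R) => exact: ler0n
  | |- is_true (0 <= 1) => exact: ler01
  end].

Section Lyapunov.
Context {R : realType} {n dx dy : nat} {d_f d_g d_u d_l : measure_display}.
Context {Sf : measurableType d_f} {Sg : measurableType d_g}.
Context {Su : measurableType d_u} {Sl : measurableType d_l}.
Context {d : measure_display} {W : measurableType d}.
Variables (c : regularity R) (e : noise R) (a : parameters R).
Variables (P : probability W R) (p : problem R n dx dy Sf Sg).
Variables (C : compressors R n dx dy Su Sl) (r : randomness n Sf Sg Su Sl W).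
Hypothesis n_gt0 : (0 < n)%N.
Hypothesis dy_gt0 : (0 < dy)%N.
Hypothesis wp : well_posed p.
Hypothesis ct : continuity p c.
Hypothesis sc : strong_convexity p (mu_g c).
Hypothesis sn : stochastic_noise p (sigma e).
Hypothesis uc : unbiased_compression C (omega_u e) (omega_l e).
Hypothesis het : bounded_heterogeneity p (b_f e) (b_g e).
Hypothesis lip : lipschitz_constants p c.
Hypothesis Phi0 : forall x, 0 <= Phi p x.
Hypothesis fr : fresh_randomness P p C r.
Hypothesis alpha_gt0 : 0 < alpha a.
Hypothesis beta_gt0 : 0 < beta a.
Hypothesis gamma_gt0 : 0 < gamma a.
Hypothesis theta_gt0 : 0 < theta a.
Hypothesis rho_gt0 : 0 < rho a.

Local Notation mu := (mu_g c).
Local Notation L := (L_g c).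
Local Notation ys := (ystar p).
Local Notation zs := (zstar p).
Local Notation G x := (l2norm (grad (Phi p) x) ^+ 2).
Local Notation err_h x h := (l2norm (h - grad (Phi p) x) ^+ 2).

(* [parameter_bounds] without the divisions by omega, and with a non-strict
   bound on beta, which is attained by [parameter_choice] when the noise of the
   y-update vanishes. *)
Definition step_conditions : Prop :=
  [/\ beta a <= 2 / (mu + L) /\ 8 * omega_l e * L ^+ 2 * beta a <= mu * n%:R,
      gamma a <= L^-1 /\ 36 * omega_l e * L ^+ 2 * gamma a <= mu * n%:R,
      theta a <= 1 /\ 12 * omega_u e * theta a <= n%:R,
      C_f c / mu <= rho a
    & alpha a <= (2 * L_Phi c)^-1 /\ alpha a * C2inv c a <= 1].

(* The factors 9 and 8 make the decrease of the y- and z-errors dominate their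
   contributions to the h-step and, for the y-error, to the z-step. *)
Definition weight_y : R := 9 * Lmix c a / (beta a * mu).
Definition weight_z : R := 8 * L ^+ 2 / (gamma a * mu).

Definition lyapunov (s : iterate R dx dy) : R :=
  2 / alpha a * Phi p (it_x s) + err_h (it_x s) (it_h s) / theta a
  + weight_y * err_y p (it_x s) (it_y s) + weight_z * err_z p (it_x s) (it_z s).

(** The floors are the additive noise of the three updates, already multiplied by the weight that
    each error carries in [lyapunov]. *)
Definition floor_x : R := theta a / n%:R
  * ((1 + omega_u e) * sigma1sq e a + 6 * omega_u e * (b_f e ^+ 2 + rho a ^+ 2 * b_g e ^+ 2)).
Definition floor_y : R := 9 * Lmix c a * beta a / (mu * n%:R)
  * ((1 + omega_l e) * sigma e ^+ 2 + 2 * omega_l e * b_g e ^+ 2).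
Definition floor_z : R := 8 * L ^+ 2 * gamma a / (mu * n%:R)
  * ((1 + omega_l e) * sigma1sq e a + 6 * omega_l e * (b_f e ^+ 2 + rho a ^+ 2 * b_g e ^+ 2)).

Hypothesis cond : step_conditions.

Let mu_gt0 : 0 < mu. Proof. by case: sc. Qed.
Let muL : mu <= L. Proof. exact: (mu_le_L n_gt0 dy_gt0 wp ct sc). Qed.
Let L_gt0 : 0 < L. Proof. exact: lt_le_trans muL. Qed.
Let n0 : 0 < n%:R :> R. Proof. by rewrite ltr0n. Qed.
Let ou0 : 0 <= omega_u e. Proof. by case: uc. Qed.
Let ol0 : 0 <= omega_l e. Proof. by case: uc. Qed.

Lemma L1sq_ge0 : 0 <= L1sq c a.
Proof. by rewrite /L1sq; nonneg. Qed.

Lemma Lmix_ge0 : 0 <= Lmix c a.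
Proof. by have := L1sq_ge0; rewrite /Lmix /L2sq => L1_ge0; nonneg. Qed.

Let wy0 : 0 <= weight_y.
Proof. by have := Lmix_ge0; rewrite /weight_y => Lm; nonneg. Qed.
Let wz0 : 0 <= weight_z.
Proof. by rewrite /weight_z; nonneg. Qed.

Lemma lyapunov_ge0 s : 0 <= lyapunov s.
Proof.
have p0 : 0 <= 2 / alpha a * Phi p (it_x s) by rewrite mulr_ge0 ?divr_ge0 ?(ltW alpha_gt0).
by rewrite !addr_ge0// ?divr_ge0 ?sqr_ge0 ?(ltW theta_gt0)// mulr_ge0 ?sqr_ge0.
Qed.

Section OneStep.
Variables (k : nat) (s : iterate R dx dy).
Hypothesis z_rho : l2norm (it_z s) <= rho a.
Local Notation x := (it_x s).
Local Notation y := (it_y s).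
Local Notation z := (it_z s).
Local Notation h := (it_h s).
Local Notation x' := (it_x s - alpha a *: it_h s).
Local Notation H := (alpha a ^+ 2 * l2norm (it_h s) ^+ 2).
Local Notation D := (dev_x c p a (it_x s) (it_y s) (it_z s)).
Local Notation E2 := (b_f e ^+ 2 + rho a ^+ 2 * b_g e ^+ 2).

Let rhoC : C_f c / mu <= rho a. Proof. by case: cond. Qed.

Lemma expect_h :
  (\int[P]_w (l2norm (it_h (cm_soba_step p C a r w k s) - grad (Phi p) x')%R ^+ 2)%:E
   <= ((1 - theta a) * err_h x h + 2 * theta a * D + 2 * L_Phi c ^+ 2 * H / theta a
       + theta a ^+ 2 / n%:R * ((1 + omega_u e) * sigma1sq e a
           + omega_u e * (3 * D + 6 * E2 + 3 * G x)))%:E)%E.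
Proof.
have [_ _ [t1 _] _ _] := cond.
rewrite [leLHS](_ : _ = \int[P]_w (l2norm (((1 - theta a) *: h - grad (Phi p) x') + (theta a / n%:R) *: \sum_i message_x p C r k x y z i w)%R ^+ 2)%:E)%E; last first.
  by apply: eq_integral => w _; case: (s) => ? ? ? ?; rewrite /= addrAC.
apply: le_trans.
  apply: (integral_avg_step _ _ n_gt0 (mu := fun i => mean_Dx p i x y z)
    (e := fun i => (1 + omega_u e) * sigma1sq e a + omega_u e * l2norm (mean_Dx p i x y z) ^+ 2)
    (B := (1 + omega_u e) * sigma1sq e a + omega_u e * (3 * D + 6 * E2 + 3 * G x))).
  - by move=> i; have [] := message_estimators wp sn uc fr k x y z_rho i.
  - move=> i; rewrite lerD2l ler_wpM2l//.
    exact: (mean_Dx_bound n_gt0 dy_gt0 wp ct sc lip het rhoC).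
  - by move=> i j ij; have [] := messages_independent wp uc fr k x y z ij.
rewrite lee_fin lerD2r.
have := drift_h n_gt0 dy_gt0 wp ct sc lip rhoC x h y z theta_gt0 t1.
by rewrite addrAC.
Qed.

Lemma expect_y :
  (\int[P]_w (l2norm (it_y (cm_soba_step p C a r w k s) - ys x')%R ^+ 2)%:E
   <= ((1 - beta a * mu) * err_y p x y + L_ystar c ^+ 2 * H / (beta a * mu)
       + beta a ^+ 2 / n%:R * ((1 + omega_l e) * sigma e ^+ 2
           + omega_l e * (2 * L ^+ 2 * err_y p x y + 2 * b_g e ^+ 2)))%:E)%E.
Proof.
have [[bL _] _ _ _ _] := cond.
rewrite [leLHS](_ : _ = \int[P]_w (l2norm ((y - ys x') + (- beta a / n%:R) *: \sum_i message_y p C r k x y i w)%R ^+ 2)%:E)%E; last first.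
  by apply: eq_integral => w _; case: (s) => ? ? ? ?; rewrite /= mulNr scaleNr addrAC.
apply: le_trans.
  apply: (integral_avg_step _ _ n_gt0 (mu := fun i => mean_Dy p i x y)
    (e := fun i => (1 + omega_l e) * sigma e ^+ 2 + omega_l e * l2norm (mean_Dy p i x y) ^+ 2)
    (B := (1 + omega_l e) * sigma e ^+ 2 + omega_l e * (2 * L ^+ 2 * err_y p x y + 2 * b_g e ^+ 2))).
  - by move=> i; have [] := message_estimators wp sn uc fr k x y z_rho i.
  - move=> i; rewrite lerD2l ler_wpM2l//.
    exact: (mean_Dy_bound n_gt0 wp ct sc het).
  - by move=> i j ij; have [] := messages_independent wp uc fr k x y z ij.
rewrite lee_fin sqrrN lerD2r.
have := drift_y n_gt0 dy_gt0 wp ct sc lip x h y beta_gt0 bL.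
by rewrite scaleNr addrAC.
Qed.

Lemma expect_z :
  (\int[P]_w (l2norm (it_z (cm_soba_step p C a r w k s) - zs x')%R ^+ 2)%:E
   <= ((1 - gamma a * mu) * err_z p x z
       + (4 * gamma a ^+ 2 * L1sq c a * err_y p x y + 2 * L_zstar c ^+ 2 * H)
         / (gamma a * mu)
       + gamma a ^+ 2 / n%:R * ((1 + omega_l e) * sigma1sq e a
           + omega_l e * (3 * L ^+ 2 * err_z p x z + 6 * L1sq c a * err_y p x y + 6 * E2)))%:E)%E.
Proof.
have [_ [cL _] _ _ _] := cond.
have zr : l2norm (zs x') <= rho a.
  apply: le_trans rhoC.
  exact: (zstar_le n_gt0 dy_gt0 wp ct sc _ (C_f_ge0 n_gt0 dy_gt0 ct)).
apply: (@le_trans _ _ (\int[P]_w (l2norm ((z - zs x') + (- gamma a / n%:R) *: \sum_i message_z p C r k x y z i w)%R ^+ 2)%:E)%E).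
  apply: ge0_le_integral_setT => w; first by rewrite lee_fin sqr_ge0.
  rewrite lee_fin mulNr scaleNr addrAC.
  by move: zr; case: (s) => ? ? ? ? /= zr; exact: clip_nonexpansive.
apply: le_trans.
  apply: (integral_avg_step _ _ n_gt0 (mu := fun i => mean_Dz p i x y z)
    (e := fun i => (1 + omega_l e) * sigma1sq e a + omega_l e * l2norm (mean_Dz p i x y z) ^+ 2)
    (B := (1 + omega_l e) * sigma1sq e a + omega_l e * (3 * L ^+ 2 * err_z p x z + 6 * L1sq c a * err_y p x y + 6 * E2))).
  - by move=> i; have [] := message_estimators wp sn uc fr k x y z_rho i.
  - move=> i; rewrite lerD2l ler_wpM2l//.
    exact: (mean_Dz_bound n_gt0 dy_gt0 wp ct sc het rhoC).
  - by move=> i j ij; have [] := messages_independent wp uc fr k x y z ij.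
rewrite lee_fin sqrrN lerD2r.
have := drift_z n_gt0 dy_gt0 wp ct sc lip rhoC x h y z gamma_gt0 cL.
by rewrite scaleNr addrAC.
Qed.

End OneStep.

(** Compression adds 3 q (D0 + G0) with q = omega_u theta / n <= 1/12, hence 9/4 = 2 + 1/4 in front
    of D0 and 1/4 in front of G0. *)
Lemma weighted_h X D0 G0 H0 E0 S : 0 <= D0 -> 0 <= G0 ->
  ((1 - theta a) * X + 2 * theta a * D0 + 2 * L_Phi c ^+ 2 * H0 / theta a
   + theta a ^+ 2 / n%:R * ((1 + omega_u e) * S + omega_u e * (3 * D0 + 6 * E0 + 3 * G0)))
    / theta a
  <= X / theta a - X + 9 / 4 * D0 + G0 / 4 + 2 * L_Phi c ^+ 2 / theta a ^+ 2 * H0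
     + theta a / n%:R * ((1 + omega_u e) * S + 6 * omega_u e * E0).
Proof.
move=> D_ge0 G_ge0; have [_ _ [_ t12] _ _] := cond.
pose q := omega_u e * theta a / n%:R.
have q12 : 12 * q <= 1 by rewrite /q !mulrA ler_pdivrMr// mul1r.
rewrite [leLHS](_ : _ = X / theta a - X + 2 * D0 + 2 * L_Phi c ^+ 2 / theta a ^+ 2 * H0
    + theta a / n%:R * ((1 + omega_u e) * S + 6 * omega_u e * E0) + q * 3 * (D0 + G0)); last first.
  by rewrite /q; field; rewrite !gt_eqF.
have : 0 <= (1 - 12 * q) * (D0 + G0) by rewrite mulr_ge0 ?subr_ge0 ?addr_ge0.
lra.
Qed.

(** Compression takes back 18 q Lmix Y with q <= 1/8, and 9 - 18/8 = 27/4. *)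
Lemma weighted_y Y H0 A b : 0 <= Y ->
  weight_y * ((1 - beta a * mu) * Y + L_ystar c ^+ 2 * H0 / (beta a * mu)
    + beta a ^+ 2 / n%:R * ((1 + omega_l e) * A + omega_l e * (2 * L ^+ 2 * Y + 2 * b)))
  <= weight_y * Y - 27 / 4 * Lmix c a * Y
     + 9 * Lmix c a * L_ystar c ^+ 2 / (beta a ^+ 2 * mu ^+ 2) * H0
     + 9 * Lmix c a * beta a / (mu * n%:R) * ((1 + omega_l e) * A + 2 * omega_l e * b).
Proof.
move=> Y_ge0; have [[_ b8] _ _ _ _] := cond.
pose q := omega_l e * L ^+ 2 * beta a / (mu * n%:R).
have mn0 : 0 < mu * n%:R by exact: mulr_gt0.
have q8 : 8 * q <= 1 by rewrite /q mulrA ler_pdivrMr//; lra.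
rewrite [leLHS](_ : _ = weight_y * Y - 9 * Lmix c a * Y
     + 9 * Lmix c a * L_ystar c ^+ 2 / (beta a ^+ 2 * mu ^+ 2) * H0
     + 9 * Lmix c a * beta a / (mu * n%:R) * ((1 + omega_l e) * A + 2 * omega_l e * b)
     + q * 18 * (Lmix c a * Y)); last first.
  by rewrite /q /weight_y; field; rewrite !gt_eqF.
have : 0 <= (1 - 8 * q) * (Lmix c a * Y) by rewrite mulr_ge0 ?subr_ge0// mulr_ge0// Lmix_ge0.
lra.
Qed.

(** Here q <= 1/36 gives 8 - 24/36 = 22/3 for Z and 32 + 48/36 = 100/3 for Y; kappa >= 1 absorbs the
    48/36 into the kappa^2 term. *)
Lemma weighted_z Z Y H0 S E0 : 0 <= Z -> 0 <= Y ->
  weight_z * ((1 - gamma a * mu) * Z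
    + (4 * gamma a ^+ 2 * L1sq c a * Y + 2 * L_zstar c ^+ 2 * H0) / (gamma a * mu)
    + gamma a ^+ 2 / n%:R * ((1 + omega_l e) * S
        + omega_l e * (3 * L ^+ 2 * Z + 6 * L1sq c a * Y + 6 * E0)))
  <= weight_z * Z - 22 / 3 * L ^+ 2 * Z + 100 / 3 * kappa_g c ^+ 2 * L1sq c a * Y
     + 16 * L ^+ 2 * L_zstar c ^+ 2 / (gamma a ^+ 2 * mu ^+ 2) * H0
     + 8 * L ^+ 2 * gamma a / (mu * n%:R) * ((1 + omega_l e) * S + 6 * omega_l e * E0).
Proof.
move=> Z_ge0 Y_ge0; have [_ [_ g36] _ _ _] := cond.
pose q := omega_l e * L ^+ 2 * gamma a / (mu * n%:R).
have mn0 : 0 < mu * n%:R by exact: mulr_gt0.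
have q0 : 0 <= q.
  by rewrite /q; nonneg.
have q36 : 36 * q <= 1 by rewrite /q mulrA ler_pdivrMr//; lra.
rewrite [leLHS](_ : _ = weight_z * Z - 8 * L ^+ 2 * Z + 32 * kappa_g c ^+ 2 * L1sq c a * Y
     + 16 * L ^+ 2 * L_zstar c ^+ 2 / (gamma a ^+ 2 * mu ^+ 2) * H0
     + 8 * L ^+ 2 * gamma a / (mu * n%:R) * ((1 + omega_l e) * S + 6 * omega_l e * E0)
     + q * (24 * (L ^+ 2 * Z) + 48 * (L1sq c a * Y))); last first.
  by rewrite /q /weight_z /kappa_g; field; rewrite !gt_eqF.
have L1_ge0 := L1sq_ge0.
have k1 : 1 <= kappa_g c ^+ 2.
  rewrite -(expr1n _ 2) ler_pXn2r ?nnegrE ?divr_ge0 ?(ltW mu_gt0) ?(ltW L_gt0)//.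
  by rewrite ler_pdivlMr// mul1r.
have : 0 <= (1 - 36 * q) * (L ^+ 2 * Z) by rewrite mulr_ge0 ?subr_ge0// mulr_ge0 ?sqr_ge0.
have : 0 <= (1 - 36 * q) * (L1sq c a * Y) by rewrite mulr_ge0 ?subr_ge0// mulr_ge0.
have : 0 <= (kappa_g c ^+ 2 - 1) * (L1sq c a * Y) by rewrite mulr_ge0 ?subr_ge0// mulr_ge0.
lra.
Qed.

(** The coefficients 9 and 16 produced by the weights lie below the 26 and 78 of C_2, and alpha
    C_2^{-1} <= 1 leaves the factor 1/2. *)
Lemma step_coefficient H0 : 0 <= H0 ->
  (2 * L_Phi c ^+ 2 / theta a ^+ 2 + 9 * Lmix c a * L_ystar c ^+ 2 / (beta a ^+ 2 * mu ^+ 2)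
   + 16 * L ^+ 2 * L_zstar c ^+ 2 / (gamma a ^+ 2 * mu ^+ 2)) * (alpha a ^+ 2 * H0) <= H0 / 2.
Proof.
move=> H_ge0; have [_ _ _ _ [_ aC]] := cond.
set u := 2 * _ / _; set v := L_ystar c ^+ 2 / (beta a ^+ 2 * mu ^+ 2).
set w := L ^+ 2 * L_zstar c ^+ 2 / (gamma a ^+ 2 * mu ^+ 2).
have u0 : 0 <= u by rewrite /u; nonneg.
have v0 : 0 <= v by rewrite /v; nonneg.
have w0 : 0 <= w by rewrite /w; nonneg.
have Mv0 : 0 <= Lmix c a * v by rewrite mulr_ge0 ?Lmix_ge0.
have C2E : C2inv c a ^+ 2 = 2 * (u + 26 * (Lmix c a * v) + 78 * w).
  rewrite /C2inv sqr_sqrtr; first by rewrite /u /v /w; ring.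
  have := addr_ge0 (addr_ge0 u0 (mulr_ge0 (ler0n _ 26) Mv0)) (mulr_ge0 (ler0n _ 78) w0).
  move=> /(mulr_ge0 (ler0n _ 2)); congr (0 <= _); rewrite /u /v /w; ring.
have aC2 : alpha a ^+ 2 * C2inv c a ^+ 2 <= 1.
  by rewrite -exprMn -(expr1n _ 2) ler_pXn2r ?nnegrE ?mulr_ge0 ?sqrtr_ge0 ?(ltW alpha_gt0).
rewrite C2E in aC2.
have -> : 9 * Lmix c a * L_ystar c ^+ 2 / (beta a ^+ 2 * mu ^+ 2) = 9 * (Lmix c a * v).
  by rewrite /v; ring.
have -> : 16 * L ^+ 2 * L_zstar c ^+ 2 / (gamma a ^+ 2 * mu ^+ 2) = 16 * w by rewrite /w; ring.
have le1 : alpha a ^+ 2 * (u + 9 * (Lmix c a * v) + 16 * w) <= 1 / 2.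
  have : alpha a ^+ 2 * (u + 9 * (Lmix c a * v) + 16 * w)
    <= alpha a ^+ 2 * (u + 26 * (Lmix c a * v) + 78 * w).
    by rewrite ler_wpM2l ?sqr_ge0//; lra.
  lra.
have := ler_wpM2r H_ge0 le1; lra.
Qed.

Let lipPhi x1 x2 : l2norm (grad (Phi p) x1 - grad (Phi p) x2) <= L_Phi c * l2norm (x1 - x2).
Proof. by case: lip => _ /(_ x1 x2) []. Qed.
Let lip_ys x1 x2 : l2norm (ys x1 - ys x2) <= L_ystar c * l2norm (x1 - x2).
Proof. by case: lip => _ /(_ x1 x2) []. Qed.
Let lip_zs x1 x2 : l2norm (zs x1 - zs x2) <= L_zstar c * l2norm (x1 - x2).
Proof. by case: lip => _ /(_ x1 x2) []. Qed.

Section LyapunovMeasurable.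
Context {dV : measure_display} {V : measurableType dV} (s : V -> iterate R dx dy).
Hypothesis ms : measurable_iterate s.

Lemma measurable_Phi : measurable_fun setT (fun v => Phi p (it_x (s v))).
Proof.
have [mx _ _ _] := ms.
apply: (measurableT_comp (f := Phi p : borel 'cV[R]_dx -> R) _ mx).
apply: (@continuous_borel_measurable R 'cV[R]_dx).
exact: has_grad_continuous (has_grad_Phi n_gt0 dy_gt0 wp ct sc lip).
Qed.

Lemma measurable_grad_sqr : measurable_fun setT (fun v => G (it_x (s v))).
Proof.
have [mx _ _ _] := ms; apply: measurable_l2norm_sqr.
exact: (measurableT_comp (lipschitz_measurable lipPhi) mx).
Qed.

Lemma measurable_err_h : measurable_fun setT (fun v => err_h (it_x (s v)) (it_h (s v))).
Proof.
have [mx _ _ mh] := ms; apply/measurable_l2norm_sqr/measurable_mxB => //.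
exact: (measurableT_comp (lipschitz_measurable lipPhi) mx).
Qed.

Lemma measurable_err_y : measurable_fun setT (fun v => err_y p (it_x (s v)) (it_y (s v))).
Proof.
have [mx my _ _] := ms; apply/measurable_l2norm_sqr/measurable_mxB => //.
exact: (measurableT_comp (lipschitz_measurable lip_ys) mx).
Qed.

Lemma measurable_err_z : measurable_fun setT (fun v => err_z p (it_x (s v)) (it_z (s v))).
Proof.
have [mx _ mz _] := ms; apply/measurable_l2norm_sqr/measurable_mxB => //.
exact: (measurableT_comp (lipschitz_measurable lip_zs) mx).
Qed.

Lemma measurable_lyapunov : measurable_fun setT (fun v => lyapunov (s v)).
Proof.
apply: measurable_funD; last by apply: measurable_funM => //; exact: measurable_err_z.
apply: measurable_funD; last by apply: measurable_funM => //; exact: measurable_err_y.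
apply: measurable_funD; first by apply: measurable_funM => //; exact: measurable_Phi.
by apply: measurable_funM => //; exact: measurable_err_h.
Qed.

End LyapunovMeasurable.

Lemma measurable_randomness k i :
  [/\ measurable_fun setT (phi r k i), measurable_fun setT (xi r k i),
      measurable_fun setT (seed_x r k i), measurable_fun setT (seed_y r k i)
    & measurable_fun setT (seed_z r k i)].
Proof. by have [/(_ k i) [[? _] [? _] [? _] [? _] [? _]] _] := fr. Qed.

Definition total_floor : R := floor_x + floor_y + floor_z.

(** The decrease is written as a sum on the left, which keeps every term nonnegative and avoids
    subtraction of possibly infinite integrals. *)
Lemma one_step k s : l2norm (it_z s) <= rho a ->
  (\int[P]_w (lyapunov (cm_soba_step p C a r w k s))%:E + (3 / 4 * G (it_x s))%:E
   <= (lyapunov s + total_floor)%:E)%E.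
Proof.
move=> zr.
set st := fun w => cm_soba_step p C a r w k s.
have mst : measurable_iterate st.
  apply: (@measurable_step _ _ _ _ _ _ _ _ _ _ _ _ _ _ wp _ _ a uc _ _ r k _ (fun=> s)).
    exact: measurable_randomness.
  by split; exact: measurable_mx_cst.
(* The x-update uses the old h, so from a fixed state the new x is deterministic: the Phi-term is a
   constant and the three errors have fixed targets. *)
have sx w : it_x (st w) = it_x s - alpha a *: it_h s by rewrite /st; case: (s).
pose x' := it_x s - alpha a *: it_h s.
pose Qh w := l2norm (it_h (st w) - grad (Phi p) x') ^+ 2.
pose Qy w := l2norm (it_y (st w) - ys x') ^+ 2.
pose Qz w := l2norm (it_z (st w) - zs x') ^+ 2.
have mQh : measurable_fun setT Qh.
  by have := measurable_err_h mst; under eq_fun do rewrite sx.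
have mQy : measurable_fun setT Qy.
  by have := measurable_err_y mst; under eq_fun do rewrite /err_y sx.
have mQz : measurable_fun setT Qz.
  by have := measurable_err_z mst; under eq_fun do rewrite /err_z sx.
have E w : (lyapunov (st w))%:E
  = ((2 / alpha a * Phi p x')%:E + ((theta a)^-1%:E * (Qh w)%:E
      + (weight_y%:E * (Qy w)%:E + weight_z%:E * (Qz w)%:E)))%E.
  rewrite -!EFinM -!EFinD /lyapunov /err_y /err_z !sx; congr EFin.
  by rewrite -/x' -/(Qh w) -/(Qy w) -/(Qz w); ring.
under eq_integral do rewrite E.
have p0 : 0 <= 2 / alpha a * Phi p x' by rewrite mulr_ge0 ?divr_ge0 ?(ltW alpha_gt0).
have t0 : 0 <= (theta a)^-1 by rewrite invr_ge0 ltW.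
have q0 (u : R) (Q : W -> R) : 0 <= u -> (forall w, 0 <= Q w) -> forall w, (0 <= u%:E * (Q w)%:E)%E.
  by move=> u0 Q0 w; rewrite -EFinM lee_fin mulr_ge0.
have Qh0 w : 0 <= Qh w by exact: sqr_ge0.
have Qy0 w : 0 <= Qy w by exact: sqr_ge0.
have Qz0 w : 0 <= Qz w by exact: sqr_ge0.
have mE (u : R) (Q : W -> R) : measurable_fun setT Q -> measurable_fun setT (fun w => u%:E * (Q w)%:E)%E.
  by move=> mQ; apply: measurable_funeM; exact/measurable_EFinP.
have Zl (u : R) (Q : W -> R) : 0 <= u -> (forall w, 0 <= Q w) -> measurable_fun setT Q ->
    (\int[P]_w (u%:E * (Q w)%:E) = u%:E * \int[P]_w (Q w)%:E)%E.
  by move=> u0 Q0 mQ; rewrite ge0_integralZl//; [exact/measurable_EFinP|move=> w _; rewrite lee_fin].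
rewrite !ge0_integralD//; do ?[exact: mE|by move=> w _; rewrite ?adde_ge0 ?q0
  |by do ?[exact: mE|apply: emeasurable_funD]].
have -> : (\int[P]_w (2 / alpha a * Phi p x')%:E = (2 / alpha a * Phi p x')%:E)%E.
  apply: etrans (integral_cst P measurableT _) _.
  by apply: etrans (congr1 (fun u => _ * u)%E (probability_setT P)) _; rewrite mule1.
rewrite !Zl//.
have Ih := expect_h k zr; have Iy := expect_y k zr; have Iz := expect_z k zr.
set bh := ((1 - theta a) * _ + _ + _ + _) in Ih.
set by_ := ((1 - beta a * mu) * _ + _ + _) in Iy.
set bz := ((1 - gamma a * mu) * _ + _ + _) in Iz.
apply: (@le_trans _ _ ((2 / alpha a * Phi p x')%:E + ((theta a)^-1%:E * bh%:E
   + (weight_y%:E * by_%:E + weight_z%:E * bz%:E)) + (3 / 4 * G (it_x s))%:E)%E).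
  rewrite leeD2r// leeD2l// leeD//; first by rewrite lee_wpmul2l ?lee_fin.
  by rewrite leeD// lee_wpmul2l ?lee_fin.
rewrite -!EFinM -!EFinD lee_fin.
have rhoC : C_f c / mu <= rho a by case: cond.
have D0 := dev_x_ge0 n_gt0 dy_gt0 wp ct sc rhoC (it_x s) (it_y s) (it_z s).
have G0 : 0 <= G (it_x s) by exact: sqr_ge0.
have Y0 : 0 <= err_y p (it_x s) (it_y s) by exact: sqr_ge0.
have Z0 : 0 <= err_z p (it_x s) (it_z s) by exact: sqr_ge0.
have := @weighted_h (err_h (it_x s) (it_h s)) _ _ (alpha a ^+ 2 * l2norm (it_h s) ^+ 2)
  (b_f e ^+ 2 + rho a ^+ 2 * b_g e ^+ 2) (sigma1sq e a) D0 G0.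
rewrite -/bh => wh.
have := @weighted_y _ (alpha a ^+ 2 * l2norm (it_h s) ^+ 2) (sigma e ^+ 2) (b_g e ^+ 2) Y0.
rewrite -/by_ => wy.
have := @weighted_z _ _ (alpha a ^+ 2 * l2norm (it_h s) ^+ 2) (sigma1sq e a)
  (b_f e ^+ 2 + rho a ^+ 2 * b_g e ^+ 2) Z0 Y0.
rewrite -/bz => wz.
have aL : alpha a <= (2 * L_Phi c)^-1 by case: cond => _ _ _ _ [].
have dP := drift_Phi n_gt0 dy_gt0 wp ct sc lip (it_x s) (it_h s) alpha_gt0 aL.
have dP' : 2 / alpha a * Phi p x' <= 2 / alpha a * Phi p (it_x s) - G (it_x s)
    - l2norm (it_h s) ^+ 2 / 2 + err_h (it_x s) (it_h s).
  have := ler_wpM2l (_ : 0 <= 2 / alpha a) dP; rewrite divr_ge0 ?(ltW alpha_gt0)// => /(_ isT).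
  move=> /le_trans; apply; rewrite le_eqVlt; apply/orP; left; apply/eqP.
  by field; rewrite gt_eqF.
have sc' := step_coefficient (sqr_ge0 (l2norm (it_h s))).
rewrite /total_floor /floor_x /floor_y /floor_z /lyapunov.
rewrite [(theta a)^-1 * bh]mulrC.
apply: (@lyapunov_combination _ _ _ _ _ _ _ _ _ _ _ _ _ _ _ _ _ _ _ (L ^+ 2 * err_z p (it_x s) (it_z s))
  (L2sq c a * err_y p (it_x s) (it_y s))
  (kappa_g c ^+ 2 * L1sq c a * err_y p (it_x s) (it_y s)) _ _ _ _ _ dP' sc').
- by rewrite mulr_ge0 ?sqr_ge0.
- by rewrite mulr_ge0// mulr_ge0 ?sqr_ge0// L1sq_ge0.
- by apply: le_trans wh _; rewrite /dev_x -!mulrA.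
- apply: le_trans wy _; rewrite le_eqVlt; apply/orP; left; apply/eqP.
  by rewrite {1}/Lmix; ring.
- by apply: le_trans wz _; rewrite -!mulrA.
Qed.

Lemma total_floor_ge0 : 0 <= total_floor.
Proof.
have Lm := Lmix_ge0.
by rewrite /total_floor /floor_x /floor_y /floor_z /sigma1sq; nonneg.
Qed.

Local Notation salg := (sub_salg (source_events r)).

(* Along [f], the step is viewed over a sub-sigma-algebra or a product space. *)
Lemma measurable_step_along d' (V : measurableType d') (f : V -> W) k
    (s : V -> iterate R dx dy) :
  (forall i,
   [/\ measurable_fun setT (phi r k i \o f), measurable_fun setT (xi r k i \o f),
       measurable_fun setT (seed_x r k i \o f), measurable_fun setT (seed_y r k i \o f)
     & measurable_fun setT (seed_z r k i \o f)]) ->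
  measurable_iterate s ->
  measurable_iterate (fun v => cm_soba_step p C a r (f v) k (s v)).
Proof.
move=> mr ms.
(* The randomness pulled back along f lives on V, where the measurability of a step applies. *)
pose rf := Randomness (fun k i v => phi r k i (f v)) (fun k i v => xi r k i (f v))
  (fun k i v => seed_x r k i (f v)) (fun k i v => seed_y r k i (f v))
  (fun k i v => seed_z r k i (f v)).
exact: (@measurable_step _ _ _ _ _ _ _ _ _ _ _ _ _ _ wp _ _ a uc _ _ rf k mr _ ms).
Qed.

Variable s0 : iterate R dx dy.
Hypothesis z0_rho : l2norm (it_z s0) <= rho a.
Local Notation s_ k := (cm_soba p C a r s0 k).

(** Strict inequality: the sources of iteration k first act on the state of iteration k + 1. *)
Definition past (k : nat) : set (nat * 'I_n * source) := [set q | (q.1.1 < k)%N].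
Definition current (k : nat) : set (nat * 'I_n * source) := [set q | q.1.1 = k].

Lemma iterate_z_rho k w : l2norm (it_z (s_ k w)) <= rho a.
Proof. by case: k => //= k; case: (s_ k w) => ? ? ? ?; exact: clip_le. Qed.

Lemma measurable_cm_soba k : measurable_iterate (fun w : salg (past k) => s_ k w).
Proof.
elim: k => [|k IH]; first by split; exact: measurable_mx_cst.
have mS : past k `<=` past k.+1 by move=> q /= qk; exact: leqW.
apply: (@measurable_step_along _ (salg (past k.+1)) id k (s_ k)).
  move=> i; have [mF mG mX mY mZ] := measurable_sources r (past k.+1) k i.
  by split; [apply: mF|apply: mG|apply: mX|apply: mY|apply: mZ]; exact: ltnSn.
by have [mx my mz mh] := IH; split; exact: measurable_sub_salgS mS _.
Qed.

Lemma measurable_cm_sobaT k : measurable_iterate (s_ k).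
Proof.
have mE := source_events_measurable fr.
by have [mx my mz mh] := measurable_cm_soba k; split;
  apply: (measurable_from_sub_salg mE (A := past k)).
Qed.

(* The state at iteration k depends on [past k] only, and is independent of the
   randomness of the step, so that [one_step] may be applied state by state. *)
Lemma lyapunov_decrease k :
  (\int[P]_w (lyapunov (s_ k.+1 w))%:E + \int[P]_w (3 / 4 * G (it_x (s_ k w)))%:E
   <= \int[P]_w (lyapunov (s_ k w))%:E + total_floor%:E)%E.
Proof.
(* The first outcome drives the state, the second the step; on the diagonal this is the next
   potential. *)
pose F (q : W * W) := (lyapunov (cm_soba_step p C a r q.2 k (s_ k q.1)))%:E.
have mE := source_events_measurable fr.
have ET := source_eventsT r.
have EI := @source_eventsI _ _ _ _ _ _ _ _ _ _ _ r.
have ind : mutually_independent P (source_events r) by case: fr.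
have AA' : past k `&` current k = set0.
  by apply/seteqP; split => // q [] /=; rewrite /past/= => + qk; rewrite qk ltnn.
have mF : measurable_fun setT (F : salg (past k) * salg (current k) -> \bar R).
  apply/measurable_EFinP/measurable_lyapunov.
  apply: (@measurable_step_along _ (salg (past k) * salg (current k))%type snd k (s_ k \o fst)).
    move=> i; have [mF mG mX mY mZ] := measurable_sources r (current k) k i.
    by split; [exact: measurableT_comp (mF erefl) measurable_snd
      |exact: measurableT_comp (mG erefl) measurable_snd
      |exact: measurableT_comp (mX erefl) measurable_snd
      |exact: measurableT_comp (mY erefl) measurable_snd
      |exact: measurableT_comp (mZ erefl) measurable_snd].
  have [mx my mz mh] := measurable_cm_soba k.
  by split; [exact: measurableT_comp mx measurable_fst
    |exact: measurableT_comp my measurable_fst|exact: measurableT_comp mz measurable_fst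
    |exact: measurableT_comp mh measurable_fst].
have F0 q : (0 <= F q)%E by rewrite lee_fin lyapunov_ge0.
have [FE mI] := ge0_integral_decouple ET EI mE ind AA' mF F0.
have eq_leD (u v a' b' : \bar R) : u = v -> (v + a' <= b')%E -> (u + a' <= b')%E.
  by move=> ->.
apply: (eq_leD _ _ _ _ FE); clear FE mF.
have ms := measurable_cm_sobaT k.
have mG : measurable_fun setT (fun w => (3 / 4 * G (it_x (s_ k w)))%:E).
  by apply/measurable_EFinP; apply: measurable_funM => //; exact: measurable_grad_sqr.
have G0 w : (0 <= (3 / 4 * G (it_x (s_ k w)))%:E)%E by rewrite lee_fin mulr_ge0// sqr_ge0.
rewrite -ge0_integralD//; last by move=> w _; apply: integral_ge0 => w' _; exact: F0.
have f0 := total_floor_ge0.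
apply: (@le_trans _ _ (\int[P]_w ((lyapunov (s_ k w))%:E + total_floor%:E))%E); last first.
  rewrite ge0_integralD//; last 2 first.
  - by move=> w _; rewrite lee_fin lyapunov_ge0.
  - by apply/measurable_EFinP; exact: measurable_lyapunov.
  rewrite leeD2l// le_eqVlt; apply/orP; left; apply/eqP.
  apply: etrans (integral_cst P measurableT _) _.
  by apply: etrans (congr1 (fun u => _ * u)%E (probability_setT P)) _; rewrite mule1.
apply: ge0_le_integral_setT => w.
  by rewrite adde_ge0//; apply: integral_ge0 => w' _; exact: F0.
exact: (one_step k (iterate_z_rho k w)).
Qed.

Lemma lyapunov_sum K :
  (\int[P]_w (lyapunov (s_ K w))%:E + \sum_(k < K) \int[P]_w (3 / 4 * G (it_x (s_ k w)))%:E
   <= (lyapunov s0 + K%:R * total_floor)%:E)%E.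
Proof.
elim: K => [|K IH].
  rewrite big_ord0 adde0 mul0r addr0 /=.
  apply: le_trans; first exact: le_refl.
  rewrite le_eqVlt; apply/orP; left; apply/eqP.
  apply: etrans (integral_cst P measurableT _) _.
  by apply: etrans (congr1 (fun u => _ * u)%E (probability_setT P)) _; rewrite mule1.
rewrite big_ord_recr/= addeCA -/(s_ K.+1).
apply: (@le_trans _ _ (\sum_(k < K) \int[P]_w (3 / 4 * G (it_x (s_ k w)))%:E
   + (\int[P]_w (lyapunov (s_ K w))%:E + total_floor%:E))%E).
  by rewrite leeD2l//; exact: lyapunov_decrease.
rewrite addeA [X in (X + _)%E]addeC.
have -> : (lyapunov s0 + K.+1%:R * total_floor)%:E
   = ((lyapunov s0 + K%:R * total_floor)%:E + total_floor%:E)%E.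
  by rewrite -EFinD -natr1 mulrDl mul1r addrA.
by rewrite leeD2r.
Qed.

Lemma avg_grad_le K : (0 < K)%N ->
  (avg_grad P p C a r s0 K <= (4 / 3 * (lyapunov s0 / K%:R + total_floor))%:E)%E.
Proof.
move=> K0; have k0 : 0 < K%:R :> R by rewrite ltr0n.
have G0 k w : (0 <= (G (it_x (s_ k w)))%:E)%E by rewrite lee_fin sqr_ge0.
have mG k : measurable_fun setT (fun w => (G (it_x (s_ k w)))%:E).
  by apply/measurable_EFinP/measurable_grad_sqr; exact: measurable_cm_sobaT.
have S34 : (\sum_(k < K) \int[P]_w (3 / 4 * G (it_x (s_ k w)))%:E
   = (3 / 4)%:E * \sum_(k < K) 'E_P[fun w => G (it_x (s_ k w))])%E.
  rewrite ge0_sume_distrr; last first.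
    by move=> k _; rewrite unlock; apply: integral_ge0 => w _; exact: G0.
  apply: eq_bigr => k _; rewrite unlock -ge0_integralZl//.
have := lyapunov_sum K; rewrite S34 /avg_grad; set S := (\sum_(k < K) _)%E.
have S0 : (0 <= S)%E.
  by apply: sume_ge0 => k _; rewrite unlock; apply: integral_ge0 => w _; exact: G0.
have L0 : (0 <= \int[P]_w (lyapunov (s_ K w))%:E)%E.
  by apply: integral_ge0 => w _; rewrite lee_fin lyapunov_ge0.
move=> H; have {H} : ((3 / 4)%:E * S <= (lyapunov s0 + K%:R * total_floor)%:E)%E.
  by apply: le_trans H; rewrite leeDr.
have -> : (4 / 3 * (lyapunov s0 / K%:R + total_floor))%:E
  = ((K%:R^-1)%:E * ((4 / 3)%:E * (lyapunov s0 + K%:R * total_floor)%:E))%E.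
  by rewrite -!EFinM; congr EFin; field; rewrite gt_eqF.
move=> H; rewrite lee_pmul2l ?lte_fin ?invr_gt0//.
have := lee_wpmul2l (_ : 0 <= (4 / 3 : R)%:E)%E H.
by rewrite lee_fin muleA -EFinM (_ : 4 / 3 * (3 / 4) = 1 :> R) ?mul1e; [apply; lra|field].
Qed.

End Lyapunov.

(** * From parameters to the bound *)

Section StepConditions.
Context {R : realType}.
Variables (c : regularity R) (e : noise R) (a : parameters R) (n : nat).
Hypothesis n_gt0 : (0 < n)%N.
Hypothesis mu_gt0 : 0 < mu_g c.
Hypothesis L_gt0 : 0 < L_g c.
Hypothesis LPhi_gt0 : 0 < L_Phi c.
Hypothesis ou0 : 0 <= omega_u e.
Hypothesis ol0 : 0 <= omega_l e.
Local Notation mu := (mu_g c).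
Local Notation L := (L_g c).

Let n0 : 0 < n%:R :> R. Proof. by rewrite ltr0n. Qed.
Let mn0 : 0 < mu * n%:R. Proof. exact: mulr_gt0. Qed.
Let L2 : 0 < L ^+ 2. Proof. exact: exprn_gt0. Qed.

(** Removes the guard on omega: at omega = 0, where the bound is infinite, the cleared inequality is
    0 <= m. *)
Lemma omega_bound (m o u b : R) : 0 < b -> 0 < m -> 0 < u -> 0 <= o ->
  (o != 0 -> b <= m / (u * o)) -> u * o * b <= m.
Proof.
move=> b0 m0 u0; rewrite le_eqVlt => /predU1P[<- _|o0 H].
  by rewrite mulr0 mul0r ltW.
by have := H (lt0r_neq0 o0); rewrite ler_pdivlMr ?mulr_gt0// mulrC.
Qed.

Lemma step_conditions_of_bounds : 0 < beta a -> 0 < gamma a -> 0 < theta a ->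
  parameter_bounds c e a n -> step_conditions (n := n) c e a.
Proof.
move=> b0 g0 t0 [[b1 b2] [g1 g2] [t1 t2] r1].
rewrite le_min => /andP[a1 a2]; split=> //.
- split; first exact: ltW.
  rewrite [8 * _ * _]mulrAC.
  apply: (omega_bound b0 mn0) => // [|/b2 /ltW]; first exact: mulr_gt0.
  by rewrite [8 * _ * _]mulrAC.
- split=> //; rewrite [36 * _ * _]mulrAC.
  apply: (omega_bound g0 mn0) => // [|/g2]; first exact: mulr_gt0.
  by rewrite [36 * _ * _]mulrAC.
- by split=> //; apply: (omega_bound t0 n0).
- split=> //; have [->|C0] := eqVneq (C2inv c a) 0; first by rewrite mulr0.
  have C1 : 0 < C2inv c a by rewrite lt_def C0 sqrtr_ge0.
  by rewrite -ler_pdivlMr// mul1r.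
Qed.

Lemma mul_invD_le1 (u v : R) : 0 <= u -> 0 <= v -> u * (u + v)^-1 <= 1.
Proof.
move=> u0 v0; have [uv|uv] := eqVneq (u + v) 0; first by rewrite uv invr0 mulr0.
by rewrite ler_pdivrMr ?mul1r ?lerDl// lt_def uv addr_ge0.
Qed.

(** The shape of a tuned step size: its inverse contains the compression term w / m as a summand,
    which alone gives the cleared bound. *)
Lemma mul_invDD_le (u w m v : R) : 0 < m -> 0 <= u -> 0 <= w / m -> 0 <= v ->
  w * (u + w / m + v)^-1 <= m.
Proof.
move=> m0 u0 w0 v0; rewrite -[leRHS]mul1r -ler_pdivrMr// mulrAC.
by rewrite [u + _]addrC -addrA mul_invD_le1// addr_ge0.
Qed.

Lemma invD_le (u v : R) : 0 < u -> 0 <= v -> (u + v)^-1 <= u^-1.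
Proof. by move=> u0 v0; rewrite lef_pV2 ?posrE ?lerDl// ltr_wpDr. Qed.

Section Choice.
Variables (K : nat) (Dx Dy Dz : R).
Hypothesis choice : parameter_choice c e a n K Dx Dy Dz.

Local Notation Sx := (Num.sqrt (K%:R * noise_x c e a / (n%:R * Dx))).
Local Notation Sy := (Num.sqrt (2 * K%:R * noise_y e / (n%:R * Dy))).
Local Notation Sz := (Num.sqrt (3 * K%:R * noise_z c e a / (2 * n%:R * Dz))).

Let wy0 : 0 <= 8 * omega_l e * L ^+ 2 / (mu * n%:R).
Proof. by nonneg. Qed.
Let wz0 : 0 <= 36 * omega_l e * L ^+ 2 / (mu * n%:R).
Proof. by nonneg. Qed.
Let wx0 : 0 <= 12 * omega_u e / n%:R.
Proof. by nonneg. Qed.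
Let muL0 : 0 < (mu + L) / 2. Proof. by rewrite divr_gt0// addr_gt0. Qed.

Lemma step_conditions_of_choice : step_conditions (n := n) c e a.
Proof.
have [r1 aE bE gE tE] := choice; split; last first.
- have C0 : 0 <= C2inv c a by exact: sqrtr_ge0.
  have LP0 : 0 < 2 * L_Phi c by exact: mulr_gt0.
  by rewrite aE invD_le//; split=> //; rewrite mulrC addrC mul_invD_le1// ltW.
- by rewrite r1.
- rewrite tE; split.
    by rewrite -[leRHS]invr1 -addrA invD_le// addr_ge0// sqrtr_ge0.
  by rewrite mul_invDD_le// sqrtr_ge0.
- rewrite gE; split.
    by rewrite -addrA invD_le// addr_ge0// sqrtr_ge0.
  by rewrite mul_invDD_le ?sqrtr_ge0// ltW.
- rewrite bE; split.
    by rewrite -addrA -[leRHS]invf_div invD_le// addr_ge0// sqrtr_ge0.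
  by rewrite mul_invDD_le ?sqrtr_ge0// ltW.
Qed.

End Choice.
End StepConditions.

Section BoundRhs.
Context {R : realType} {n dx dy : nat} {d_f d_g d_u d_l : measure_display}.
Context {Sf : measurableType d_f} {Sg : measurableType d_g}.
Context {Su : measurableType d_u} {Sl : measurableType d_l}.
Context {d : measure_display} {W : measurableType d}.
Variables (c : regularity R) (e : noise R) (a : parameters R).
Variables (P : probability W R) (p : problem R n dx dy Sf Sg).
Variables (C : compressors R n dx dy Su Sl) (r : randomness n Sf Sg Su Sl W).
Variables (s0 : iterate R dx dy) (K : nat).
Hypothesis setting : cm_soba_setting c e a P p C r s0 K.

Lemma setting_facts :
  [/\ (0 < n)%N, (0 < K)%N, 0 < mu_g c, 0 < L_g c & 0 < L_Phi c]
  /\ [/\ 0 <= omega_u e, 0 <= omega_l e, 0 <= sigma e, 0 <= b_f e & 0 <= b_g e]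
  /\ [/\ 0 < alpha a, 0 < beta a, 0 < gamma a & 0 < theta a]
  /\ 0 <= Delta_Phi p s0.
Proof.
have [[n0 _ dy0 K0] [wp [ct [sc [[s_ge0 _] [uc [[[bf0 bg0] _] [[[LP0 _ _] _] [Phi0 [_ [[a0 b0 g0 t0 _] _]]]]]]]]]]]
  := setting.
have mu0 : 0 < mu_g c by case: sc.
have [ou0 ol0 _] := uc.
do ![split=> //]; last exact: Phi0.
exact: lt_le_trans (mu_le_L n0 dy0 wp ct sc).
Qed.

Lemma avg_grad_bound_rhs : step_conditions (n := n) c e a ->
  (avg_grad P p C a r s0 K
   <= (bound_rhs c e a n K (Delta_Phi p s0) (Delta_x p s0) (Delta_y p s0) (Delta_z p s0))%:E)%E.
Proof.
move=> cond.
have [[n0 _ dy0 K0] [wp [ct [sc [[_ sn] [uc [[_ het] [lip [Phi0 [fr [[a0 b0 g0 t0 r0] z0]]]]]]]]]]]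
  := setting.
apply: le_trans (avg_grad_le n0 dy0 wp ct sc sn uc het lip Phi0 fr a0 b0 g0 t0 r0 cond z0 K0) _.
have [[_ _ mu0 L0 _] [[ou0 ol0 s_ge0 bf0 bg0] [_ DP0]]] := setting_facts.
rewrite lee_fin.
have k0 : 0 < K%:R :> R by rewrite ltr0n.
have nn : 0 < n%:R :> R by rewrite ltr0n.
have Lm0 := Lmix_ge0 c a.
pose s1 := sigma1sq e a.
have s1_ge0 : 0 <= s1 by rewrite mulr_ge0 ?sqr_ge0// addr_ge0// sqr_ge0.
pose wx := theta a / n%:R.
pose wy := Lmix c a * beta a / (mu_g c * n%:R).
pose wz := L_g c ^+ 2 * gamma a / (mu_g c * n%:R).
(* The gap between the stated coefficients and 4/3 times those of the potential and its floors, as a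
   sum of nonnegative terms: 4 - 8/3, 2 - 4/3, 26 - 12, 52 - 32/3, and likewise for the noise. *)
rewrite -subr_ge0 [leRHS](_ : _ = 4 / 3 * (Delta_Phi p s0 / (alpha a * K%:R))
  + 2 / 3 * (Delta_x p s0 / (theta a * K%:R))
  + 14 * (Lmix c a * Delta_y p s0 / (beta a * mu_g c * K%:R))
  + 124 / 3 * (L_g c ^+ 2 * Delta_z p s0 / (gamma a * mu_g c * K%:R))
  + wx * (2 / 3 * (1 + omega_u e) * s1
      + 4 * omega_u e * (b_f e ^+ 2 + rho a ^+ 2 * b_g e ^+ 2))
  + wy * (40 * (1 + omega_l e) * sigma e ^+ 2 + 80 * omega_l e * b_g e ^+ 2)
  + wz * (202 / 3 * (1 + omega_l e) * s1
      + 248 * omega_l e * (b_f e ^+ 2 + rho a ^+ 2 * b_g e ^+ 2))).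
  by rewrite /wx /wy /wz /Delta_x /Delta_y /Delta_z; nonneg.
rewrite /lyapunov /total_floor /floor_x /floor_y /floor_z /weight_y /weight_z /err_y /err_z.
rewrite -/(Delta_Phi p s0) -/(Delta_x p s0) -/(Delta_y p s0) -/(Delta_z p s0).
by rewrite /bound_rhs /wx /wy /wz /s1; field; rewrite !gt_eqF.
Qed.

End BoundRhs.

(** * The rate *)

Section Rate.
Context {R : realType}.

(** * Balancing an initial error against a noise term *)

Section Balance.
Variables (nn kk t q k2 N D0 D S T : R).
Hypothesis nn0 : 0 < nn.
Hypothesis kk0 : 0 < kk.
Hypothesis q0 : 0 < q.
Hypothesis k20 : 0 <= k2.
Hypothesis N0 : 0 <= N.
Hypothesis D_ge0 : 0 <= D.
Hypothesis T0 : 0 <= T.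
Hypothesis S0 : 0 <= S.
Hypothesis SE0 : N = 0 -> S = 0.
Hypothesis SE : 0 < D0 -> S ^+ 2 * (nn * D0) = q * kk * N.
Hypothesis bal : balanced t N D0 D.
Hypothesis DN : D * N <= k2 * T ^+ 2.

Lemma ler_of_sqr (u v : R) : 0 <= v -> u ^+ 2 <= v ^+ 2 -> u <= v.
Proof.
move=> v0 uv; have [u0|/ltW u0] := leP 0 u; last exact: le_trans v0.
by rewrite -(ler_pXn2r (n := 2)) ?nnegrE.
Qed.

Let sqr_ratio : (T / Num.sqrt (nn * kk)) ^+ 2 = T ^+ 2 / (nn * kk).
Proof. by rewrite exprMn exprVn sqr_sqrtr// ltW// mulr_gt0. Qed.

Let ratio_ge0 : 0 <= T / Num.sqrt (nn * kk).
Proof. by rewrite divr_ge0// sqrtr_ge0. Qed.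

(** S is the square root in the inverse of a tuned step and N its noise. Substituting S^2 gives (D S
    / kk)^2 = (D / D0) (D N) q / (nn kk), and D / D0 <= t is where the balance of the initial errors
    is spent. *)
Lemma balanced_initial_le :
  D * S / kk <= Num.sqrt (q * t * k2) * (T / Num.sqrt (nn * kk)).
Proof.
have rhs_ge0 : 0 <= Num.sqrt (q * t * k2) * (T / Num.sqrt (nn * kk)).
  by rewrite mulr_ge0// sqrtr_ge0.
case: bal => [/SE0 ->|[d0 Dt]]; first by rewrite mulr0 mul0r.
have t0 : 0 <= t by rewrite -(pmulr_lge0 _ d0) (le_trans D_ge0).
apply: ler_of_sqr => //; rewrite [leRHS]exprMn sqr_ratio sqr_sqrtr; last first.
  by rewrite !mulr_ge0// ltW.
have -> : (D * S / kk) ^+ 2 = D / D0 * (D * N) * (q / (nn * kk)).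
  have -> : N = S ^+ 2 * (nn * D0) / (q * kk).
    by rewrite SE//; field; rewrite !gt_eqF.
  by field; rewrite !gt_eqF.
have -> : q * t * k2 * (T ^+ 2 / (nn * kk)) = t * (k2 * T ^+ 2) * (q / (nn * kk)).
  by field; rewrite !gt_eqF.
apply: ler_wpM2r; first by rewrite divr_ge0// ltW// mulr_gt0.
by apply: ler_pM; rewrite ?divr_ge0 ?mulr_ge0 ?(ltW d0)// ler_pdivrMr.
Qed.

(** For a step x <= 1/S, (x N / nn)^2 = (x S)^2 D0 N / (q nn kk), and D0 <= D is enough. *)
Lemma balanced_noise_le x : 0 <= x -> x * S <= 1 -> D0 <= D ->
  x * N / nn <= Num.sqrt (k2 / q) * (T / Num.sqrt (nn * kk)).
Proof.
move=> x0 xS D0D.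
have rhs_ge0 : 0 <= Num.sqrt (k2 / q) * (T / Num.sqrt (nn * kk)).
  by rewrite mulr_ge0// sqrtr_ge0.
case: bal => [->|[d0 Dt]]; first by rewrite mulr0 mul0r.
apply: ler_of_sqr => //; rewrite [leRHS]exprMn sqr_ratio sqr_sqrtr; last first.
  by rewrite divr_ge0// ltW.
have xS2 : (x * S) ^+ 2 <= 1 by rewrite expr_le1// mulr_ge0.
have -> : (x * N / nn) ^+ 2 = (x * S) ^+ 2 * ((D0 * N) / (q * nn * kk)).
  have -> : N = S ^+ 2 * (nn * D0) / (q * kk).
    by rewrite SE//; field; rewrite !gt_eqF.
  by field; rewrite !gt_eqF.
have -> : k2 / q * (T ^+ 2 / (nn * kk)) = 1 * (k2 * T ^+ 2 / (q * nn * kk)).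
  by field; rewrite !gt_eqF.
have q1 : 0 <= (q * nn * kk)^-1 by rewrite invr_ge0 !mulr_ge0// ltW.
apply: ler_pM => //; first exact: sqr_ge0.
  by apply: mulr_ge0 => //; apply: mulr_ge0 => //; exact: ltW.
by apply: ler_wpM2r => //; apply: le_trans DN; rewrite ler_wpM2r.
Qed.

End Balance.

Variable c : regularity R.
Hypothesis mu_gt0 : 0 < mu_g c.
Hypothesis L_gt0 : 0 < L_g c.
Hypothesis LPhi_gt0 : 0 < L_Phi c.
Local Notation mu := (mu_g c).
Local Notation L := (L_g c).
Local Notation rho0 := (C_f c / mu_g c).
(** [Lmix] depends on the parameters through rho only, so dummy values elsewhere make it a constant
    of the problem once rho = C_f / mu. *)
Local Notation Lam := (Lmix c (MkParameters 0 0 0 0 rho0)).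

Definition noise_factor : R := 6 * (1 + rho0 ^+ 2).

Variable t : R.
Definition const_x : R := 12 + Num.sqrt (1 * t * noise_factor).
Definition const_y : R := (mu + L) / 2 + 8 * L ^+ 2 / mu + Num.sqrt (2 * t * noise_factor).
Definition const_z : R := L + 36 * L ^+ 2 / mu + Num.sqrt (3 / 2 * t * noise_factor).
(** The value of [C2inv] for theta, beta and gamma equal to 1. *)
Definition const_C2 : R :=
  Num.sqrt (2 * (2 * L_Phi c ^+ 2 + 26 * Lam * L_ystar c ^+ 2 / mu ^+ 2
                 + 78 * L ^+ 2 * L_zstar c ^+ 2 / mu ^+ 2)).
(** Depends on the regularity constants and on t only, as the order notation demands. *)
Definition rate_const : R :=
  4 * (2 * L_Phi c + const_C2 * (const_x + const_y + const_z))
  + 2 * const_x + 26 * Lam / mu * const_y + 52 * L ^+ 2 / mu * const_z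
  + 52 * Lam / mu * Num.sqrt (noise_factor / 2) + 2 * Num.sqrt (noise_factor / 1)
  + 78 * L ^+ 2 / mu * Num.sqrt (noise_factor / (3 / 2)).

Variables (e : noise R) (a : parameters R) (n K : nat) (Dphi Dx Dy Dz D : R).
Hypothesis n_gt0 : (0 < n)%N.
Hypothesis K_gt0 : (0 < K)%N.
Hypothesis ou0 : 0 <= omega_u e.
Hypothesis ol0 : 0 <= omega_l e.
Hypothesis s_ge0 : 0 <= sigma e.
Hypothesis bf0 : 0 <= b_f e.
Hypothesis bg0 : 0 <= b_g e.
Hypothesis Dx0 : 0 <= Dx.
Hypothesis Dy0 : 0 <= Dy.
Hypothesis Dz0 : 0 <= Dz.
Hypothesis DphiD : Dphi <= D.
Hypothesis DxD : Dx <= D.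
Hypothesis DyD : Dy <= D.
Hypothesis DzD : Dz <= D.
Hypothesis choice : parameter_choice c e a n K Dx Dy Dz.
Hypothesis bal : balanced_errors c e a t Dx Dy Dz D.

Let n0 : 0 < n%:R :> R. Proof. by rewrite ltr0n. Qed.
Let k0 : 0 < K%:R :> R. Proof. by rewrite ltr0n. Qed.
Let D0 : 0 <= D. Proof. exact: le_trans DxD. Qed.
Let rhoE : rho a = rho0. Proof. by case: choice. Qed.
Let LamE : Lmix c a = Lam. Proof. by rewrite /Lmix /L2sq /L1sq rhoE. Qed.
Let nf0 : 0 <= noise_factor. Proof. by rewrite /noise_factor; nonneg. Qed.

Local Notation T := (Num.sqrt ((1 + omega_u e + omega_l e) * D) * sigma e
  + Num.sqrt ((omega_u e + omega_l e) * D) * (b_f e + b_g e)).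
Local Notation T' := (T / Num.sqrt (n%:R * K%:R)).
Local Notation V := ((1 + omega_u e / n%:R + omega_l e / n%:R) * D / K%:R).

Let T0 : 0 <= T.
Proof. by rewrite addr_ge0// mulr_ge0 ?sqrtr_ge0// addr_ge0. Qed.
Let T'0 : 0 <= T'. Proof. by rewrite divr_ge0// sqrtr_ge0. Qed.
Let oun : 0 <= omega_u e / n%:R. Proof. by rewrite divr_ge0// ltW. Qed.
Let oln : 0 <= omega_l e / n%:R. Proof. by rewrite divr_ge0// ltW. Qed.
Let DK : 0 <= D / K%:R. Proof. by rewrite divr_ge0// ltW. Qed.
Let V0 : 0 <= V.
Proof. by rewrite -mulrA mulr_ge0// !addr_ge0. Qed.

Let rateE : rate e n K D = T' + V. Proof. by []. Qed.

(** Squaring T produces the required squares plus nonnegative cross terms. *)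
Lemma noise_le_rate_sqr N :
  N <= noise_factor * ((1 + omega_u e + omega_l e) * sigma e ^+ 2
         + (omega_u e + omega_l e) * (b_f e ^+ 2 + b_g e ^+ 2)) ->
  D * N <= noise_factor * T ^+ 2.
Proof.
move=> HN; apply: (@le_trans _ _ (noise_factor * (D * ((1 + omega_u e + omega_l e) * sigma e ^+ 2
    + (omega_u e + omega_l e) * (b_f e ^+ 2 + b_g e ^+ 2))))).
  by rewrite mulrCA ler_wpM2l.
apply: ler_wpM2l => //; rewrite sqrrD !exprMn !sqr_sqrtr; last 2 first.
- by rewrite mulr_ge0// addr_ge0.
- by rewrite mulr_ge0// !addr_ge0.
have H1 : 0 <= Num.sqrt ((1 + omega_u e + omega_l e) * D) * sigma e
    * (Num.sqrt ((omega_u e + omega_l e) * D) * (b_f e + b_g e)).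
  by apply: mulr_ge0; apply: mulr_ge0; rewrite ?sqrtr_ge0// addr_ge0.
have H2 : 0 <= (omega_u e + omega_l e) * D * (b_f e * b_g e).
  by apply: mulr_ge0; apply: mulr_ge0 => //; rewrite addr_ge0.
move: H1 H2; move: (Num.sqrt _ * _ * _) => w; lra.
Qed.

Let sg2 : 0 <= sigma e ^+ 2. Proof. exact: sqr_ge0. Qed.
Let bf2 : 0 <= b_f e ^+ 2. Proof. exact: sqr_ge0. Qed.
Let bg2 : 0 <= b_g e ^+ 2. Proof. exact: sqr_ge0. Qed.
Let r2 : 0 <= rho0 ^+ 2. Proof. exact: sqr_ge0. Qed.
Let rsqE : C_f c ^+ 2 / mu ^+ 2 = rho0 ^+ 2.
Proof. by rewrite exprMn exprVn. Qed.

Lemma noise_bounds :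
  [/\ D * noise_x c e a <= noise_factor * T ^+ 2,
      D * noise_y e <= noise_factor * T ^+ 2
    & D * noise_z c e a <= noise_factor * T ^+ 2].
Proof.
have m2 (u v : R) : 0 <= u -> 0 <= v -> 0 <= u * v by exact: mulr_ge0.
have m3 (u v w : R) : 0 <= u -> 0 <= v -> 0 <= w -> 0 <= u * v * w.
  by move=> *; rewrite !mulr_ge0.
have := m2 _ _ ou0 sg2; have := m2 _ _ ol0 sg2; have := m2 _ _ ou0 bf2.
have := m2 _ _ ol0 bf2; have := m2 _ _ ou0 bg2; have := m2 _ _ ol0 bg2.
have := m2 _ _ r2 sg2.
have := m3 _ _ _ ou0 sg2 r2; have := m3 _ _ _ ol0 sg2 r2; have := m3 _ _ _ ou0 bf2 r2.
have := m3 _ _ _ ol0 bf2 r2; have := m3 _ _ _ ou0 bg2 r2; have := m3 _ _ _ ol0 bg2 r2.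
have sg2' := sg2.
move=> *; split; apply: noise_le_rate_sqr; rewrite /noise_x /noise_y /noise_z ?rsqE /sigma1sq ?rhoE /noise_factor; lra.
Qed.

Lemma noise_ge0 : [/\ 0 <= noise_x c e a, 0 <= noise_y e & 0 <= noise_z c e a].
Proof. by rewrite /noise_x /noise_y /noise_z rsqE /sigma1sq; split; nonneg. Qed.

Local Notation Sx := (Num.sqrt (K%:R * noise_x c e a / (n%:R * Dx))).
Local Notation Sy := (Num.sqrt (2 * K%:R * noise_y e / (n%:R * Dy))).
Local Notation Sz := (Num.sqrt (3 * K%:R * noise_z c e a / (2 * n%:R * Dz))).

Lemma SxE : 0 < Dx -> Sx ^+ 2 * (n%:R * Dx) = 1 * K%:R * noise_x c e a.
Proof.
have [Nx _ _] := noise_ge0; move=> d0; rewrite sqr_sqrtr; last first.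
  by rewrite divr_ge0// mulr_ge0// ltW.
by field; rewrite !gt_eqF.
Qed.

Lemma SyE : 0 < Dy -> Sy ^+ 2 * (n%:R * Dy) = 2 * K%:R * noise_y e.
Proof.
have [_ Ny _] := noise_ge0; move=> d0; rewrite sqr_sqrtr; last first.
  by rewrite divr_ge0// !mulr_ge0// ltW.
by field; rewrite !gt_eqF.
Qed.

Lemma SzE : 0 < Dz -> Sz ^+ 2 * (n%:R * Dz) = 3 / 2 * K%:R * noise_z c e a.
Proof.
have [_ _ Nz] := noise_ge0; move=> d0; rewrite sqr_sqrtr; last first.
  by rewrite divr_ge0// !mulr_ge0// ltW.
by field; rewrite !gt_eqF.
Qed.

(** The inverse of a tuned step splits into u, which contributes to the 1/K part of the rate, and
    the square root b, which contributes to the 1/sqrt(nK) part. *)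
Lemma initial_error_le_rate s b w u : 0 <= s -> 0 <= b -> 0 <= w ->
  u <= w * (1 + omega_u e / n%:R + omega_l e / n%:R) -> D * b / K%:R <= s * T' ->
  D * (u + b) / K%:R <= (w + s) * rate e n K D.
Proof.
move=> s0 b0 w0 uw Hs.
have : D / K%:R * u <= D / K%:R * (w * (1 + omega_u e / n%:R + omega_l e / n%:R)).
  by rewrite ler_wpM2l.
have : 0 <= s * V by exact: mulr_ge0.
have : 0 <= w * T' by exact: mulr_ge0.
rewrite rateE; move: Hs; move: T' => v.
have -> : V = D / K%:R * (1 + omega_u e / n%:R + omega_l e / n%:R) by ring.
have -> : D * (u + b) / K%:R = D / K%:R * u + D * b / K%:R by ring.
by move: (omega_u e / n%:R) (omega_l e / n%:R) (D / K%:R) (D * b / K%:R) => o1 o2 d1 d2; lra.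
Qed.

Lemma initial_errors_le :
  [/\ D / theta a / K%:R <= const_x * rate e n K D,
      D / beta a / K%:R <= const_y * rate e n K D
    & D / gamma a / K%:R <= const_z * rate e n K D].
Proof.
have [_ _ bE gE tE] := choice; have [bx by_ bz] := bal.
have [Nx Ny Nz] := noise_ge0; have [Bx By Bz] := noise_bounds.
split.
- rewrite tE invrK; apply: initial_error_le_rate; rewrite ?sqrtr_ge0//.
    have := oun; have := oln; rewrite -[12 * _ / _]mulrA.
    by move: (omega_u e / n%:R) (omega_l e / n%:R) => o1 o2; lra.
  apply: (balanced_initial_le n0 k0 _ nf0 Nx D0 T0 _ SxE bx Bx) => //.
  by move=> ->; rewrite mulr0 mul0r sqrtr0.
- rewrite bE invrK; apply: initial_error_le_rate; rewrite ?sqrtr_ge0//.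
  + by nonneg.
  + have p1 : 0 <= 8 * L ^+ 2 / mu by nonneg.
    have p2 : 0 <= (mu + L) / 2 by rewrite divr_ge0// addr_ge0// ltW.
    have -> : 8 * omega_l e * L ^+ 2 / (mu * n%:R) = 8 * L ^+ 2 / mu * (omega_l e / n%:R).
      by field; rewrite !gt_eqF.
    have := mulr_ge0 p1 oun; have := mulr_ge0 p2 oln; have := mulr_ge0 p2 oun.
    by move: (8 * _ / _) p1 ((mu + L) / 2) p2 => q1 p1 q2 p2; move: (omega_u e / n%:R) (omega_l e / n%:R) => o1 o2; lra.
  apply: (balanced_initial_le n0 k0 _ nf0 Ny D0 T0 _ SyE by_ By) => //.
  by move=> ->; rewrite mulr0 mul0r sqrtr0.
- rewrite gE invrK; apply: initial_error_le_rate; rewrite ?sqrtr_ge0//.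
  + by nonneg.
  + have p1 : 0 <= 36 * L ^+ 2 / mu by nonneg.
    have p2 : 0 <= L by exact: ltW.
    have -> : 36 * omega_l e * L ^+ 2 / (mu * n%:R) = 36 * L ^+ 2 / mu * (omega_l e / n%:R).
      by field; rewrite !gt_eqF.
    have := mulr_ge0 p1 oun; have := mulr_ge0 p2 oln; have := mulr_ge0 p2 oun.
    by move: (36 * _ / _) p1 => q1 p1; move: (omega_u e / n%:R) (omega_l e / n%:R) => o1 o2; lra.
  apply: (balanced_initial_le n0 k0 _ nf0 Nz D0 T0 _ SzE bz Bz) => //.
  by move=> ->; rewrite mulr0 mul0r sqrtr0.
Qed.

Lemma le_rate u s : 0 <= s -> u <= s * T' -> u <= s * rate e n K D.
Proof. by move=> s0 /le_trans; apply; rewrite ler_wpM2l// rateE lerDl. Qed.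

Lemma noise_terms_le :
  [/\ theta a * noise_x c e a / n%:R <= Num.sqrt (noise_factor / 1) * rate e n K D,
      beta a * noise_y e / n%:R <= Num.sqrt (noise_factor / 2) * rate e n K D
    & gamma a * noise_z c e a / n%:R <= Num.sqrt (noise_factor / (3 / 2)) * rate e n K D].
Proof.
have [_ _ bE gE tE] := choice; have [bx by_ bz] := bal.
have [Nx Ny Nz] := noise_ge0; have [Bx By Bz] := noise_bounds.
have inv_mul (u S : R) : 0 <= u -> 0 <= S -> (u + S)^-1 * S <= 1.
  by move=> u0 S0; rewrite mulrC addrC mul_invD_le1.
have wx : 0 <= 1 + 12 * omega_u e / n%:R by nonneg.
have wy : 0 <= (mu + L) / 2 + 8 * omega_l e * L ^+ 2 / (mu * n%:R) by nonneg.
have wz : 0 <= L + 36 * omega_l e * L ^+ 2 / (mu * n%:R) by nonneg.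
split; apply: le_rate; rewrite ?sqrtr_ge0//.
- apply: (balanced_noise_le n0 k0 _ nf0 Nx T0 _ SxE bx Bx) => //; rewrite tE ?invr_ge0 ?inv_mul ?sqrtr_ge0//.
  by rewrite addr_ge0 ?sqrtr_ge0.
- apply: (balanced_noise_le n0 k0 _ nf0 Ny T0 _ SyE by_ By) => //; rewrite bE ?invr_ge0 ?inv_mul ?sqrtr_ge0//.
  by rewrite addr_ge0 ?sqrtr_ge0.
- apply: (balanced_noise_le n0 k0 _ nf0 Nz T0 _ SzE bz Bz) => //; rewrite gE ?invr_ge0 ?inv_mul ?sqrtr_ge0//.
  by rewrite addr_ge0 ?sqrtr_ge0.
Qed.

Hypothesis beta_gt0 : 0 < beta a.
Hypothesis gamma_gt0 : 0 < gamma a.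
Hypothesis theta_gt0 : 0 < theta a.

Lemma Lam_ge0 : 0 <= Lam. Proof. exact: Lmix_ge0. Qed.

(** The square root of a weighted sum of squares is at most a constant times the sum. The cost of
    alpha is thereby reduced to the costs of theta, beta and gamma. *)
Lemma C2inv_le :
  C2inv c a <= const_C2 * ((theta a)^-1 + (beta a)^-1 + (gamma a)^-1).
Proof.
have it0 : 0 <= (theta a)^-1 by nonneg.
have ib0 : 0 <= (beta a)^-1 by nonneg.
have ig0 : 0 <= (gamma a)^-1 by nonneg.
have Lam0 := Lam_ge0.
have u0 : 0 <= 2 * L_Phi c ^+ 2 by nonneg.
have v0 : 0 <= 26 * Lam * L_ystar c ^+ 2 / mu ^+ 2 by nonneg.
have w0 : 0 <= 78 * L ^+ 2 * L_zstar c ^+ 2 / mu ^+ 2 by nonneg.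
have S0 : 0 <= (theta a)^-1 + (beta a)^-1 + (gamma a)^-1 by nonneg.
rewrite /C2inv /const_C2 LamE -(ger0_norm S0) -sqrtr_sqr -sqrtrM; last first.
  by rewrite mulr_ge0// !addr_ge0.
apply: ler_wsqrtr; rewrite -[leRHS]mulrA ler_wpM2l//.
have -> : 2 * L_Phi c ^+ 2 / theta a ^+ 2 = 2 * L_Phi c ^+ 2 * (theta a)^-1 ^+ 2.
  by rewrite exprVn.
have -> : 26 * Lam * L_ystar c ^+ 2 / (beta a ^+ 2 * mu ^+ 2)
  = 26 * Lam * L_ystar c ^+ 2 / mu ^+ 2 * (beta a)^-1 ^+ 2.
  by field; rewrite !gt_eqF.
have -> : 78 * L ^+ 2 * L_zstar c ^+ 2 / (gamma a ^+ 2 * mu ^+ 2)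
  = 78 * L ^+ 2 * L_zstar c ^+ 2 / mu ^+ 2 * (gamma a)^-1 ^+ 2.
  by field; rewrite !gt_eqF.
have sq_le (u : R) : 0 <= u -> u <= (theta a)^-1 + (beta a)^-1 + (gamma a)^-1 ->
    u ^+ 2 <= ((theta a)^-1 + (beta a)^-1 + (gamma a)^-1) ^+ 2.
  by move=> ? ?; rewrite ler_pXn2r ?nnegrE.
have H1 : (theta a)^-1 ^+ 2 <= ((theta a)^-1 + (beta a)^-1 + (gamma a)^-1) ^+ 2.
  by apply: sq_le => //; rewrite -addrA lerDl addr_ge0.
have H2 : (beta a)^-1 ^+ 2 <= ((theta a)^-1 + (beta a)^-1 + (gamma a)^-1) ^+ 2.
  by apply: sq_le => //; rewrite addrAC lerDr addr_ge0.
have H3 : (gamma a)^-1 ^+ 2 <= ((theta a)^-1 + (beta a)^-1 + (gamma a)^-1) ^+ 2.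
  by apply: sq_le => //; rewrite lerDr addr_ge0.
move: H1 H2 H3; move: ((_ + _ + _) ^+ 2) => S2 H1 H2 H3.
by rewrite [leRHS]mulrDl [X in _ <= X + _]mulrDl; apply: lerD; [apply: lerD|]; exact: ler_wpM2l.
Qed.

Lemma bound_rhs_rate :
  bound_rhs c e a n K Dphi Dx Dy Dz <= rate_const * rate e n K D.
Proof.
have [_ aE _ _ _] := choice.
have [Ix Iy Iz] := initial_errors_le; have [Nx Ny Nz] := noise_terms_le.
have C2le := C2inv_le.
have Lam0 := Lam_ge0.
have alpha_inv : (alpha a)^-1 = 2 * L_Phi c + C2inv c a by rewrite aE invrK.
(* With rho = C_f / mu the coefficients of sigma, b_f and b_g group exactly into the three noise
   levels: 104 = 52 * 2, 12 = 2 * 6 and 312 = 78 * 4. *)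
have -> : bound_rhs c e a n K Dphi Dx Dy Dz
  = 4 * (Dphi / K%:R * (alpha a)^-1) + 2 * (Dx / theta a / K%:R)
    + 26 * Lam / mu * (Dy / beta a / K%:R) + 52 * L ^+ 2 / mu * (Dz / gamma a / K%:R)
    + 52 * Lam / mu * (beta a * noise_y e / n%:R) + 2 * (theta a * noise_x c e a / n%:R)
    + 78 * L ^+ 2 / mu * (gamma a * noise_z c e a / n%:R).
  have a0 : 0 < alpha a by rewrite aE invr_gt0 ltr_wpDr ?sqrtr_ge0// mulr_gt0.
  rewrite /bound_rhs /noise_x /noise_y /noise_z LamE rhoE.
  by field; rewrite !gt_eqF.
have mono (u v x w : R) : 0 <= x -> 0 <= w -> u <= v -> u / x / w <= v / x / w.
  by move=> x0 w0 uv; rewrite !ler_wpM2r ?invr_ge0.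
have Jx : Dx / theta a / K%:R <= const_x * rate e n K D.
  by apply: le_trans Ix; apply: mono => //; exact: ltW.
have Jy : Dy / beta a / K%:R <= const_y * rate e n K D.
  by apply: le_trans Iy; apply: mono => //; exact: ltW.
have Jz : Dz / gamma a / K%:R <= const_z * rate e n K D.
  by apply: le_trans Iz; apply: mono => //; exact: ltW.
have J0 : D / K%:R <= rate e n K D.
  rewrite rateE; apply: (@le_trans _ _ V); last by rewrite lerDr.
  by rewrite -mulrA ler_peMl// -addrA lerDl addr_ge0.
have Ja : Dphi / K%:R * (alpha a)^-1
    <= (2 * L_Phi c + const_C2 * (const_x + const_y + const_z)) * rate e n K D.
  apply: (@le_trans _ _ (D / K%:R * (2 * L_Phi c + const_C2 * ((theta a)^-1 + (beta a)^-1 + (gamma a)^-1)))).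
    have C20 : 0 <= C2inv c a by exact: sqrtr_ge0.
    rewrite alpha_inv; apply: (@le_trans _ _ (D / K%:R * (2 * L_Phi c + C2inv c a))).
      apply: ler_wpM2r; first by rewrite addr_ge0// mulr_ge0// ltW.
      by rewrite ler_wpM2r// invr_ge0 ltW.
    by rewrite ler_wpM2l// lerD2l.
  have -> : D / K%:R * (2 * L_Phi c + const_C2 * ((theta a)^-1 + (beta a)^-1 + (gamma a)^-1))
    = 2 * L_Phi c * (D / K%:R)
      + const_C2 * (D / theta a / K%:R + D / beta a / K%:R + D / gamma a / K%:R) by ring.
  rewrite [leRHS]mulrDl -[const_C2 * _ * _]mulrA; apply: lerD.
    by rewrite ler_wpM2l// mulr_ge0// ltW.
  by rewrite ler_wpM2l ?sqrtr_ge0// [leRHS]mulrDl [X in _ <= X + _]mulrDl; do 2?apply: lerD.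
have L2 : 0 <= L ^+ 2 by exact: sqr_ge0.
have coef (q u : R) : 0 <= q -> 0 <= u -> 0 <= q * u / mu.
  by move=> q0 u0; apply/divr_ge0/ltW/mu_gt0; exact: mulr_ge0.
have -> : rate_const * rate e n K D
  = 4 * ((2 * L_Phi c + const_C2 * (const_x + const_y + const_z)) * rate e n K D)
    + 2 * (const_x * rate e n K D) + 26 * Lam / mu * (const_y * rate e n K D)
    + 52 * L ^+ 2 / mu * (const_z * rate e n K D)
    + 52 * Lam / mu * (Num.sqrt (noise_factor / 2) * rate e n K D)
    + 2 * (Num.sqrt (noise_factor / 1) * rate e n K D)
    + 78 * L ^+ 2 / mu * (Num.sqrt (noise_factor / (3 / 2)) * rate e n K D).
  by rewrite /rate_const; move: (rate _ _ _ _) => w; ring.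
by do 6?apply: lerD; apply: ler_wpM2l => //; exact: coef.
Qed.

End Rate.

Theorem theoremB14 (R : realType) (c : regularity R) :
  (forall (n dx dy : nat) (d_f d_g d_u d_l d : measure_display)
     (Sf : measurableType d_f) (Sg : measurableType d_g)
     (Su : measurableType d_u) (Sl : measurableType d_l)
     (W : measurableType d) (P : probability W R)
     (p : problem R n dx dy Sf Sg) (C : compressors R n dx dy Su Sl)
     (r : randomness n Sf Sg Su Sl W) (s0 : iterate R dx dy)
     (e : noise R) (a : parameters R) (K : nat),
     cm_soba_setting c e a P p C r s0 K ->
     parameter_bounds c e a n ->
     (avg_grad P p C a r s0 K
      <= (bound_rhs c e a n K (Delta_Phi p s0) (Delta_x p s0) (Delta_y p s0)
            (Delta_z p s0))%:E)%E)
  /\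
  (forall t : R, exists M : R,
   forall (n dx dy : nat) (d_f d_g d_u d_l d : measure_display)
     (Sf : measurableType d_f) (Sg : measurableType d_g)
     (Su : measurableType d_u) (Sl : measurableType d_l)
     (W : measurableType d) (P : probability W R)
     (p : problem R n dx dy Sf Sg) (C : compressors R n dx dy Su Sl)
     (r : randomness n Sf Sg Su Sl W) (s0 : iterate R dx dy)
     (e : noise R) (a : parameters R) (K : nat),
     cm_soba_setting c e a P p C r s0 K ->
     parameter_choice c e a n K (Delta_x p s0) (Delta_y p s0) (Delta_z p s0) ->
     balanced_errors c e a t (Delta_x p s0) (Delta_y p s0) (Delta_z p s0)
       (Delta p s0) ->
     (avg_grad P p C a r s0 K <= (M * rate e n K (Delta p s0))%:E)%E).
Proof.
split=> [n dx dy d_f d_g d_u d_l d Sf Sg Su Sl W P p C r s0 e a K st bounds|t].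
  have [[n0 K0 mu0 L0 LP0] [[ou0 ol0 _ _ _] [[_ b0 g0 t0] _]]] := setting_facts st.
  apply: (avg_grad_bound_rhs st); exact: step_conditions_of_bounds bounds.
exists (rate_const c t) => n dx dy d_f d_g d_u d_l d Sf Sg Su Sl W P p C r s0 e a K st choice bal.
have [[n0 K0 mu0 L0 LP0] [[ou0 ol0 s_ge0 bf0 bg0] [[_ b0 g0 t0] _]]] := setting_facts st.
have cond : step_conditions (n := n) c e a by exact: step_conditions_of_choice choice.
apply: le_trans (avg_grad_bound_rhs st cond) _.
rewrite lee_fin; apply: bound_rhs_rate bal _ _ _ => //; rewrite ?sqr_ge0//.
- by rewrite le_max lexx.
- by rewrite !le_max lexx orbT.
- by rewrite !le_max lexx !orbT.
- by rewrite !le_max lexx !orbT.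
Qed.
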